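(* Let $f$ be an analytic function on $\{z\in\mathbb{C}:\mathrm{Re}\,z>0\}$. Suppose there exists $p\in\mathbb{N}$ such that (1) $f'\in\mathcal{T}^{(p-1)}_{-2\pi,0;2\pi,0}$; (2) $\lim_{t\to\infty}f^{(p+1)}(t+\mathrm{i}\xi)=0$ ($t$ real), locally uniformly in $\xi\in\mathbb{R}$; (3) $\int_{-\infty}^{\infty}\mathrm{e}^{-2\pi|\xi|}|f(t+\mathrm{i}\xi)|\,\mathrm{d}\xi$ is locally bounded as a function of $t$, $\mathrm{Re}\,t>0$. Then, for $z\in\mathbb{C}$ with $\mathrm{Re}\,z>-1$, $$\frac{\mathrm{d}}{\mathrm{d}z}\left((\mathrm{MS})\text{-}\sum_{k=1}^{z}f(k)\right)=f(\mathrm{B})+(\mathrm{MS})\text{-}\sum_{k=1}^{z}f'(k).$$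
   Context: $\mathbb{N}=\{0,1,2,\dots\}$. **Müller–Schleicher (MS) fractional sum.** Let $U\subseteq\mathbb{C}$ with $U+1\subseteq U$ and $1\in U$, and $f:U\to\mathbb{C}$ (here $U=\{\mathrm{Re}\,z>0\}$). Suppose there is a sequence of polynomials $(P_n)_{n\in\mathbb{N}}$ such that: (i) the degrees of the $P_n$ are uniformly bounded; (ii) for all $y$ with $y+1\in U$ the limit $\lim_{n\to\infty}\left(\sum_{k=1}^n(f(k+y)-f(k))-P_n(y)\right)=:-Q(y)$ exists; (iii) for all $y$ with $y+1\in U$, $Q(y+1)-Q(y)=f(y+1)$. Then $(\mathrm{MS})\text{-}\sum_{k=x}^{y}f(k):=Q(y)-Q(x-1)$ for $x,y+1\in U$ (this does not depend on the choice of $(P_n)$). **The class $\mathcal{T}^{(p-1)}_{a,k;b,l}$.** It consists of the analytic functions $f$ on $\{\mathrm{Re}\,z>0\}$ such that: (1) for every $t\in\mathbb{C}$ with $\mathrm{Re}\,t>0$, $\xi\mapsto|f(t+\mathrm{i}\xi)|\mathrm{e}^{-b\xi}(1+|\xi|)^l$ is in $L^1(0,\infty)$, and $\lim_{\mathrm{Re}\,t\to\infty}\int_0^\infty\left|f(t+\mathrm{i}\xi)-\sum_{j=0}^{p-1}\frac{f^{(j)}(t)}{j!}(\mathrm{i}\xi)^j\right|\mathrm{e}^{-b\xi}(1+|\xi|)^l\,\mathrm{d}\xi=0$ locally uniformly with respect to $\mathrm{Im}\,t$; (2) for every $t\in\mathbb{C}$ with $\mathrm{Re}\,t>0$, $\xi\mapsto|f(t+\mathrm{i}\xi)|\mathrm{e}^{-a\xi}(1+|\xi|)^k$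 is in $L^1(-\infty,0)$, and $\lim_{\mathrm{Re}\,t\to\infty}\int_{-\infty}^0\left|f(t+\mathrm{i}\xi)-\sum_{j=0}^{p-1}\frac{f^{(j)}(t)}{j!}(\mathrm{i}\xi)^j\right|\mathrm{e}^{-a\xi}(1+|\xi|)^k\,\mathrm{d}\xi=0$ locally uniformly with respect to $\mathrm{Im}\,t$; (3) there are $s\in\mathbb{R}$ and a locally bounded $C:(0,\infty)\to[0,\infty)$ with $|f(z)|\le C(\mathrm{Re}\,z)\mathrm{e}^{s|\mathrm{Im}\,z|}$. For $p=0$ the sums over $j$ are empty. **Evaluation at the Bernoulli umbra $\mathrm{B}$.** Let $\mathcal{B}(w)=\frac{w\mathrm{e}^w}{\mathrm{e}^w-1}$ (with $\mathcal{B}(0)=1$) on $|\mathrm{Im}\,w|<2\pi$. For $\xi\in\mathbb{R}$, $s\in(0,1)$ put $\hat{\mathcal{B}}(\xi-\mathrm{i}s)=\frac{1}{\sqrt{2\pi}}\int_{-\infty}^{\infty}\mathcal{B}(x)\mathrm{e}^{-\mathrm{i}(\xi-\mathrm{i}s)x}\,\mathrm{d}x$. For $f$ analytic on $\{\mathrm{Re}\,w>0\}$, $$f(\mathrm{B}):=\frac{1}{\sqrt{2\pi}}\int_{-\infty-\mathrm{i}t}^{\infty-\mathrm{i}t}\hat{\mathcal{B}}(w)f(\mathrm{i}w)\,\mathrm{d}w,\qquad t\in(0,1).$$ This is defined when the integrand is Lebesgue integrable on the line for each such $t$ and $|f(w)|\le C(\mathrm{Re}\,w)\mathrm{e}^{s|\mathrm{Im}\,w|}$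 with $C$ locally bounded; the value is then independent of $t$. *)

(* Defs.v *)
From HB Require Import structures.
From mathcomp Require Import all_boot all_order all_algebra.
From mathcomp Require Import all_classical all_reals all_analysis.
From mathcomp Require Import complex.

Set Implicit Arguments.
Unset Strict Implicit.
Unset Printing Implicit Defensive.

Import Order.TTheory GRing.Theory Num.Theory.
Import numFieldNormedType.Exports.

Local Open Scope ring_scope.
Local Open Scope classical_set_scope.
Local Open Scope complex_scope.

(* R[i] is normed over itself, so [derivable], [derive1] and [is_derive] for
   functions R[i] -> R[i] are about complex differentiation. The library norm
   `|z| lies in R[i]; the modulus as a real number is [ComplexField.normc]. *)
HB.instance Definition _ (R : realType) := NormedModule.copy R[i] R[i]^o.

Notation modulus := ComplexField.Normc.normc.

Section Defs.
Variable R : realType.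
Implicit Types (f : R[i] -> R[i]) (a b k l : R) (p : nat) (t z w : R[i]).

Definition right_half_plane : set R[i] := [set z | 0 < complex.Re z].
Local Notation U := right_half_plane.

Definition cexp z : R[i] :=
  (expR (complex.Re z))%:C * (cos (complex.Im z) +i* sin (complex.Im z)).

Definition cintegrable (F : R -> R[i]) : Prop :=
  lebesgue_measure.-integrable setT (fun x => (complex.Re (F x))%:E) /\
  lebesgue_measure.-integrable setT (fun x => (complex.Im (F x))%:E).

Definition cintegral (F : R -> R[i]) : R[i] :=
  (\int[lebesgue_measure]_x complex.Re (F x)) +i*
  (\int[lebesgue_measure]_x complex.Im (F x)).

Definition analytic_on (D : set R[i]) f : Prop :=
  forall z0, D z0 -> exists c : nat -> R[i], exists2 r : R, 0 < r &
    forall z, modulus (z - z0) < r ->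
      series (fun n => c n * (z - z0) ^+ n) @ \oo --> f z.

Definition exp_growth f : Prop :=
  exists s : R, exists C : R -> R, [/\
    forall x : R, 0 < x -> 0 <= C x,
    forall x : R, 0 < x -> exists M : R, \forall y \near x, C y <= M &
    forall z, U z ->
      modulus (f z) <= C (complex.Re z) * expR (s * `|complex.Im z|)].

(* g x y tends to 0 as x tends to +oo, locally uniformly with respect to y *)
Definition cvg0_locally_uniformly (g : R -> R -> \bar R) : Prop :=
  forall y0 : R, exists2 V : set R, nbhs y0 V &
    forall e : R, 0 < e ->
      \forall x \near +oo, forall y, V y -> (`|g x y| < e%:E)%E.

Definition weight (c m xi : R) : R := expR (- c * xi) * (1 + `|xi|) `^ m.

Definition taylor_remainder p f t (xi : R) : R[i] :=
  f (t + xi *i) -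
  \sum_(0 <= j < p) (derive1n j f t / j`!%:R * (xi *i) ^+ j).

(* [class_T p a k b l] is the class with upper index p - 1: p is the number of
   terms of the Taylor polynomial (none if p = 0). *)
Definition class_T p a k b l f : Prop :=
  [/\ analytic_on U f,
   (forall t, U t -> lebesgue_measure.-integrable `]0, +oo[
      (fun xi : R => (modulus (f (t + xi *i)) * weight b l xi)%:E)) /\
   cvg0_locally_uniformly (fun x y =>
      \int[lebesgue_measure]_(xi in `]0%R, +oo[)
        (modulus (taylor_remainder p f (x +i* y) xi) * weight b l xi)%:E)%E,
   (forall t, U t -> lebesgue_measure.-integrable `]-oo, 0[
      (fun xi : R => (modulus (f (t + xi *i)) * weight a k xi)%:E)) /\
   cvg0_locally_uniformly (fun x y =>
      \int[lebesgue_measure]_(xi in `]-oo, 0%R[)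
        (modulus (taylor_remainder p f (x +i* y) xi) * weight a k xi)%:E)%E &
   exp_growth f].

Definition bernoulli_fun w : R[i] :=
  if w == 0 then 1 else w * cexp w / (cexp w - 1).

(* zeta = xi - i s with 0 < s < 1 *)
Definition bernoulli_hat (zeta : R[i]) : R[i] :=
  (Num.sqrt (2 * pi))^-1%:C *
  cintegral (fun x : R => bernoulli_fun x%:C * cexp (- ('i * zeta * x%:C))).

(* the integrand of f(B) on the line Im w = - t, parametrized by u = Re w *)
Definition umbra_integrand f (t u : R) : R[i] :=
  bernoulli_hat (u -i* t) * f ('i * (u -i* t)).

Definition umbra_integral f (t : R) : R[i] :=
  (Num.sqrt (2 * pi))^-1%:C * cintegral (umbra_integrand f t).

(* f(B) is defined and equal to v *)
Definition is_umbra_value f (v : R[i]) : Prop :=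
  [/\ exp_growth f,
      forall t : R, 0 < t < 1 -> cintegrable (umbra_integrand f t) &
      forall t : R, 0 < t < 1 -> umbra_integral f t = v].

Definition MS_partial f (P : nat -> {poly R[i]}) (y : R[i]) (n : nat) : R[i] :=
  (\sum_(1 <= k < n.+1) (f (k%:R + y) - f k%:R)) - (P n).[y].

Definition MS_Q f (P : nat -> {poly R[i]}) (y : R[i]) : R[i] :=
  - limn (MS_partial f P y).

Definition MS_sequence f (P : nat -> {poly R[i]}) : Prop :=
  [/\ exists d : nat, forall n, (size (P n) <= d)%N,
      forall y, U (y + 1) -> cvgn (MS_partial f P y) &
      forall y, U (y + 1) -> MS_Q f P (y + 1) - MS_Q f P y = f (y + 1)].

Definition MS_summable f : Prop := exists P, MS_sequence f P.

(* the value does not depend on the chosen P; meaningful if [MS_summable f] *)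
Definition MS_sum f (x y : R[i]) : R[i] :=
  let P := xget (fun _ : nat => 0 : {poly R[i]}) (MS_sequence f) in
  MS_Q f P y - MS_Q f P (x - 1).

End Defs.

(* Main.v *)
(* On the line Re = 1/2 the integral defining f(B) becomes the integral of f
   against the logistic density k(u) = pi / (2 cosh^2 (pi u)), because the
   Laplace transform of the Bernoulli function is pi^2 / sin^2 (pi c), as
   Herglotz' trick shows. Let G(w) = f(B + w). Moving the line of integration by
   one unit crosses the double pole of pi^2 / sin^2, whence
   G(w + 1) - G(w) = f'(w + 1). Let T_n be the Taylor polynomial of f at n of
   degree p and L(T_n)(y) = T_n(B + y). Integrating by parts against k turns the
   hypotheses on f' and f^(p+1) into G(n + y) - L(T_n)(y) -> 0, locally uniformly.
   Since the sum of f'(k + y) for k <= n telescopes to G(n + y) - G(y),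
   the polynomials L(T_n) - G(n) sum f', with Q = G - G(0). If S_n is the
   primitive of T_n, the sums of f(k + y) - f(k) minus L(S_n)(y) - L(S_n)(0) vanish at
   y = 0 and have derivatives converging to - G locally uniformly, so they
   converge to some - Q with Q' = G. Then Q(y + 1) - Q(y) - f(y + 1) is constant,
   and it vanishes at y = 0 by the shift formula for the polynomial S_n. Hence
   Q' = G = f(B) + (G - G(0)) is the claimed formula. *)

From HB Require Import structures.
Require Import Defs.
From mathcomp Require Import all_boot all_order all_algebra.
From mathcomp Require Import all_classical all_reals all_analysis.
From mathcomp Require Import measurable_realfun.
From mathcomp Require Import complex ring lra qpoly.
Set Implicit Arguments.
Unset Strict Implicit.
Unset Printing Implicit Defensive.
Import Order.TTheory GRing.Theory Num.Theory.
Import numFieldNormedType.Exports.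
Local Open Scope ring_scope.
Local Open Scope classical_set_scope.
Local Open Scope complex_scope.

(** * Modulus and complex derivatives *)

(** All contour arguments rest on one statement: two vertical lines of a strip carry the same
    integral of a holomorphic function. A rectangular contour would need pointwise decay on its
    horizontal edges, whereas the hypothesis on $f$ bounds only integrals, and [ker] decays exactly
    like the weight $e^{-2\pi|u|}$, without any margin. A quadratic cutoff replaces the edges and
    asks only for $L^1$ bounds uniform over the lines. The residue at the double pole reappears as
    the slope of the subtracted linear polynomial times the mass 1 of [ker]. The line Re = 1/2 is
    singled out because the kernel there is a positive density with the explicit primitive [sigm].
    Integration by parts then turns weighted control of $f' - T'$ into control of $f - T$: the $p$
    Taylor terms in the class condition on $f'$ are exactly those of $T'$ when $T$ has degree $p$.
    That condition concerns Taylor polynomials at the moving point $n + y + 1/2$, whose coefficients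
    depend on $y$. A polynomial in $y$ requires the fixed centre $n$; passing from one centre to the
    other is where $f^{(p+1)} \to 0$ enters. *)

Section Modulus.
Context {R : realType}.
Implicit Types (z w : R[i]) (x y : R).

Lemma modulusC z : `|z| = (modulus z)%:C.
Proof. by rewrite normc_def; case: z. Qed.

Lemma modulus_ge0 z : 0 <= modulus z.
Proof. by rewrite -lecR -modulusC; exact: normr_ge0. Qed.

Lemma modulusM z w : modulus (z * w) = modulus z * modulus w.
Proof. by apply: complexI; rewrite rmorphM -!modulusC normrM. Qed.

Lemma modulusX z n : modulus (z ^+ n) = modulus z ^+ n.
Proof. by apply: complexI; rewrite rmorphXn -!modulusC normrX. Qed.

Lemma modulusN z : modulus (- z) = modulus z.
Proof. by apply: complexI; rewrite -!modulusC normrN. Qed.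

Lemma modulusV z : modulus z^-1 = (modulus z)^-1.
Proof. by apply: complexI; rewrite fmorphV -!modulusC normfV. Qed.

Lemma modulusD z w : modulus (z + w) <= modulus z + modulus w.
Proof. by rewrite -lecR rmorphD -!modulusC ler_normD. Qed.

Lemma modulusB z w : modulus (z - w) <= modulus z + modulus w.
Proof. by rewrite -(modulusN w); exact: modulusD. Qed.

Lemma modulus_distC z w : modulus (z - w) = modulus (w - z).
Proof. by rewrite -modulusN opprB. Qed.

Lemma modulus0 : modulus (0 : R[i]) = 0.
Proof. by apply: complexI; rewrite -modulusC normr0. Qed.

Lemma modulus1 : modulus (1 : R[i]) = 1.
Proof. by apply: complexI; rewrite -modulusC normr1. Qed.

Lemma modulus_eq0 z : (modulus z == 0) = (z == 0).
Proof. by rewrite -(inj_eq (@complexI R)) -modulusC normr_eq0. Qed.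

Lemma modulus_gt0 z : (0 < modulus z) = (z != 0).
Proof. by rewrite lt_neqAle eq_sym modulus_eq0 modulus_ge0 andbT. Qed.

Lemma modulus_real x : modulus x%:C = `|x|.
Proof. by rewrite /= expr0n /= addr0 sqrtr_sqr. Qed.

Lemma modulus_imag x : modulus (x *i) = `|x|.
Proof. by rewrite /= expr0n /= add0r sqrtr_sqr. Qed.

Lemma modulus_nat n : modulus (n%:R : R[i]) = n%:R.
Proof. by rewrite -(rmorph_nat (real_complex R)) modulus_real ger0_norm. Qed.

Lemma sqr_modulus z : modulus z ^+ 2 = complex.Re z ^+ 2 + complex.Im z ^+ 2.
Proof. by case: z => a b /=; rewrite sqr_sqrtr// addr_ge0 ?sqr_ge0. Qed.

Lemma Re_le_modulus z : `|complex.Re z| <= modulus z.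
Proof.
case: z => a b /=; rewrite -sqrtr_sqr ler_wsqrtr// lerDl sqr_ge0 //.
Qed.

Lemma Im_le_modulus z : `|complex.Im z| <= modulus z.
Proof.
case: z => a b /=; rewrite -sqrtr_sqr ler_wsqrtr// lerDr sqr_ge0 //.
Qed.

Lemma modulus_le_ReIm z : modulus z <= `|complex.Re z| + `|complex.Im z|.
Proof.
case: z => a b /=; rewrite -[leRHS]ger0_norm ?addr_ge0// -[leRHS]sqrtr_sqr.
rewrite ler_wsqrtr// sqrrD !real_normK ?num_real// lerD2r lerDl.
by rewrite mulrn_wge0 ?mulr_ge0.
Qed.

Lemma complex_decomp z : z = complex.Re z +i* complex.Im z.
Proof. by case: z. Qed.

Lemma ReD z w : complex.Re (z + w) = complex.Re z + complex.Re w.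
Proof. by case: z; case: w. Qed.

Lemma ImD z w : complex.Im (z + w) = complex.Im z + complex.Im w.
Proof. by case: z; case: w. Qed.

Lemma ReN z : complex.Re (- z) = - complex.Re z.
Proof. by case: z. Qed.

Lemma ImN z : complex.Im (- z) = - complex.Im z.
Proof. by case: z. Qed.

Lemma ReM z w : complex.Re (z * w) =
  complex.Re z * complex.Re w - complex.Im z * complex.Im w.
Proof. by case: z; case: w. Qed.

Lemma ImM z w : complex.Im (z * w) =
  complex.Re z * complex.Im w + complex.Im z * complex.Re w.
Proof. by case: z; case: w. Qed.

(** A positive element of [R[i]] is a positive real, so the [R[i]]-valued radii of normed
    neighbourhoods can be traded for real ones. *)
Lemma nbhs_modulusP (z : R[i]) (A : set R[i]) :
  nbhs z A <-> exists2 d : R, 0 < d & forall w, modulus (w - z) < d -> A w.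
Proof.
split => [/nbhs_normP[e /= e0 eA]|[d d0 dA]].
  have [er ee] : e = (complex.Re e)%:C /\ 0 < complex.Re e.
    by move: e0; rewrite ltcE => /andP[/eqP /= i0 r0]; rewrite {1}[e]complex_decomp i0.
  exists (complex.Re e) => // w wz; apply: eA => /=.
  by rewrite distrC modulusC er ltcR.
apply/nbhs_normP; exists d%:C => /=; first by rewrite ltcR.
by move=> w /=; rewrite distrC modulusC ltcR; exact: dA.
Qed.

Lemma cvg_modulusP {T : Type} {F : set_system T} {FF : Filter F}
    (u : T -> R[i]) (l : R[i]) :
  u @ F --> l <-> forall e : R, 0 < e -> \forall t \near F, modulus (u t - l) < e.
Proof.
split => [ul e e0|ul].
  have /ul : nbhs l [set w | modulus (w - l) < e] by apply/nbhs_modulusP; exists e.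
  by [].
by move=> A /nbhs_modulusP[d d0 dA]; apply: filterS (ul _ d0) => t; exact: dA.
Qed.

End Modulus.

(** The remainder form needs no division and no exclusion of [h = 0]. Stating it over any
    [numFieldType] serves both [R] and [R[i]]. *)
Lemma is_derive1P {K : numFieldType} (f : K -> K) (z d : K) :
  is_derive z 1 f d <-> forall e : K, 0 < e ->
    \forall h \near 0, `|f (z + h) - f z - d * h| <= e * `|h|.
Proof.
have quot (h : K) : h != 0 ->
    `|d - h^-1 *: ((f \o shift z) (h *: 1) - f z)| * `|h| =
    `|f (z + h) - f z - d * h|.
  move=> h0; rewrite -normrM -normrN; congr `|_|.
  by rewrite /= /GRing.scale /= mulr1 (addrC h) mulrBl mulrAC mulVf// mul1r opprB.
split=> [[df dE] e e0|dP]; first rewrite -dE in quot *.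
  have /cvgrPdist_le/(_ _ e0) : h^-1 *: ((f \o shift z) (h *: 1) - f z)
    @[h --> 0^'] --> 'D_1 f z by exact: df.
  rewrite -/(derive f z 1) => H.
  move: H quot; rewrite near_withinE /= => H quot.
  apply: filterS H => h hle.
  have [->|h0] := eqVneq h 0; first by rewrite addr0 subrr mulr0 subr0 normr0 mulr0.
  by rewrite -quot// ler_wpM2r//; exact: hle.
suff H : h^-1 *: ((f \o shift z) (h *: 1) - f z) @[h --> 0^'] --> d.
  by apply: DeriveDef; [apply/cvg_ex; exists d|exact: cvg_lim].
apply/cvgrPdist_le => e e0; rewrite near_withinE; near=> h => h0.
rewrite -(@ler_pM2r _ `|h|) ?normr_gt0// quot//.
by near: h; exact: dP.
Unshelve. all: by end_near. Qed.

Section ComplexDerivative.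
Context {R : realType}.
Implicit Types (f g : R[i] -> R[i]) (z w a b d : R[i]).

(** Complex differentiability in terms of the real modulus: all estimates become inequalities in the
    totally ordered field [R], where [lra] and [nra] apply. *)
Definition cderiv f z d : Prop := forall e : R, 0 < e ->
  exists2 r : R, 0 < r & forall h, modulus h < r ->
    modulus (f (z + h) - f z - d * h) <= e * modulus h.

Definition ccont f z : Prop := forall e : R, 0 < e ->
  exists2 r : R, 0 < r & forall w, modulus (w - z) < r -> modulus (f w - f z) < e.

Lemma cderivP f z d : is_derive z 1 f d <-> cderiv f z d.
Proof.
rewrite (@is_derive1P R[i]); split=> fd e e0.
  have /(fd _) /nbhs_modulusP[r r0 H] : (0 : R[i]) < e%:C by rewrite ltcR.
  exists r => // h hr; have := H h; rewrite subr0 => /(_ hr).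
  by rewrite !modulusC -rmorphM lecR.
have [er ee] : e = (complex.Re e)%:C /\ 0 < complex.Re e.
  by move: e0; rewrite ltcE => /andP[/eqP /= i0 r0]; rewrite {1}[e]complex_decomp i0.
have [r r0 H] := fd _ ee.
apply/nbhs_modulusP; exists r => // h; rewrite subr0 => /H.
by rewrite er !modulusC -rmorphM lecR.
Qed.

Lemma cderiv_derive1 f z d : cderiv f z d -> f^`() z = d.
Proof. by move=> /cderivP H; rewrite derive1E; apply: derive_val. Qed.

Lemma cderiv_near f g z d (r : R) : 0 < r ->
  (forall w, modulus (w - z) < r -> f w = g w) -> cderiv f z d -> cderiv g z d.
Proof.
move=> r0 fg fd e e0; have [q q0 H] := fd e e0.
exists (Num.min r q); first by rewrite lt_min r0.
move=> h; rewrite lt_min => /andP[hr hq].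
rewrite -!fg; first exact: H.
  by rewrite subrr modulus0.
by rewrite addrC addKr.
Qed.

Lemma cderiv_ext f g z d : f =1 g -> cderiv f z d -> cderiv g z d.
Proof. by move=> fg; apply: (@cderiv_near _ _ _ _ 1). Qed.

Lemma cderiv_eq f z d d' : d = d' -> cderiv f z d -> cderiv f z d'.
Proof. by move=> ->. Qed.

Lemma cderiv_cst a z : cderiv (fun=> a) z 0.
Proof.
move=> e e0; exists 1 => // h _.
by rewrite subrr mul0r subr0 modulus0; apply: mulr_ge0; [exact: ltW|exact: modulus_ge0].
Qed.

Lemma cderiv_id z : cderiv id z 1.
Proof.
move=> e e0; exists 1 => // h _.
rewrite (_ : _ - _ = 0); last by rewrite /=; ring.
by rewrite modulus0; apply: mulr_ge0; [exact: ltW|exact: modulus_ge0].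
Qed.

Lemma cderivD f g z a b : cderiv f z a -> cderiv g z b ->
  cderiv (fun w => f w + g w) z (a + b).
Proof.
move=> fa gb e e0; have e20 : 0 < e / 2 by rewrite divr_gt0.
have [r r0 Hr] := fa _ e20; have [q q0 Hq] := gb _ e20.
exists (Num.min r q); first by rewrite lt_min r0.
move=> h; rewrite lt_min => /andP[hr hq].
rewrite (_ : _ - _ = (f (z + h) - f z - a * h) + (g (z + h) - g z - b * h)); last by ring.
rewrite (le_trans (modulusD _ _))// [leRHS](_ : _ = e / 2 * modulus h + e / 2 * modulus h);
  last by field.
by rewrite lerD ?Hr ?Hq.
Qed.

Lemma cderiv_ccont f z d : cderiv f z d -> ccont f z.
Proof.
move=> fd e e0; have [r r0 H] := fd 1 ltr01.
pose q := e / (modulus d + 2).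
have d0 : 0 < modulus d + 2 by rewrite ltr_wpDl// modulus_ge0.
exists (Num.min r q); first by rewrite lt_min r0 divr_gt0.
move=> w; rewrite lt_min => /andP[wr wq].
have := H (w - z) wr; rewrite mul1r (addrC z) subrK => Hw.
rewrite (_ : f w - f z = (f w - f z - d * (w - z)) + d * (w - z)); last by ring.
rewrite (le_lt_trans (modulusD _ _))// modulusM.
rewrite (@le_lt_trans _ _ ((modulus d + 1) * modulus (w - z)))//; first by lra.
rewrite (@le_lt_trans _ _ ((modulus d + 2) * modulus (w - z)))//.
  by rewrite ler_wpM2r ?modulus_ge0// lerD2l ler1n.
by rewrite mulrC -ltr_pdivlMr.
Qed.

(* The remainder of a product is [f(z+h) rg + g(z) rf + (f(z+h) - f(z)) b h]. *)
Lemma cderivM f g z a b : cderiv f z a -> cderiv g z b ->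
  cderiv (fun w => f w * g w) z (a * g z + f z * b).
Proof.
move=> fa gb e e0; have fc := cderiv_ccont fa.
pose A := modulus (f z) + 1; pose B := modulus (g z) + 1; pose D := modulus b + 1.
have A0 : 0 < A by rewrite ltr_wpDl// modulus_ge0.
have B0 : 0 < B by rewrite ltr_wpDl// modulus_ge0.
have D0 : 0 < D by rewrite ltr_wpDl// modulus_ge0.
have [r r0 Hr] := fa (e / 3 / B) (divr_gt0 (divr_gt0 e0 (ltr0n _ 3)) B0).
have [q q0 Hq] := gb (e / 3 / A) (divr_gt0 (divr_gt0 e0 (ltr0n _ 3)) A0).
have [s s0 Hs] := fc (e / 3 / D) (divr_gt0 (divr_gt0 e0 (ltr0n _ 3)) D0).
have [t t0 Ht] := fc 1 ltr01.
exists (Num.min (Num.min r q) (Num.min s t)); first by rewrite !lt_min r0 q0 s0 t0.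
move=> h; rewrite !lt_min => /andP[/andP[hr hq] /andP[hs ht]].
rewrite (_ : _ - _ = f (z + h) * (g (z + h) - g z - b * h) +
   (g z * (f (z + h) - f z - a * h) + (f (z + h) - f z) * (b * h))); last by ring.
have zh : z + h - z = h by rewrite addrC addKr.
have {}Hs := Hs (z + h); rewrite zh in Hs; have {}Hs := Hs hs.
have {}Ht := Ht (z + h); rewrite zh in Ht; have {}Ht := Ht ht.
have fA : modulus (f (z + h)) <= A.
  rewrite (_ : f (z + h) = f z + (f (z + h) - f z)); last by ring.
  by rewrite (le_trans (modulusD _ _))// lerD2l ltW.
have h0 := modulus_ge0 h.
have e1 : modulus (f (z + h) * (g (z + h) - g z - b * h)) <= e / 3 * modulus h.
  rewrite modulusM (le_trans (ler_pM (modulus_ge0 _) (modulus_ge0 _) fA (Hq _ hq)))//.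
  by rewrite mulrA mulrCA divff ?gt_eqF// mulr1.
have e2 : modulus (g z * (f (z + h) - f z - a * h)) <= e / 3 * modulus h.
  have gB : modulus (g z) <= B by rewrite lerDl.
  rewrite modulusM (le_trans (ler_pM (modulus_ge0 _) (modulus_ge0 _) gB (Hr _ hr)))//.
  by rewrite mulrA mulrCA divff ?gt_eqF// mulr1.
have e3 : modulus ((f (z + h) - f z) * (b * h)) <= e / 3 * modulus h.
  rewrite 2!modulusM mulrA ler_wpM2r//.
  have bD : modulus b <= D by rewrite lerDl.
  rewrite (le_trans (ler_pM (modulus_ge0 _) (modulus_ge0 _) (ltW Hs) bD))//.
  by rewrite divfK ?gt_eqF.
rewrite (le_trans (modulusD _ _))// (@le_trans _ _ (e / 3 * modulus h + (e / 3 * modulus h + e /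
  3 * modulus h)))//.
  by rewrite lerD// (le_trans (modulusD _ _))// lerD.
by rewrite le_eqVlt; apply/orP; left; apply/eqP; field.
Qed.

Lemma cderivZ f z a b : cderiv f z a -> cderiv (fun w => b * f w) z (b * a).
Proof.
move=> fa; have := cderivM (cderiv_cst b z) fa.
by rewrite mul0r add0r.
Qed.

Lemma cderivN f z a : cderiv f z a -> cderiv (fun w => - f w) z (- a).
Proof.
move=> /(@cderivZ _ _ _ (-1)); rewrite mulN1r.
by apply: cderiv_ext => w; rewrite mulN1r.
Qed.

Lemma cderivB f g z a b : cderiv f z a -> cderiv g z b ->
  cderiv (fun w => f w - g w) z (a - b).
Proof. by move=> fa /cderivN; exact: cderivD. Qed.

Lemma cderiv_sum (I : Type) (s : seq I) (F : I -> R[i] -> R[i]) (D : I -> R[i]) z :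
  (forall i, cderiv (F i) z (D i)) ->
  cderiv (fun w => \sum_(i <- s) F i w) z (\sum_(i <- s) D i).
Proof.
move=> FD; elim: s => [|i s IH].
  rewrite big_nil; apply: cderiv_ext (cderiv_cst 0 z) => w.
  by rewrite big_nil.
rewrite big_cons; apply: cderiv_ext (cderivD (FD i) IH) => w.
by rewrite big_cons.
Qed.

Lemma cderivX n z : cderiv (fun w => w ^+ n) z (n%:R * z ^+ n.-1).
Proof.
elim: n => [|n IH]; first by rewrite mul0r; exact: cderiv_cst.
have := cderivM (cderiv_id z) IH.
rewrite mul1r (_ : _ + _ = n.+1%:R * z ^+ n); last first.
  case: n {IH} => [|n]; first by rewrite mul0r mulr0 addr0 mul1r.
  by rewrite /= -[n.+2%:R]natr1 exprS; ring.
by apply: cderiv_ext => w; rewrite exprS.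
Qed.

Lemma cderiv_affine f z a b d : cderiv f (a + b * z) d ->
  cderiv (fun w => f (a + b * w)) z (b * d).
Proof.
move=> fd e e0.
have B0 : 0 < modulus b + 1 by rewrite ltr_wpDl// modulus_ge0.
have [r r0 H] := fd (e / (modulus b + 1)) (divr_gt0 e0 B0).
exists (r / (modulus b + 1)); first by rewrite divr_gt0.
move=> h hr.
have bh : modulus (b * h) <= (modulus b + 1) * modulus h.
  by rewrite modulusM ler_wpM2r ?modulus_ge0// lerDl.
have -> : f (a + b * (z + h)) - f (a + b * z) - b * d * h =
    f (a + b * z + b * h) - f (a + b * z) - d * (b * h).
  by rewrite mulrDr addrA (mulrC b d) -mulrA.
rewrite (le_trans (H _ _))//.
  by rewrite (le_lt_trans bh)// mulrC -ltr_pdivlMr.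
by rewrite -mulrA; apply: ler_wpM2l; [exact: ltW|rewrite ler_pdivrMl].
Qed.

Lemma cderiv_shift f z a d : cderiv f (a + z) d ->
  cderiv (fun w => f (a + w)) z d.
Proof.
rewrite -{1}(mul1r z) => /cderiv_affine; rewrite mul1r.
by apply: cderiv_ext => w; rewrite mul1r.
Qed.

Lemma cderivV f z d : f z != 0 -> cderiv f z d ->
  cderiv (fun w => (f w)^-1) z (- d / f z ^+ 2).
Proof.
move=> fz0 /cderivP fd; apply/cderivP.
have -> : - d / f z ^+ 2 = - (f z) ^- 2 *: 'D_1 f z.
  by rewrite derive_val /GRing.scale /= mulNr mulrC mulNr.
have dv : derivable f z 1 by exact: ex_derive.
by apply: DeriveDef; [exact: derivableV|exact: deriveV].
Qed.

End ComplexDerivative.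

Lemma rderivP {R : realType} (f : R -> R) (x d : R) :
  is_derive x 1 f d <-> forall e : R, 0 < e ->
    exists2 r : R, 0 < r & forall h, `|h| < r ->
      `|f (x + h) - f x - d * h| <= e * `|h|.
Proof.
rewrite (@is_derive1P R); split=> fd e e0.
  have /nbhs_normP[r /= r0 H] := fd e e0.
  by exists r => // h hr; apply: H; rewrite /= sub0r normrN.
have [r r0 H] := fd e e0; apply/nbhs_normP; exists r => //= h.
by rewrite /= sub0r normrN => /H.
Qed.

(** * Mean value inequality and Taylor's formula along complex segments *)

Section Paths.
Context {R : realType}.
Implicit Types (f g : R[i] -> R[i]) (z w a b d : R[i]).

Definition pderiv (F : R -> R[i]) (s : R) d : Prop :=
  is_derive s 1 (fun x => complex.Re (F x)) (complex.Re d) /\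
  is_derive s 1 (fun x => complex.Im (F x)) (complex.Im d).

Lemma cderiv_path f a b (s : R) d : cderiv f (a + s%:C * b) d ->
  pderiv (fun s : R => f (a + s%:C * b)) s (d * b).
Proof.
move=> fd.
have key e : 0 < e -> exists2 r : R, 0 < r & forall h : R, `|h| < r ->
    modulus (f (a + (s + h)%:C * b) - f (a + s%:C * b) - d * b * h%:C) <= e * `|h|.
  move=> e0.
  have B0 : 0 < modulus b + 1 by rewrite ltr_wpDl// modulus_ge0.
  have [r r0 H] := fd (e / (modulus b + 1)) (divr_gt0 e0 B0).
  exists (r / (modulus b + 1)); first by rewrite divr_gt0.
  move=> h hr.
  have hb : modulus (h%:C * b) <= `|h| * (modulus b + 1).
    by rewrite modulusM modulus_real ler_wpM2l// lerDl.
  have := H (h%:C * b).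
  rewrite (_ : d * (h%:C * b) = d * b * h%:C); last by ring.
  rewrite rmorphD mulrDl addrA => {}H; rewrite (le_trans (H _))//.
    by rewrite (le_lt_trans hb)// -ltr_pdivlMr.
  by rewrite mulrAC ler_pdivrMr// -mulrA ler_wpM2l// ltW.
split; apply/rderivP => e /key[r r0 H]; exists r => // h /H; apply: le_trans.
  rewrite (_ : _ - _ = complex.Re (f (a + (s + h)%:C * b) - f (a + s%:C * b) - d * b * h%:C)).
    exact: Re_le_modulus.
  by rewrite !ReD !ReN [complex.Re (d * b * _)]ReM /= mulr0 subr0.
rewrite (_ : _ - _ = complex.Im (f (a + (s + h)%:C * b) - f (a + s%:C * b) - d * b * h%:C)).
  exact: Im_le_modulus.
by rewrite !ImD !ImN [complex.Im (d * b * _)]ImM /= mulr0 add0r.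
Qed.

Lemma is_derive_continuous (f : R -> R) (x d : R) : is_derive x 1 f d -> {for x, continuous f}.
Proof. by move=> fd; apply/differentiable_continuous/derivable1_diffP; exact: ex_derive. Qed.

(** With $D = f(b) - f(a)$, the real function $\mathrm{Re}(\overline{D} f)$ along the segment has
    total increment $|D|^2$. The real mean value theorem bounds this by $|D| \cdot B|b - a|$, and
    one factor $|D|$ cancels. *)
Lemma complex_mean_value f g a b (B : R) :
  (forall s : R, 0 <= s <= 1 -> cderiv f (a + s%:C * (b - a)) (g (a + s%:C * (b - a)))) ->
  (forall s : R, 0 <= s <= 1 -> modulus (g (a + s%:C * (b - a))) <= B) ->
  modulus (f b - f a) <= B * modulus (b - a).
Proof.
move=> fg gB; pose D := f b - f a.
pose F (s : R) := complex.Re (conjc D * f (a + s%:C * (b - a))).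
pose F' (s : R) := complex.Re (conjc D * g (a + s%:C * (b - a)) * (b - a)).
have FF' (s : R) : 0 <= s <= 1 -> is_derive s 1 F (F' s).
  by move=> s01; have [] := cderiv_path (cderivZ (conjc D) (fg s s01)).
have [c c01 Fc] : exists2 c, c \in `]0, 1[%R & F 1 - F 0 = F' c * (1 - 0).
  apply: MVT => //.
    move=> s; rewrite in_itv/= => /andP[s0 s1]; apply: FF'.
    by rewrite !ltW.
  apply: derivable_within_continuous => s; rewrite in_itv/= => s01.
  by have := FF' s s01 => H; exact: ex_derive.
have {}c01 : 0 <= c <= 1 by move: c01; rewrite in_itv/= => /andP[? ?]; rewrite !ltW.
have JD : modulus (conjc D) = modulus D by case: (D) => x y /=; rewrite sqrrN.
have F10 : F 1 - F 0 = modulus D ^+ 2.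
  rewrite /F rmorph1 rmorph0 mul1r mul0r addr0 (addrC a) subrK -ReN -ReD -mulrBr -/D.
  by rewrite sqr_modulus; case: (D) => x y /=; rewrite mulNr opprK !expr2.
have F'B : F' c <= modulus D * (B * modulus (b - a)).
  rewrite (le_trans (ler_norm _))// (le_trans (Re_le_modulus _))// -mulrA !modulusM JD.
  rewrite ler_wpM2l ?modulus_ge0//.
  by rewrite ler_wpM2r ?modulus_ge0//; exact: gB.
rewrite -/D; have [->|D0] := eqVneq D 0.
  rewrite modulus0 mulr_ge0 ?modulus_ge0//.
  exact: le_trans (modulus_ge0 _) (gB _ c01).
rewrite -(@ler_pM2l _ (modulus D)) ?modulus_gt0//.
by rewrite -expr2 -F10 Fc subr0 mulr1.
Qed.

Lemma cderiv_taylor_sum (c : nat -> R[i]) a z n :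
  cderiv (fun w => \sum_(i < n.+1) c i / i`!%:R * (w - a) ^+ i) z
    (\sum_(i < n) c i.+1 / i`!%:R * (z - a) ^+ i).
Proof.
have X i : cderiv (fun w => (w - a) ^+ i) z (i%:R * (z - a) ^+ i.-1).
  have := @cderiv_shift R (fun w => w ^+ i) z (- a) _ (cderivX i _).
  by rewrite (addrC (- a)); apply: cderiv_ext => w; rewrite addrC.
have := cderiv_sum (index_enum 'I_n.+1) (fun i : 'I_n.+1 => cderivZ (c i / i`!%:R) (X i)).
apply: cderiv_eq.
rewrite big_ord_recl /= mul0r mulr0 add0r; apply: eq_bigr => i _.
rewrite /bump /= add1n factS natrM mulrA; congr (_ * _).
have i0 : (i.+1%:R : R[i]) != 0 by rewrite pnatr_eq0.
by rewrite invfM mulrA mulrAC divfK.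
Qed.

(** Induction on the order: the derivative of the remainder of [F 0] is the remainder of [F 1] of
    one order less, and the mean value inequality integrates the bound along the segment to the
    centre. The usual factor $1/n!$ is given up. *)
Lemma complex_taylor (S : set R[i]) a (B : R) n (F : nat -> R[i] -> R[i]) :
  S a -> (forall b, S b -> forall s : R, 0 <= s <= 1 -> S (a + s%:C * (b - a))) ->
  (forall j z, (j < n)%N -> S z -> cderiv (F j) z (F j.+1 z)) ->
  (forall z, S z -> modulus (F n z) <= B) ->
  forall b, S b ->
  modulus (F 0%N b - \sum_(i < n) F i a / i`!%:R * (b - a) ^+ i) <=
    B * modulus (b - a) ^+ n.
Proof.
move=> Sa star; elim: n F => [|n IH] F dF FB b Sb.
  by rewrite big_ord0 subr0 mulr1; exact: FB.
have B0 : 0 <= B by exact: le_trans (modulus_ge0 _) (FB _ Sa).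
pose r w := F 0%N w - \sum_(i < n.+1) F i a / i`!%:R * (w - a) ^+ i.
have ra : r a = 0.
  rewrite /r big_ord_recl big1 => [|i _]; last by rewrite subrr expr0n /= mulr0.
  by rewrite /= fact0 divr1 mulr1 addr0 subrr.
rewrite -[X in modulus X]/(r b) -[r b]subr0 -ra exprSr mulrA.
apply: (@complex_mean_value _
    (fun w => F 1%N w - \sum_(i < n) F i.+1 a / i`!%:R * (w - a) ^+ i)) => s s01.
  apply: cderivB; first by apply: dF => //; exact: star.
  exact: (@cderiv_taylor_sum (F ^~ a)).
have Ss := star b Sb s s01.
have := IH (fun j => F j.+1) (fun j z jn Sz => dF j.+1 z jn Sz) FB _ Ss.
rewrite (_ : a + _ - a = s%:C * (b - a)); last by rewrite addrC addKr.
move=> H; rewrite (le_trans H)// ler_wpM2l// lerXn2r ?nnegrE ?modulus_ge0//.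
rewrite modulusM modulus_real; have /andP[s0 s1] := s01.
by rewrite ger0_norm// ler_piMl ?modulus_ge0.
Qed.

End Paths.

(** * The complex exponential and its derivative *)

Section ComplexExp.
Context {R : realType}.
Implicit Types (z w : R[i]).

Lemma cexpD z w : cexp (z + w) = cexp z * cexp w.
Proof.
case: z => x y; case: w => x' y'; rewrite /cexp /=.
rewrite expRD cosD sinD; apply/eqP; rewrite eq_complex /=; apply/andP.
by split; apply/eqP; ring.
Qed.

Lemma cexp_real (x : R) : cexp x%:C = (expR x)%:C.
Proof. by rewrite /cexp /= cos0 sin0 mulr1. Qed.

Lemma cexp0 : cexp 0 = 1 :> R[i].
Proof. by rewrite (cexp_real 0) expR0. Qed.

Lemma modulus_cexp z : modulus (cexp z) = expR (complex.Re z).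
Proof.
rewrite /cexp modulusM modulus_real ger0_norm ?expR_ge0// /= cos2Dsin2 sqrtr1.
by rewrite mulr1.
Qed.

Lemma cexp_neq0 z : cexp z != 0.
Proof. by rewrite -modulus_gt0 modulus_cexp expR_gt0. Qed.

Lemma cexpN z : cexp (- z) = (cexp z)^-1.
Proof.
by apply: (mulfI (cexp_neq0 z)); rewrite -cexpD subrr cexp0 divff// cexp_neq0.
Qed.

Lemma cderiv_cexp0 : cderiv (@cexp R) 0 1.
Proof.
move=> e0 e00; pose e := Num.min e0 1.
have e_gt0 : 0 < e by rewrite lt_min e00 ltr01.
have ee0 : e <= e0 by rewrite ge_min lexx.
have e1 : e <= 1 by rewrite ge_min lexx orbT.
(* The real part will cost four shares [e / 16] and the imaginary part five, so nine sixteenths of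
   [e] are spent. *)
have e30 : 0 < e / 16 by rewrite divr_gt0.
have /rderivP/(_ _ e30)[r1 r10 H1] : is_derive (0 : R) 1 expR 1.
  by rewrite -[X in is_derive _ _ _ X](@expR0 R); exact: is_derive_expR.
have /rderivP/(_ _ e30)[r2 r20 H2] : is_derive (0 : R) 1 cos 0.
  by rewrite -[X in is_derive _ _ _ X]oppr0 -[X in - X](@sin0 R); exact: is_derive_cos.
have /rderivP/(_ _ e30)[r3 r30 H3] : is_derive (0 : R) 1 sin 1.
  by rewrite -[X in is_derive _ _ _ X](@cos0 R); exact: is_derive_sin.
pose r := Num.min (Num.min r1 r2) (Num.min r3 (e / 16)).
exists r; first by rewrite !lt_min r10 r20 r30 e30.
move=> h; rewrite !lt_min => /andP[/andP[h1 h2] /andP[h3 h5]].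
rewrite add0r mul1r cexp0.
have xh := Re_le_modulus h; have yh := Im_le_modulus h.
have m0 := modulus_ge0 h.
apply: (le_trans (modulus_le_ReIm _)).
move: m0 h1 h2 h3 h5 xh yh; set m := modulus h => m0 h1 h2 h3 h5.
case: h @m m0 h1 h2 h3 h5 => x y m m0 h1 h2 h3 h5 xh yh.
have {}xh : `|x| <= m := xh; have {}yh : `|y| <= m := yh.
have := H1 x (le_lt_trans xh h1); rewrite add0r expR0 mul1r => {}H1.
have := H2 y (le_lt_trans yh h2); rewrite add0r cos0 mul0r subr0 => {}H2.
have := H3 y (le_lt_trans yh h3); rewrite add0r sin0 mul1r subr0 => {}H3.
have c1 : `|expR x - 1 - x| <= e / 16 * m by rewrite (le_trans H1)// ler_wpM2l// ltW.
have c2 : `|cos y - 1| <= e / 16 * m by rewrite (le_trans H2)// ler_wpM2l// ltW.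
have c3 : `|sin y - y| <= e / 16 * m by rewrite (le_trans H3)// ler_wpM2l// ltW.
have em : e / 16 * m <= m by nra.
have ex1 : `|expR x - 1| <= 2 * m.
  rewrite (_ : expR x - 1 = (expR x - 1 - x) + x); last by ring.
  by rewrite (le_trans (ler_normD _ _))//; lra.
have ex3 : expR x <= 3.
  have : expR x - 1 <= 2 * m by rewrite (le_trans (ler_norm _)).
  lra.
have ex0 := expR_ge0 x.
have -> : complex.Re (cexp (x +i* y) - 1 - (x +i* y)) = expR x * cos y - 1 - x.
  by rewrite /cexp /=; ring.
have -> : complex.Im (cexp (x +i* y) - 1 - (x +i* y)) = expR x * sin y - y.
  by rewrite /cexp /=; ring.
have e5 : `|expR x * cos y - 1 - x| <= 4 * (e / 16 * m).
  rewrite (_ : _ - x = (expR x - 1 - x) + expR x * (cos y - 1)); last by ring.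
  rewrite (le_trans (ler_normD _ _))// normrM (ger0_norm ex0).
  have : expR x * `|cos y - 1| <= 3 * (e / 16 * m) by apply: ler_pM.
  lra.
have e6 : `|expR x * sin y - y| <= 5 * (e / 16 * m).
  rewrite (_ : _ - y = (expR x - 1) * y + expR x * (sin y - y)); last by ring.
  rewrite (le_trans (ler_normD _ _))// !normrM (ger0_norm ex0).
  have : expR x * `|sin y - y| <= 3 * (e / 16 * m) by apply: ler_pM.
  have : `|expR x - 1| * `|y| <= (2 * m) * m by apply: ler_pM.
  have : (2 * m) * m <= 2 * (e / 16 * m) by nra.
  lra.
have : e * m <= e0 * m by rewrite ler_wpM2r.
have : 0 <= e / 16 * m by rewrite mulr_ge0// ltW.
rewrite -/m; lra.
Qed.

Lemma cderiv_cexp z : cderiv (@cexp R) z (cexp z).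
Proof.
have := @cderiv_shift R (fun w => cexp z * cexp w) z (- z) (cexp z * 1).
rewrite addNr mulr1 => /(_ _); rewrite -[X in cderiv _ 0 X]mulr1.
move=> H; apply: cderiv_ext (H (cderivZ _ cderiv_cexp0)) => w.
by rewrite -cexpD addrA subrr add0r.
Qed.

Lemma cderiv_cexpZ a z : cderiv (fun w => cexp (a * w)) z (a * cexp (a * z)).
Proof.
have := @cderiv_affine R (@cexp R) z 0 a (cexp (a * z)).
rewrite add0r => /(_ (cderiv_cexp _)).
by apply: cderiv_ext => w; rewrite add0r.
Qed.

End ComplexExp.

(** * Complex sequences and power series *)

Section ComplexSequences.
Context {R : realType}.
Implicit Types (u : nat -> R[i]) (l : R[i]).

Lemma cvgn_modulusP u l : u @ \oo --> l <->
  forall e : R, 0 < e -> exists N, forall n, (N <= n)%N -> modulus (u n - l) < e.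
Proof.
split=> [/cvg_modulusP ul e e0|ul].
  by have [N _ H] := ul e e0; exists N => n Nn; exact: H.
apply/cvg_modulusP => e e0; have [N H] := ul e e0.
by exists N => // n /= Nn; exact: H.
Qed.

Lemma cvgn_ReIm u (a b : R) :
  (fun n => complex.Re (u n)) @ \oo --> a -> (fun n => complex.Im (u n)) @ \oo --> b ->
  u @ \oo --> a +i* b.
Proof.
move=> /cvgrPdist_lt ua /cvgrPdist_lt ub; apply/cvgn_modulusP => e e0.
have [N _ HN] := ua _ (divr_gt0 e0 (ltr0n R 2)).
have [M _ HM] := ub _ (divr_gt0 e0 (ltr0n R 2)).
exists (maxn N M) => n; rewrite geq_max => /andP[Nn Mn].
rewrite (le_lt_trans (modulus_le_ReIm _))// [ltRHS]splitr ReD ImD ReN ImN /=.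
by rewrite ltrD// distrC; [exact: HN|exact: HM].
Qed.

(** Completeness of [R] is applied to the real and imaginary parts, both of which are additive and
    dominated by the modulus. *)
Lemma complex_cauchy_cvg u :
  (forall e : R, 0 < e -> exists N, forall m n, (N <= m)%N -> (N <= n)%N ->
     modulus (u m - u n) < e) -> cvgn u.
Proof.
move=> uC.
have key (p : R[i] -> R) : (forall z, `|p z| <= modulus z) ->
    (forall z w, p (z - w) = p z - p w) -> cvgn (fun n => p (u n)).
  move=> pm pB; apply/cauchy_cvgP/cauchyP => e e0; have [N H] := uC e e0.
  exists (p (u N)); exists N => // n /= Nn; rewrite /ball /=.
  by rewrite -pB (le_lt_trans (pm _))// H.
have /cvg_ex[a ua] := key _ (@Re_le_modulus R) (fun z w => etrans (ReD z (- w)) (congr1 _ (ReN w))).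
have /cvg_ex[b ub] := key _ (@Im_le_modulus R) (fun z w => etrans (ImD z (- w)) (congr1 _ (ImN w))).
by apply/cvg_ex; exists (a +i* b); exact: cvgn_ReIm.
Qed.

Lemma modulus_lim_le u l (B : R) : u @ \oo --> l ->
  (\forall n \near \oo, modulus (u n) <= B) -> modulus l <= B.
Proof.
move=> /cvgn_modulusP ul [M _ uB]; apply/ler_addgt0Pr => e e0.
have [N H] := ul e e0; pose n := maxn N M.
have -> : l = u n - (u n - l) by ring.
rewrite (le_trans (modulusB _ _))// lerD//; first exact: uB (leq_maxr _ _).
exact: ltW (H n (leq_maxl _ _)).
Qed.

Lemma complex_cvgn_unique u l l' : u @ \oo --> l -> u @ \oo --> l' -> l = l'.
Proof.
move=> /cvgn_modulusP ul /cvgn_modulusP ul'; apply/eqP; rewrite -subr_eq0 -modulus_eq0.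
rewrite eq_le modulus_ge0 andbT; apply/ler_addgt0Pr => e e0; rewrite add0r.
have [N H] := ul _ (divr_gt0 e0 (ltr0n R 2)); have [M H'] := ul' _ (divr_gt0 e0 (ltr0n R 2)).
have := H (maxn N M) (leq_maxl _ _); have := H' (maxn N M) (leq_maxr _ _).
set v := u _ => v1 v2.
rewrite (_ : l - l' = (v - l') - (v - l)); last by ring.
by rewrite (le_trans (modulusB _ _))// [leRHS]splitr ltW// ltrD.
Qed.

Lemma complex_lim u l : u @ \oo --> l -> limn u = l.
Proof.
move=> ul; have uc : cvgn u by apply/cvg_ex; exists l.
exact: complex_cvgn_unique uc ul.
Qed.

Lemma complex_cvgnD u v l l' : u @ \oo --> l -> v @ \oo --> l' ->
  (fun n => u n + v n) @ \oo --> l + l'.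
Proof.
move=> /cvgn_modulusP ul /cvgn_modulusP ul'; apply/cvgn_modulusP => e e0.
have [N H] := ul _ (divr_gt0 e0 (ltr0n R 2)); have [M H'] := ul' _ (divr_gt0 e0 (ltr0n R 2)).
exists (maxn N M) => n; rewrite geq_max => /andP[Nn Mn].
rewrite (_ : u n + v n - _ = (u n - l) + (v n - l')); last by ring.
by rewrite (le_lt_trans (modulusD _ _))// [ltRHS]splitr ltrD ?H ?H'.
Qed.

Lemma complex_cvgnMl (a : R[i]) u l : u @ \oo --> l -> (fun n => a * u n) @ \oo --> a * l.
Proof.
move=> /cvgn_modulusP ul; apply/cvgn_modulusP => e e0.
have a0 : 0 < modulus a + 1 by rewrite ltr_wpDl// modulus_ge0.
have [N H] := ul _ (divr_gt0 e0 a0).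
exists N => n Nn; rewrite -mulrBr modulusM.
rewrite (@le_lt_trans _ _ ((modulus a + 1) * modulus (u n - l)))//.
  by rewrite ler_wpM2r ?modulus_ge0// lerDl.
by rewrite mulrC -ltr_pdivlMr// H.
Qed.

Lemma complex_cvgn_ext u v l : u =1 v -> u @ \oo --> l -> v @ \oo --> l.
Proof. by move=> /funext ->. Qed.

Lemma complex_cvgnS u l : u @ \oo --> l -> (fun n => u n.+1) @ \oo --> l.
Proof.
move=> /cvgn_modulusP ul; apply/cvgn_modulusP => e e0.
by have [N H] := ul e e0; exists N => n Nn; rewrite H// ltnW.
Qed.

Lemma complex_cvgn_cst l : (fun _ : nat => l) @ \oo --> l.
Proof. by apply/cvgn_modulusP => e e0; exists 0%N => n _; rewrite subrr modulus0. Qed.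

Lemma complex_cvgnB u v l l' : u @ \oo --> l -> v @ \oo --> l' ->
  (fun n => u n - v n) @ \oo --> l - l'.
Proof.
move=> ul /(@complex_cvgnMl (-1)) vl; rewrite -(mulN1r l').
by apply: complex_cvgn_ext (complex_cvgnD ul vl) => n; rewrite mulN1r.
Qed.

Lemma complex_cvgn_sum (I : Type) (s : seq I) (F : I -> nat -> R[i]) (L : I -> R[i]) :
  (forall i, F i @ \oo --> L i) ->
  (fun n => \sum_(i <- s) F i n) @ \oo --> \sum_(i <- s) L i.
Proof.
move=> FL; elim: s => [|i s IH].
  rewrite big_nil (_ : (fun n => _) = fun=> 0); first exact: complex_cvgn_cst.
  by apply/funext => n; rewrite big_nil.
rewrite big_cons (_ : (fun n => _) = fun n => F i n + \sum_(j <- s) F j n).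
  exact: (complex_cvgnD (FL i) IH).
by apply/funext => n; rewrite big_cons.
Qed.

Lemma sum_half_pow m n (K : R) : 0 <= K ->
  \sum_(m <= k < n) K * 2^-1 ^+ k <= 2 * K * 2^-1 ^+ m.
Proof.
move=> K0; have [mn|nm] := leqP m n; last first.
  by rewrite big_geq 1?ltnW// !mulr_ge0// exprn_ge0.
rewrite -(subnKC mn); move: (n - m)%N => d {mn n}.
have -> : \sum_(m <= k < m + d) K * 2^-1 ^+ k = 2 * K * 2^-1 ^+ m - 2 * K * 2^-1 ^+ (m + d).
  elim: d => [|d IH]; first by rewrite addn0 big_geq// subrr.
  rewrite addnS big_nat_recr ?leq_addr//= IH exprS.
  by field.
by rewrite gerBl !mulr_ge0// exprn_ge0.
Qed.

Lemma modulus_sum_half_pow u (K : R) m n : 0 <= K ->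
  (forall k, modulus (u k) <= K * 2^-1 ^+ k) ->
  modulus (\sum_(m <= k < n) u k) <= 2 * K * 2^-1 ^+ m.
Proof.
move=> K0 uK; rewrite (le_trans _ (sum_half_pow m n K0))//.
elim/big_ind2: _ => [|x y x' y' h h'|k _]; first by rewrite modulus0.
  by rewrite (le_trans (modulusD _ _))// lerD.
exact: uK.
Qed.

Lemma half_pow_small (e : R) : 0 < e -> exists N, 2^-1 ^+ N < e.
Proof.
move=> e0; have /cvgrPdist_lt/(_ e e0)[N _ H] :
    (fun n => (2^-1 : R) ^+ n) @ \oo --> (0 : R).
  by apply: cvg_expr; rewrite ger0_norm ?invr_ge0// invf_lt1// ltr1n.
exists N; have := H N (leqnn _); rewrite /= sub0r normrN ger0_norm //.
Qed.

Lemma cvgn_series_half_pow u (K : R) : 0 <= K ->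
  (forall k, modulus (u k) <= K * 2^-1 ^+ k) -> cvgn (series u).
Proof.
move=> K0 uK; apply: complex_cauchy_cvg => e e0.
have K1 : 0 < 2 * K + 1 by rewrite ltr_wpDl// mulr_ge0.
have [N HN] := half_pow_small (divr_gt0 e0 K1).
exists N.
suff H m n : (N <= m)%N -> (m <= n)%N -> modulus (series u n - series u m) < e.
  move=> m n Nm Nn; have [mn|/ltnW nm] := leqP m n; last exact: H.
  by rewrite modulus_distC; exact: H.
move=> Nm mn; rewrite sub_series_geq//.
apply: le_lt_trans (modulus_sum_half_pow _ _ K0 uK) _.
rewrite (@le_lt_trans _ _ ((2 * K + 1) * 2^-1 ^+ N))//; last by rewrite mulrC -ltr_pdivlMr.
rewrite ler_pM//; first by rewrite mulr_ge0.
  by rewrite lerDl.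
by rewrite ler_wiXn2l// ?invr_ge0// invf_le1// ler1n.
Qed.

End ComplexSequences.

(** * Termwise differentiation of power series *)

Section PowerSeries.
Context {R : realType}.
Implicit Types (f : R[i] -> R[i]) (z w x y : R[i]).

(** The remainder of order $n+1$ is $x$ times that of order $n$ plus $n y^{n-1}(x-y)^2$, and $n^2 +
    n \le (n+1)^2$. Multiplying by $s^2$ avoids the exponent $n - 2$. *)
Lemma pow_taylor2 x y (s m : R) n : 0 <= s ->
  modulus x <= s -> modulus y <= s -> modulus (x - y) <= m ->
  modulus (x ^+ n - y ^+ n - n%:R * y ^+ n.-1 * (x - y)) * s ^+ 2 <=
    (n ^ 2)%:R * s ^+ n * m ^+ 2.
Proof.
move=> s0 xs ys xym; have m0 : 0 <= m := le_trans (modulus_ge0 _) xym.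
elim: n => [|n IH]; first by rewrite !mul0r subrr subr0 modulus0 mul0r.
have -> : x ^+ n.+1 - y ^+ n.+1 - n.+1%:R * y ^+ n.+1.-1 * (x - y) =
    x * (x ^+ n - y ^+ n - n%:R * y ^+ n.-1 * (x - y)) +
    n%:R * y ^+ n.-1 * (x - y) ^+ 2.
  case: n {IH} => [|n]; first by rewrite !mul0r addr0 /= !expr1 !expr0; ring.
  by rewrite /= -[n.+2%:R]natr1 !exprS; ring.
rewrite (le_trans (ler_wpM2r (sqr_ge0 _) (modulusD _ _)))// mulrDl modulusM -(mulrA (modulus x)).
have h1 : modulus x * (modulus (x ^+ n - y ^+ n - n%:R * y ^+ n.-1 * (x - y)) * s ^+ 2)
    <= s * ((n ^ 2)%:R * s ^+ n * m ^+ 2).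
  by apply: ler_pM => //; rewrite ?modulus_ge0// mulr_ge0 ?modulus_ge0// sqr_ge0.
have h2 : modulus (n%:R * y ^+ n.-1 * (x - y) ^+ 2) * s ^+ 2 <=
    n%:R * s ^+ n.+1 * m ^+ 2.
  case: n {IH h1} => [|n]; first by rewrite !mul0r modulus0 mul0r.
  rewrite !modulusM modulus_nat -expr2 !modulusX /= [leRHS](_ : _ = n.+1%:R * s ^+ n * m ^+ 2 * s
    ^+ 2); last first.
    by rewrite !exprS; ring.
  apply: ler_wpM2r; first exact: sqr_ge0.
  apply: ler_pM; rewrite ?mulr_ge0 ?modulus_ge0//.
  - by rewrite exprn_ge0// modulus_ge0.
  - by rewrite ler_wpM2l// lerXn2r// nnegrE modulus_ge0.
  - by rewrite lerXn2r// nnegrE modulus_ge0.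
rewrite (le_trans (lerD h1 h2))//.
rewrite [leLHS](_ : _ = (n ^ 2 + n)%:R * (s ^+ n.+1 * m ^+ 2)); last first.
  by rewrite natrD; set q := (n ^ 2)%:R; rewrite (exprS s n); ring.
rewrite -mulrA ler_wpM2r ?mulr_ge0 ?exprn_ge0// ler_nat.
by rewrite -[n.+1]addn1 sqrnD -addnA leq_add2l muln1 (leq_trans _ (leq_addl _ _))// leq_pmull.
Qed.

Lemma cvgn_terms_bounded (a : nat -> R[i]) : cvgn (series a) ->
  exists2 M : R, 0 <= M & forall n, modulus (a n) <= M.
Proof.
move=> /cvg_ex[l /cvgn_modulusP H]; have [N HN] := H 1 ltr01.
have S0 : 0 <= \sum_(0 <= k < N) modulus (a k).
  by apply: sumr_ge0 => k _; exact: modulus_ge0.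
exists (2 + \sum_(0 <= k < N) modulus (a k)); first by rewrite addr_ge0.
move=> n; have [Nn|nN] := leqP N n.
  have -> : a n = (series a n.+1 - l) - (series a n - l).
    by rewrite /series /= big_nat_recr//=; ring.
  rewrite (le_trans (modulusB _ _))// (@le_trans _ _ 2)//; last by rewrite lerDl.
  by rewrite (_ : 2 = 1 + 1)// lerD// ltW// HN// ltnW.
rewrite (bigD1_seq n)//= ?mem_index_iota ?iota_uniq//=.
rewrite addrCA lerDl addr_ge0//.
by apply: sumr_ge0 => k _; exact: modulus_ge0.
Qed.

Lemma natr_le_pow2 n : (n%:R : R) <= 2 ^+ n.
Proof. by rewrite -natrX ler_nat ltnW// ltn_expl. Qed.

(** The radii are wasteful on purpose. The terms are bounded at $r/2$, and $s = r/16$ is eight times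
    smaller, so $|c_n| s^n \le M 8^{-n}$ absorbs $n^2 \le 4^n$ and leaves the geometric series of
    ratio 1/2. Two points of modulus below $r/32$ have a sum of modulus at most $s$. *)
Lemma pow_series_derivative (c : nat -> R[i]) (g : R[i] -> R[i]) (r : R) : 0 < r ->
  (forall h, modulus h < r -> series (fun n => c n * h ^+ n) @ \oo --> g h) ->
  forall h, modulus h < r / 32 -> exists2 d : R[i], cderiv g h d &
    series (fun n => n.+1%:R * c n.+1 * h ^+ n) @ \oo --> d.
Proof.
move=> r0 cg h hr.
pose rho := r / 2; pose s := r / 16.
have rho0 : 0 < rho by rewrite divr_gt0.
have s0 : 0 < s by rewrite divr_gt0.
have srho : s = rho * 8^-1 by rewrite /s /rho; field.
have [M M0 cM] : exists2 M : R, 0 <= M & forall n, modulus (c n) * rho ^+ n <= M.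
  have rr : modulus (rho%:C : R[i]) < r.
    by rewrite modulus_real ger0_norm ?ltW// /rho ltr_pdivrMr// ltr_pMr// ltr1n.
  have [|M M0 cM] := @cvgn_terms_bounded (fun n => c n * rho%:C ^+ n).
    by apply/cvg_ex; exists (g rho%:C); exact: cg.
  exists M => // n; have := cM n.
  by rewrite modulusM modulusX modulus_real ger0_norm// ltW.
have sM n : modulus (c n) * s ^+ n <= M * 8^-1 ^+ n.
  by rewrite srho exprMn mulrA ler_wpM2r ?exprn_ge0.
pose a n := n.+1%:R * c n.+1 * h ^+ n.
have hs : modulus h <= s by rewrite (le_trans (ltW hr))// /s ler_pM2l// lef_pV2 ?posrE// ler_nat.
have aK n : modulus (a n) <= (M / s) * 2^-1 ^+ n.
  rewrite -(@ler_pM2r _ s)// mulrAC divfK ?gt_eqF// /a !modulusM modulus_nat modulusX.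
  rewrite (@le_trans _ _ (n.+1%:R * (modulus (c n.+1) * s ^+ n.+1)))//.
    rewrite -!mulrA ler_wpM2l// ler_wpM2l ?modulus_ge0// exprSr.
    by apply: (ler_wpM2r (ltW s0)); rewrite lerXn2r// nnegrE ?modulus_ge0// ltW.
  rewrite (@le_trans _ _ (2 ^+ n.+1 * (M * 8^-1 ^+ n.+1)))//.
    by rewrite ler_pM ?natr_le_pow2// mulr_ge0 ?modulus_ge0// exprn_ge0// ltW.
  rewrite mulrCA ler_wpM2l// -exprMn (_ : 2 * 8^-1 = 2^-1 * 2^-1 :> R); last by field.
  have h1 : 2^-1 <= 1 :> R by rewrite invf_le1// ler1n.
  rewrite exprMn (@le_trans _ _ (2^-1 ^+ n.+1 * 1))//.
    by rewrite ler_wpM2l ?exprn_ge0// exprn_ile1.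
  by rewrite mulr1 ler_wiXn2l.
have /cvg_ex[d ad] : cvgn (series a) by apply: cvgn_series_half_pow aK; rewrite divr_ge0// ltW.
exists d => //.
pose B := 2 * (M / s ^+ 2).
have B0 : 0 <= B by rewrite mulr_ge0// divr_ge0// sqr_ge0.
have key k : modulus k < r / 32 -> modulus (g (h + k) - g h - d * k) <= B * modulus k ^+ 2.
  move=> kr.
  have hk : modulus (h + k) < r.
    rewrite (le_lt_trans (modulusD _ _))// (lt_trans (ltrD hr kr))// -mulrDl.
    by rewrite ltr_pdivrMr//; lra.
  have hks : modulus (h + k) <= s.
    by rewrite (le_trans (modulusD _ _))// (le_trans (ltW (ltrD hr kr)))// /s; lra.
  have hr' : modulus h < r by rewrite (lt_trans hr)// ltr_pdivrMr// ltr_pMr// ltr1n.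
  pose b n := c n * ((h + k) ^+ n - h ^+ n - n%:R * h ^+ n.-1 * k).
  (* The term of index 0 has no linear part, so [n.+1] terms of [b] meet only [n] terms of the
     derivative series. *)
  have bE n : series b n.+1 = series (fun n => c n * (h + k) ^+ n) n.+1 -
      series (fun n => c n * h ^+ n) n.+1 - k * series a n.
    rewrite /series /= mulr_sumr -[X in _ - X](_ : \sum_(0 <= i < n.+1) c i * (i%:R * h ^+ i.-1 *
      k) = _).
      by rewrite -!sumrB; apply: eq_bigr => i _; rewrite /b; ring.
    rewrite big_nat_recl// !mul0r mulr0 add0r; apply: eq_bigr => i _.
    by rewrite /a /=; ring.
  have bl : (fun n => series b n.+1) @ \oo --> g (h + k) - g h - k * d.
    apply: (complex_cvgn_ext (fun n => esym (bE n))).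
    apply: complex_cvgnB; last exact: (@complex_cvgnMl _ k _ _ ad).
    exact: (complex_cvgnB (complex_cvgnS (cg _ hk)) (complex_cvgnS (cg _ hr'))).
  rewrite (mulrC d); apply: modulus_lim_le bl _; near=> n.
  have K0 : 0 <= M / s ^+ 2 * modulus k ^+ 2.
    by rewrite mulr_ge0 ?sqr_ge0// divr_ge0// sqr_ge0.
  suff bK i : modulus (b i) <= M / s ^+ 2 * modulus k ^+ 2 * 2^-1 ^+ i.
    by have := modulus_sum_half_pow 0 n.+1 K0 bK; rewrite expr0 mulr1 mulrA.
  have s20 : 0 < s ^+ 2 by rewrite exprn_gt0.
  rewrite -(@ler_pM2r _ (s ^+ 2))// /b modulusM -(mulrA (modulus (c i))).
  have := @pow_taylor2 (h + k) h s (modulus k) i (ltW s0) hks hs.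
  rewrite (addrC h k) addrK (addrC k h) lexx => /(_ isT) H.
  rewrite (le_trans (ler_wpM2l (modulus_ge0 _) H))//.
  rewrite [leRHS](_ : _ = M * 2^-1 ^+ i * modulus k ^+ 2); last by field; rewrite gt_eqF.
  rewrite mulrA ler_wpM2r ?sqr_ge0// mulrCA.
  rewrite (le_trans (ler_wpM2l _ (sM i)))// mulrCA ler_wpM2l//.
  rewrite natrX (@le_trans _ _ ((2 ^+ i) ^+ 2 * 8^-1 ^+ i))//.
    by rewrite ler_wpM2r ?exprn_ge0// lerXn2r ?nnegrE ?exprn_ge0// natr_le_pow2.
  by rewrite exprAC -exprMn (_ : 2 ^+ 2 * 8^-1 = 2^-1 :> R)//; field.
move=> e e0; exists (Num.min (r / 32) (e / (B + 1))).
  by rewrite lt_min !divr_gt0// ltr_wpDl.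
move=> k; rewrite lt_min => /andP[kr kB].
rewrite (le_trans (key _ kr))// expr2 mulrA ler_wpM2r ?modulus_ge0//.
rewrite (@le_trans _ _ ((B + 1) * modulus k))//.
  by rewrite ler_wpM2r ?modulus_ge0// lerDl.
by rewrite mulrC -ler_pdivlMr ?ltW// ltr_wpDl.
Unshelve. all: by end_near. Qed.

(** Since [analytic_on] asks for some positive radius at each point, the smaller disc on which the
    differentiated series represents the derivative is good enough. *)
Lemma analytic_derivative (D : set R[i]) f : analytic_on D f ->
  analytic_on D f^`() /\ forall z, D z -> cderiv f z (f^`() z).
Proof.
move=> fan.
have key z0 : D z0 -> exists2 r : R, 0 < r & exists c : nat -> R[i],
    forall z, modulus (z - z0) < r -> cderiv f z (f^`() z) /\
     series (fun n => c n * (z - z0) ^+ n) @ \oo --> f^`() z.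
  move=> /fan[c [r r0 fc]].
  exists (r / 32); first by rewrite divr_gt0.
  exists (fun n => n.+1%:R * c n.+1) => z zr.
  have [|d gd cd] := @pow_series_derivative c (fun h => f (z0 + h)) r r0 _ _ zr.
    by move=> h hr; have := fc (z0 + h); rewrite addrC addKr; exact.
  have fd : cderiv f z d.
    have := @cderiv_shift R (fun h => f (z0 + h)) z (- z0) d.
    rewrite (addrC (- z0)) => /(_ gd); apply: cderiv_ext => w.
    by rewrite addrA subrr add0r.
  by rewrite (cderiv_derive1 fd).
split=> z0 Dz0; have [r r0 [c H]] := key z0 Dz0.
  by exists c; exists r => // z /H[].
by apply: (H z0 _).1; rewrite subrr modulus0.
Qed.

Lemma analytic_derive1n (D : set R[i]) f n : analytic_on D f ->
  analytic_on D (derive1n n f) /\ forall z, D z -> cderiv (derive1n n f) z (derive1n n.+1 f z).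
Proof.
move=> fan; elim: n => [|n [IH _]]; first by split=> //; have [] := analytic_derivative fan.
have [IH' _] := analytic_derivative IH; split => //.
by have [] := analytic_derivative IH'.
Qed.

End PowerSeries.

(** * Shifting lines of integration *)

Section RealIntegrals.
Context {R : realType}.
Notation mu := (@lebesgue_measure R).
Implicit Types (f g F : R -> R).

Lemma real_cvgn_unique (u : nat -> R) (l l' : R) :
  u @ \oo --> l -> u @ \oo --> l' -> l = l'.
Proof.
move=> ul ul'; rewrite -(cvg_lim (@Rhausdorff R) ul).
by rewrite -(cvg_lim (@Rhausdorff R) ul').
Qed.

Lemma FTC_derivative f F (a b : R) : a < b ->
  (forall x, a <= x <= b -> is_derive x 1 F (f x)) ->
  {within `[a, b], continuous f} ->
  \int[mu]_(x in `[a, b]) f x = F b - F a.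
Proof.
move=> ab dF cf; rewrite /Rintegral (@continuous_FTC2 _ _ F)//.
  split.
  - move=> x; rewrite in_itv /= => /andP[ax xb].
    by have H := dF x; apply: ex_derive; apply: H; rewrite !ltW.
  - apply: cvg_at_right_filter; apply: (is_derive_continuous (dF a _)).
    by rewrite lexx ltW.
  - apply: cvg_at_left_filter; apply: (is_derive_continuous (dF b _)).
    by rewrite lexx ltW.
move=> x; rewrite in_itv /= => /andP[ax xb].
have H := dF x; rewrite derive1E; apply: derive_val; apply: H.
by rewrite !ltW.
Qed.

Lemma continuous_itv_integrable f (a b : R) :
  {within `[a, b], continuous f} -> mu.-integrable `[a, b] (EFin \o f).
Proof. by move=> cf; apply: continuous_compact_integrable => //; exact: segment_compact. Qed.

Lemma within_continuous_itv f (a b : R) :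
  (forall x, a <= x <= b -> {for x, continuous f}) -> {within `[a, b], continuous f}.
Proof.
move=> cf; apply/continuous_in_subspaceT => x /[1!inE] /=.
by rewrite in_itv /=; exact: cf.
Qed.

Lemma real_dominated_convergence (D : set R) (f_ : nat -> R -> R) f g :
  measurable D ->
  (forall n, measurable_fun D (f_ n)) -> measurable_fun D f ->
  {ae mu, forall x, D x -> (fun n => f_ n x) @ \oo --> f x} ->
  mu.-integrable D (EFin \o g) ->
  (forall n x, D x -> `|f_ n x| <= g x) ->
  (fun n => \int[mu]_(x in D) f_ n x) @ \oo --> \int[mu]_(x in D) f x.
Proof.
move=> mD mf_ mf f_f ig f_g.
have H1 n : measurable_fun D (EFin \o f_ n) by apply/measurable_EFinP; exact: mf_.
have H2 : measurable_fun D (EFin \o f) by apply/measurable_EFinP.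
have H3 : {ae mu, forall x, D x -> (EFin \o f_ n) x @[n --> \oo] --> (EFin \o f) x}.
  apply: (@filterS _ _ (ae_filter_ringOfSetsType mu) _ _ _ f_f) => x H Dx.
  by apply: cvg_EFin; [exact: nearW|exact: H].
have H4 : {ae mu, forall x, forall n, D x -> (`|(EFin \o f_ n) x| <= (EFin \o g) x)%E}.
  by apply: aeW => x n Dx /=; rewrite lee_fin; exact: f_g.
have [fi _ cv] := @dominated_convergence _ _ R mu D mD (fun n =>
  EFin \o f_ n) (EFin \o f) (EFin \o g) H1 H2 H3 ig H4.
apply: fine_cvg; rewrite fineK; last by apply: integrable_fin_num => //.
exact: cv.
Qed.

Lemma integrable_dominated (D : set R) f g : measurable D -> measurable_fun D f ->
  mu.-integrable D (EFin \o g) -> (forall x, D x -> `|f x| <= g x) ->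
  mu.-integrable D (EFin \o f).
Proof.
move=> mD mf gi fg; apply: (@le_integrable _ _ R mu D mD (EFin \o f) (EFin \o g)) => //.
  exact/measurable_EFinP.
by move=> x Dx /=; rewrite lee_fin (le_trans (fg x Dx))// ler_norm.
Qed.

(* [lebesgue_measure] lives on a structure of [R] that is only convertible to the
   one inferred for [measurable D]; the next lemmas restate library facts so that
   they can be applied without unification problems. *)
Lemma mu_integrableZl (D : set R) f (c : R) : measurable D ->
  mu.-integrable D (EFin \o f) -> mu.-integrable D (EFin \o (fun x => c * f x)).
Proof.
move=> mD fi.
exact: (@integrableZl _ _ _ mu D mD c (fun u => (f u)%:E)).
Qed.

Lemma mu_integrableD (D : set R) f g : measurable D ->
  mu.-integrable D (EFin \o f) -> mu.-integrable D (EFin \o g) ->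
  mu.-integrable D (EFin \o (fun x => f x + g x)).
Proof.
move=> mD fi gi.
exact: (@integrableD _ _ _ mu D mD (fun u => (f u)%:E) (fun u => (g u)%:E)).
Qed.

Lemma mu_integrableB (D : set R) f g : measurable D ->
  mu.-integrable D (EFin \o f) -> mu.-integrable D (EFin \o g) ->
  mu.-integrable D (EFin \o (fun x => f x - g x)).
Proof.
move=> mD fi gi.
exact: (@integrableB _ _ _ mu D mD (fun u => (f u)%:E) (fun u => (g u)%:E)).
Qed.

Lemma mu_integrable_norm (D : set R) f : measurable D ->
  mu.-integrable D (EFin \o f) -> mu.-integrable D (EFin \o (fun x => `|f x|)).
Proof. by move=> mD fi; apply: integrable_norm. Qed.

Lemma mu_integrableS (D E : set R) f : measurable D -> measurable E -> D `<=` E ->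
  mu.-integrable E (EFin \o f) -> mu.-integrable D (EFin \o f).
Proof. by move=> mD mE DE; apply: integrableS. Qed.

Lemma mu_integrable_measurable (D : set R) f :
  mu.-integrable D (EFin \o f) -> measurable_fun D f.
Proof. by move=> /integrableP[/measurable_EFinP]. Qed.

Lemma mu_RintegralZl (D : set R) f (c : R) : measurable D ->
  mu.-integrable D (EFin \o f) ->
  \int[mu]_(x in D) (c * f x) = c * \int[mu]_(x in D) f x.
Proof. by move=> mD fi; rewrite RintegralZl. Qed.

Lemma mu_RintegralD (D : set R) f g : measurable D ->
  mu.-integrable D (EFin \o f) -> mu.-integrable D (EFin \o g) ->
  \int[mu]_(x in D) (f x + g x) = \int[mu]_(x in D) f x + \int[mu]_(x in D) g x.
Proof. by move=> mD fi gi; rewrite RintegralD. Qed.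

Lemma mu_RintegralB (D : set R) f g : measurable D ->
  mu.-integrable D (EFin \o f) -> mu.-integrable D (EFin \o g) ->
  \int[mu]_(x in D) (f x - g x) = \int[mu]_(x in D) f x - \int[mu]_(x in D) g x.
Proof. by move=> mD fi gi; rewrite RintegralB. Qed.

Lemma mu_le_Rintegral (D : set R) f g : measurable D ->
  mu.-integrable D (EFin \o f) -> mu.-integrable D (EFin \o g) ->
  (forall x, D x -> f x <= g x) ->
  \int[mu]_(x in D) f x <= \int[mu]_(x in D) g x.
Proof. by move=> mD fi gi fg; apply: le_Rintegral. Qed.

Lemma mu_le_normr_Rintegral (D : set R) f g : measurable D ->
  mu.-integrable D (EFin \o f) -> mu.-integrable D (EFin \o g) ->
  (forall x, D x -> `|f x| <= g x) ->
  `|\int[mu]_(x in D) f x| <= \int[mu]_(x in D) g x.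
Proof.
move=> mD fi gi fg; apply: (@le_trans _ _ (\int[mu]_(x in D) `|f x|)).
  by apply: le_normr_Rintegral.
by apply: mu_le_Rintegral => //; exact: mu_integrable_norm.
Qed.

Lemma mu_Rintegral_subset (D E : set R) f : measurable D -> measurable E -> D `<=` E ->
  mu.-integrable E (EFin \o f) -> (forall x, E x -> 0 <= f x) ->
  \int[mu]_(x in D) f x <= \int[mu]_(x in E) f x.
Proof.
move=> mD mE DE fi f0; rewrite /Rintegral fine_le//.
- by apply: integrable_fin_num => //; exact: (mu_integrableS mD mE DE fi).
- by apply: integrable_fin_num.
apply: ge0_subset_integral => //.
by apply/measurable_EFinP; exact: mu_integrable_measurable.
Qed.

Lemma itvNcc (x A : R) : `[- A, A]%classic x <-> `|x| <= A.
Proof. by rewrite /= in_itv /= ler_norml. Qed.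

Lemma cvg_truncated_integral f : mu.-integrable setT (EFin \o f) ->
  (fun n : nat => \int[mu]_(x in `[- n%:R, n%:R]) f x) @ \oo --> \int[mu]_x f x.
Proof.
move=> fi; have /integrableP[/measurable_EFinP mf _] := fi.
under eq_fun do rewrite Rintegral_mkcond.
apply: (@real_dominated_convergence _ _ _ (fun x => `|f x|)) => //.
- by move=> n; apply/measurable_restrict => //; exact: measurable_funTS.
- apply: aeW => x _; apply/cvgrPdist_lt => e e0.
  exists (Num.truncn `|x|).+1 => // n /= xn; rewrite patchE mem_set ?subrr ?normr0//.
  apply/itvNcc; rewrite (le_trans (ltW (truncnS_gt _)))//.
  by rewrite ler_nat.
- exact: integrable_norm.
- by move=> n x _; rewrite patchE; case: ifP => // _; rewrite normr0.
Qed.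

(* With the cutoff [1 - u^2/N^2] the derivative in [t] of the truncated integral
   of [p t] is, by parts, the integral of [2u/N^2 * q t u], which is O(1/N). *)
Lemma strip_shift (p q g : R -> R -> R) (a b t0 u0 t1 t2 M : R) :
  a < t1 -> t1 < t0 -> t0 < t2 -> t2 < b ->
  (forall t u : R, a < t < b -> (t != t0) || (u != u0) -> is_derive t 1 (p ^~ u) (g t u)) ->
  (forall t u : R, a < t < b -> t != t0 -> is_derive u 1 (q t) (g t u)) ->
  (forall t u : R, a < t < b -> t != t0 -> {for u, continuous (g t)}) ->
  (forall t u : R, a < t < b -> t != t0 -> {for u, continuous (p t)}) ->
  (forall t (N : R), a < t < b -> t != t0 -> exists2 d : R, 0 < d & exists C : R,
     forall s u : R, `|s - t| < d -> `|u| <= N -> `|g s u| <= C) ->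
  (forall N : R, exists C : R, forall t u : R, t1 <= t <= t2 -> `|u| <= N -> `|p t u| <= C) ->
  (forall t : R, a < t < b -> mu.-integrable setT (EFin \o p t)) ->
  (forall t : R, a < t < b -> mu.-integrable setT (EFin \o q t)) ->
  (forall t : R, t1 <= t <= t2 -> \int[mu]_u `|q t u| <= M) ->
  \int[mu]_u p t1 u = \int[mu]_u p t2 u.
Proof.
move=> at1 t10 t02 t2b dp dq cg cp gb pb ip iq qM.
pose w (n : nat) (u : R) := 1 - (n.+1%:R)^-2 * u ^+ 2.
pose B (n : nat) : set R := `[- n.+1%:R, n.+1%:R]%classic.
pose J n t := \int[mu]_(u in B n) (w n u * p t u).
have n0 (n : nat) : (0 : R) < n.+1%:R by [].
have mB n : measurable (B n) by exact: measurable_itv.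
have dw n (u : R) : is_derive u 1 (w n) (- ((n.+1%:R)^-2 * (2 * u))).
  rewrite /w; apply: is_derive_eq.
  rewrite /GRing.scale /=; ring.
have wc n : continuous (w n) by move=> u; exact: (is_derive_continuous (dw n u)).
have w01 n u : B n u -> `|w n u| <= 1.
  move=> /itvNcc un.
  have h1 : 0 <= n.+1%:R ^- 2 * u ^+ 2 by rewrite mulr_ge0 ?sqr_ge0// invr_ge0 exprn_ge0.
  have h2 : n.+1%:R ^- 2 * u ^+ 2 <= 1.
    rewrite mulrC ler_pdivrMr ?exprn_gt0// mul1r -(@real_normK _ u) ?num_real//.
    by rewrite lerXn2r// nnegrE// ltW.
  by rewrite /w; move: h1 h2; set c := _ * _ => h1 h2; rewrite ger0_norm; lra.
have dw2 n u : B n u -> `| - ((n.+1%:R)^-2 * (2 * u))| <= 2 / n.+1%:R.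
  move=> /itvNcc un; rewrite normrN !normrM ger0_norm ?invr_ge0 ?exprn_ge0//.
  rewrite (@ger0_norm _ 2)// [leLHS](_ : _ = 2 / n.+1%:R * (`|u| / n.+1%:R)); last first.
    by field; rewrite gt_eqF.
  by rewrite ler_piMr ?divr_ge0// ler_pdivrMr// mul1r.
have iB f n : mu.-integrable setT (EFin \o f) -> mu.-integrable (B n) (EFin \o f).
  by apply: integrableS => //; exact: mB.
have mp f : mu.-integrable setT (EFin \o f) -> measurable_fun setT f.
  by move=> /integrableP[/measurable_EFinP].
have ib (h f : R -> R) (C : R) n : measurable_fun setT h ->
    (forall u, B n u -> `|h u| <= C) -> mu.-integrable setT (EFin \o f) ->
    mu.-integrable (B n) (EFin \o (fun u : R => h u * f u)).
  move=> mh hC fi.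
  have Ci := mu_integrableZl C (mB n) (mu_integrable_norm (mB n) (iB _ _ fi)).
  apply: (integrable_dominated (mB n) _ Ci).
    by apply: measurable_funTS; apply: measurable_funM => //; exact: mp.
  by move=> u Bu; rewrite normrM ler_wpM2r// hC.
have iwp n t : a < t < b -> mu.-integrable (B n) (EFin \o (fun u : R => w n u * p t u)).
  move=> tab; apply: (ib _ _ 1); [exact: continuous_measurable_fun|exact: w01|exact: ip].
have Nn n : - n.+1%:R < n.+1%:R :> R by rewrite gtrN.
have wB n : w n n.+1%:R = 0 by rewrite /w mulVf ?subrr// expf_eq0 /= gt_eqF.
have wBN n : w n (- n.+1%:R) = 0 by rewrite /w sqrrN; exact: wB.
(* The cutoff vanishes at both ends of [B n], so no boundary terms appear. *)
have parts n (t : R) : a < t < b -> t != t0 ->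
    \int[mu]_(u in B n) (w n u * g t u) =
    \int[mu]_(u in B n) ((n.+1%:R)^-2 * (2 * u) * q t u).
  move=> tab tt0.
  have cq : continuous (q t) by move=> u; exact: (is_derive_continuous (dq t u tab tt0)).
  have cg' : continuous (g t) by move=> u; exact: cg.
  have cw' : continuous (fun u : R => - ((n.+1%:R)^-2 * (2 * u))).
    by move=> u; apply: cvgN; apply: cvgM; [exact: cvg_cst|apply: cvgM;
      [exact: cvg_cst|exact: cvg_id]].
  have cwg : continuous (fun u : R => w n u * g t u).
    by move=> u; apply: cvgM; [exact: wc|exact: cg'].
  have cwq : continuous (fun u : R => - ((n.+1%:R)^-2 * (2 * u)) * q t u).
    by move=> u; apply: cvgM; [exact: cw'|exact: cq].
  have H : \int[mu]_(u in B n) (w n u * g t u + - ((n.+1%:R)^-2 * (2 * u)) * q t u) = 0.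
    have dF (u : R) : - n.+1%:R <= u <= n.+1%:R -> is_derive u 1 (fun u : R => w n u * q t u)
        (w n u * g t u + - ((n.+1%:R)^-2 * (2 * u)) * q t u).
      move=> _; have H := is_deriveM (dw n u) (dq t u tab tt0); apply: is_derive_eq.
      by rewrite /GRing.scale /= (mulrC (q t u)).
    rewrite (FTC_derivative (Nn n) dF) ?wB ?wBN ?mul0r ?subr0//.
    by apply: within_continuous_itv => u _; apply: cvgD; [exact: cwg|exact: cwq].
  move: H; rewrite mu_RintegralD//; last 2 first.
    by apply: continuous_itv_integrable; exact: continuous_subspaceT.
    by apply: continuous_itv_integrable; exact: continuous_subspaceT.
  move=> /eqP; rewrite addr_eq0 => /eqP ->.
  rewrite (_ : \int[mu]_(u in B n) (- (n.+1%:R ^- 2 * (2 * u)) * q t u) =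
     (-1) * \int[mu]_(u in B n) (n.+1%:R ^- 2 * (2 * u) * q t u)); first by rewrite mulN1r opprK.
  have Icq : mu.-integrable (B n) (EFin \o (fun u : R => (n.+1%:R)^-2 * (2 * u) * q t u)).
    apply: continuous_itv_integrable; apply: continuous_subspaceT => u.
    apply: cvgM; last exact: cq.
    by apply: cvgM; [exact: cvg_cst|apply: cvgM; [exact: cvg_cst|exact: cvg_id]].
  by rewrite -(mu_RintegralZl _ (mB n) Icq); apply: eq_Rintegral => u _; rewrite mulN1r mulNr.
have Jder n (t : R) : t1 <= t <= t2 -> t != t0 -> exists2 D : R,
    is_derive t 1 (J n) D & `|D| <= 2 / n.+1%:R * M.
  move=> tt tt0; have tab : a < t < b.
    by move: tt => /andP[? ?]; rewrite (lt_le_trans at1)//= (le_lt_trans _ t2b).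
  exists (\int[mu]_(u in B n) (w n u * g t u)).
    have [d d0 [C gC]] := gb t n.+1%:R tab tt0.
    have /andP[ta tb] := tab.
    (* The neighbourhood must stay inside the strip, avoid [t0], and remain where [g] is bounded, so
       that one constant dominates the differentiated integrand. *)
    pose d' := Num.min (Num.min d `|t - t0|) (Num.min (t - a) (b - t)).
    have d'0 : 0 < d' by rewrite !lt_min d0 normr_gt0 subr_eq0 tt0 !subr_gt0 ta tb.
    have It : `](t - d'), (t + d')[%classic t.
      by rewrite /= in_itv /= ltrDl d'0 gtrDl oppr_lt0 d'0.
    have Id (s : R) : `](t - d'), (t + d')[%classic s -> `|s - t| < d'.
      by rewrite /= in_itv /= ltr_norml => /andP[? ?]; apply/andP; split; lra.
    have Iab (s : R) : `](t - d'), (t + d')[%classic s -> a < s < b /\ s != t0.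
      move=> /Id; rewrite !lt_min => /andP[/andP[_ st0] /andP[sa sb]].
      move: sa sb; rewrite !ltr_norml => /andP[? ?] /andP[? ?].
      split; first by apply/andP; split; lra.
      by apply: contraTneq st0 => ->; rewrite distrC ltxx.
    have df (s u : R) : `](t - d'), (t + d')[%classic s ->
        is_derive s 1 (fun s : R => w n u * p s u) (w n u * g s u).
      move=> /Iab[sab st0]; have H := dp s u sab.
      rewrite st0 /= in H; have {}H := H isT.
      have -> : w n u * g s u = w n u *: g s u by [].
      exact: is_deriveZ.
    have H1 (s : R) : `](t - d'), (t + d')[%classic s ->
        mu.-integrable (B n) (EFin \o (fun u : R => w n u * p s u)).
      by move=> /Iab[sab _]; exact: iwp.
    have H2 (s u : R) : `](t - d'), (t + d')[%classic s -> B n u ->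
        derivable (fun s : R => w n u * p s u) s 1.
      by move=> Is _; have := df s u Is => H; exact: ex_derive.
    have H3 : mu.-integrable (B n) (EFin \o (fun=> `|C|)).
      by apply: continuous_itv_integrable; apply: continuous_subspaceT => u; exact: cvg_cst.
    have part1 (s u : R) : `](t - d'), (t + d')[%classic s ->
        partial1of2 (fun s u : R => w n u * p s u) s u = w n u * g s u.
      by move=> Is; rewrite partial1of2E; have := df s u Is => H; exact: derive_val.
    have H4 (s u : R) : `](t - d'), (t + d')[%classic s -> B n u ->
        `|partial1of2 (fun s u : R => w n u * p s u) s u| <= `|C|.
      move=> Is Bu; rewrite part1// normrM -[leRHS]mul1r.
      apply: ler_pM => //; first exact: w01.
      rewrite (le_trans _ (ler_norm _))//; apply: gC; last exact/itvNcc.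
      by have := Id s Is; rewrite !lt_min => /andP[/andP[]].
    have C0 (u : R) : 0 <= (fun=> `|C|) u by [].
    apply: DeriveDef; first exact: (@derivable_under_integral R _ _ mu _ (B n) (mB n) t _ _ It H1
      H2 _ C0 H3 H4).
    rewrite -derive1E (@differentiation_under_integral R _ _ mu _ (B n) (mB n) t _ _ It H1 H2 _
      C0 H3 H4)//.
    by apply: eq_Rintegral => u _; exact: part1.
  rewrite parts//.
  have Iq := ib _ _ (2 / n.+1%:R) n _ _ (iq t tab).
  have mh : measurable_fun setT (fun u : R => (n.+1%:R)^-2 * (2 * u)).
    apply: continuous_measurable_fun => u.
    by apply: cvgM; [exact: cvg_cst|apply: cvgM; [exact: cvg_cst|exact: cvg_id]].
  have hB u : B n u -> `|(n.+1%:R)^-2 * (2 * u)| <= 2 / n.+1%:R.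
    by move=> /dw2; rewrite normrN.
  have {}Iq := Iq _ mh hB.
  have qi : mu.-integrable setT (EFin \o (fun u : R => `|q t u|)) by apply: integrable_norm;
    exact: iq.
  apply: (@le_trans _ _ (\int[mu]_(u in B n) (2 / n.+1%:R * `|q t u|))).
    apply: (mu_le_normr_Rintegral (mB n) Iq); first exact: mu_integrableZl (iB _ _ qi).
    by move=> u Bu; rewrite normrM ler_wpM2r// hB.
  rewrite mu_RintegralZl//; last exact: iB.
  apply: ler_wpM2l; first by rewrite divr_ge0.
  by apply: le_trans (qM t tt); exact: mu_Rintegral_subset.
(* At [t0] only continuity is available. It suffices that the integrand is continuous in the
   parameter for almost every [u], and the single height [u0] has measure zero. *)
have J0 n : {for t0, continuous (J n)}.
  have [C pC] := pb n.+1%:R.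
  have I0 : t0 \in `]t1, t2[%classic by rewrite inE /= in_itv /= t10 t02.
  have Iab (s : R) : `]t1, t2[%classic s -> a < s < b.
    by rewrite /= in_itv /= => /andP[? ?]; rewrite (lt_trans at1)//= (lt_trans _ t2b).
  have H1 (s : R) : `]t1, t2[%classic s -> mu.-integrable (B n) (EFin \o (fun u : R =>
    w n u * p s u)).
    by move=> /Iab; exact: iwp.
  have H2 : {ae mu, forall u, B n u ->
      {in `]t1, t2[%classic, continuous ((fun s u : R => w n u * p s u) ^~ u)}}.
    exists [set u0]; split; first exact: measurable_set1.
      exact: lebesgue_measure_set1.
    move=> u /= H; apply: contrapT => /eqP uu0; apply: H => _ s /[1!inE] Is.
    apply: cvgM; first exact: cvg_cst.
    by apply: (is_derive_continuous (dp s u (Iab s Is) _)); rewrite uu0 orbT.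
  have H3 : mu.-integrable (B n) (EFin \o (fun=> C)).
    by apply: continuous_itv_integrable; apply: continuous_subspaceT => u; exact: cvg_cst.
  have H4 (s : R) : `]t1, t2[%classic s ->
      {ae mu, forall u, B n u -> `|(fun s u : R => w n u * p s u) s u| <= (fun=> C) u}.
    rewrite /= in_itv /= => /andP[s1 s2]; apply: aeW => u Bu.
    rewrite normrM -[leRHS]mul1r; apply: ler_pM => //; first exact: w01.
    by apply: pC; [rewrite !ltW|exact/itvNcc].
  exact: (@continuity_under_integral R _ _ mu _ (B n) (mB n) _ _ H1 H2 _ H3 H4).
(* The mean value theorem uses the derivative in the open interval only, so [t0] may be an endpoint;
   the bounds on its two sides are added afterwards. *)
have Jlip n (s1 s2 : R) : t1 <= s1 -> s1 < s2 -> s2 <= t2 -> ~~ (s1 < t0 < s2) ->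
    `|J n s2 - J n s1| <= 2 / n.+1%:R * M * (s2 - s1).
  move=> ts1 s12 ts2 nt0.
  have Jd (t : R) : s1 < t < s2 -> is_derive t 1 (J n) ((J n)^`() t) /\
      `|(J n)^`() t| <= 2 / n.+1%:R * M.
    move=> /andP[st ts]; have tt0 : t != t0.
      by apply: contraNneq nt0 => <-; rewrite st.
    have [|D JD DM] := Jder n t _ tt0.
      by rewrite (le_trans ts1 (ltW st)) (le_trans (ltW ts)).
    by rewrite derive1E derive_val.
  have Jc (t : R) : s1 <= t <= s2 -> {for t, continuous (J n)}.
    move=> /andP[st ts]; have [->|tt0] := eqVneq t t0; first exact: J0.
    have [|D JD _] := Jder n t _ tt0; first by rewrite (le_trans ts1 st) (le_trans ts).
    exact: (is_derive_continuous JD).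
  have [|c cs ->] := @MVT _ (J n) (J n)^`() s1 s2 s12 _ (within_continuous_itv Jc).
    by move=> x; rewrite in_itv /= => /Jd[].
  have s0 : 0 <= s2 - s1 by rewrite subr_ge0 ltW.
  rewrite normrM (ger0_norm s0); apply: (ler_wpM2r s0).
  by move: cs; rewrite in_itv /= => /Jd[].
have Jl n : `|J n t2 - J n t1| <= harmonic n * (2 * M * (t2 - t1)).
  rewrite (_ : J n t2 - J n t1 = (J n t2 - J n t0) + (J n t0 - J n t1)); last by ring.
  rewrite (le_trans (ler_normD _ _))//.
  have h1 := Jlip n t0 t2 (ltW t10) t02 (lexx _); rewrite ltxx /= in h1.
  have h2 := Jlip n t1 t0 (lexx _) t10 (ltW t02); rewrite ltxx andbF in h2.
  rewrite (le_trans (lerD (h1 isT) (h2 isT)))// /harmonic /=.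
  by rewrite le_eqVlt; apply/orP; left; apply/eqP; field; rewrite gt_eqF.
have Jcv (t : R) : a < t < b -> (J ^~ t) @ \oo --> \int[mu]_u p t u.
  move=> tab; rewrite /J; under eq_fun do rewrite Rintegral_mkcond.
  have mpt := mp _ (ip t tab).
  apply: (@real_dominated_convergence _ _ _ (fun u => `|p t u|)) => //.
  - move=> n; apply/measurable_restrict => //; apply: measurable_funTS.
    by apply: measurable_funM => //; exact: continuous_measurable_fun.
  - apply: aeW => u _.
    have cv : (fun n => p t u - (harmonic n * harmonic n) * (u ^+ 2 * p t u)) @ \oo --> p t u.
      have -> : nbhs (p t u) = nbhs (p t u - (0 * 0) * (u ^+ 2 * p t u)).
        by rewrite !mul0r subr0.
      apply: cvgB; first exact: cvg_cst.
      by apply: cvgM; [apply: cvgM; exact: cvg_harmonic|exact: cvg_cst].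
    apply: cvg_trans cv; apply: near_eq_cvg.
    exists (Num.truncn `|u|).+1 => // n /= un; rewrite patchE mem_set.
      by rewrite /w /harmonic /= -exprVn; ring.
    apply/itvNcc; rewrite (le_trans (ltW (truncnS_gt _)))//.
    by rewrite ler_nat leqW.
  - by apply: mu_integrable_norm => //; exact: ip.
  - move=> n u _; rewrite patchE; case: ifP => [/set_mem Bu|_]; last by rewrite normr0.
    by rewrite normrM ler_piMl// w01.
have c1 := Jcv t1 (introT andP (conj at1 (lt_trans t10 (lt_trans t02 t2b)))).
have c2 := Jcv t2 (introT andP (conj (lt_trans at1 (lt_trans t10 t02)) t2b)).
have d0 : (fun n => J n t2 - J n t1) @ \oo --> (0 : R).
  have hK : (fun n => harmonic n * (2 * M * (t2 - t1))) @ \oo --> (0 : R).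
    rewrite -(mul0r (2 * M * (t2 - t1))); apply: cvgM; [exact: cvg_harmonic|exact: cvg_cst].
  have hNK : (fun n => - (harmonic n * (2 * M * (t2 - t1)))) @ \oo --> (0 : R).
    by rewrite -oppr0; apply: cvgN.
  apply: (squeeze_cvgr _ hNK hK); apply: nearW => n.
  by have := Jl n; rewrite ler_norml.
have c21 : (fun n => J n t2 - J n t1) @ \oo --> \int[mu]_u p t2 u - \int[mu]_u p t1 u.
  exact: cvgB.
apply/eqP; rewrite eq_sym -subr_eq0; apply/eqP.
exact: real_cvgn_unique c21 d0.
Qed.

End RealIntegrals.

Lemma compact_locally_bounded {R : realType} {T : topologicalType} (K : set T) (F : T -> R) :
  compact K -> (forall x, K x -> exists M : R, \forall y \near x, F y <= M) ->
  exists C : R, forall x, K x -> F x <= C.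
Proof.
move=> /compact_near_coveringP cK loc.
have [|C [_ H]] := cK R (pinfty_nbhs R) (fun C x => F x <= C) _.
  move=> x Kx; have [M FM] := loc x Kx.
  exists ([set y | F y <= M], [set C | M < C]) => /=.
    by split=> //; exists M; split => //; rewrite num_real.
  by move=> [y C] /= [FyM MC]; rewrite (le_trans FyM)// ltW.
by exists (C + 1) => x Kx; apply: (H (C + 1)) => //; rewrite ltrDl.
Qed.

(** * Independence of the vertical line for complex integrands *)

Section StripShift.
Context {R : realType}.
Notation mu := (@lebesgue_measure R).
Implicit Types (H f g : R[i] -> R[i]) (c d : R[i]) (t u : R).

Lemma cderiv_horizontal f t u d : cderiv f (t +i* u) d ->
  is_derive t 1 (fun s => complex.Re (f (s +i* u))) (complex.Re d) /\
  is_derive t 1 (fun s => complex.Im (f (s +i* u))) (complex.Im d).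
Proof.
have E (s : R) : (u *i : R[i]) + s%:C * 1 = s +i* u.
  by rewrite mulr1; apply/eqP; rewrite eq_complex /= addr0 add0r !eqxx.
rewrite -E => /cderiv_path; rewrite mulr1 /pderiv.
by under eq_fun do rewrite E; under [in X in _ /\ X]eq_fun do rewrite E.
Qed.

Lemma cderiv_vertical f t u d : cderiv f (t +i* u) d ->
  is_derive u 1 (fun v => complex.Re (f (t +i* v))) (- complex.Im d) /\
  is_derive u 1 (fun v => complex.Im (f (t +i* v))) (complex.Re d).
Proof.
have E (s : R) : (t%:C : R[i]) + s%:C * 'i = t +i* s.
  by apply/eqP; rewrite eq_complex /= !mulr0 !mul0r !mulr1 !subr0 !addr0 add0r !eqxx.
rewrite -E => /cderiv_path; rewrite /pderiv ReiNIm ImiRe.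
by under eq_fun do rewrite E; under [in X in _ /\ X]eq_fun do rewrite E.
Qed.

Lemma ccont_vertical f t u : ccont f (t +i* u) ->
  {for u, continuous (fun v => complex.Re (f (t +i* v)))} /\
  {for u, continuous (fun v => complex.Im (f (t +i* v)))}.
Proof.
move=> fc; split; apply/cvgrPdist_lt => e e0; have [r r0 rf] := fc e e0;
    apply/nbhs_normP; exists r => // v; rewrite /= => vu.
  rewrite -ReN -ReD (le_lt_trans (Re_le_modulus _))// modulus_distC rf//.
  rewrite (_ : _ - _ = (v - u) *i) ?modulus_imag 1?distrC//.
  by apply/eqP; rewrite eq_complex /= subrr !eqxx.
rewrite -ImN -ImD (le_lt_trans (Im_le_modulus _))// modulus_distC rf//.
rewrite (_ : _ - _ = (v - u) *i) ?modulus_imag 1?distrC//.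
by apply/eqP; rewrite eq_complex /= subrr !eqxx.
Qed.

Definition loc_bounded (F : R[i] -> R) c : Prop :=
  exists2 r : R, 0 < r & exists M : R, forall w, modulus (w - c) < r -> F w <= M.

Lemma ccont_loc_bounded f c : ccont f c -> loc_bounded (fun w => modulus (f w)) c.
Proof.
move=> /(_ 1 ltr01)[r r0 H]; exists r => //; exists (modulus (f c) + 1) => w /H wc.
rewrite (_ : f w = f c + (f w - f c)); last by ring.
by rewrite (le_trans (modulusD _ _))// lerD2l ltW.
Qed.

Lemma rectangle_bounded (F : R[i] -> R) (t1 t2 N1 N2 : R) :
  (forall t u, t1 <= t <= t2 -> N1 <= u <= N2 -> loc_bounded F (t +i* u)) ->
  exists C : R, forall t u, t1 <= t <= t2 -> N1 <= u <= N2 -> F (t +i* u) <= C.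
Proof.
move=> loc.
pose K : set (R * R) := `[t1, t2]%classic `*` `[N1, N2]%classic.
have cK : compact K by apply: compact_setX; exact: segment_compact.
have [|C HC] := @compact_locally_bounded R _ K (fun x => F (x.1 +i* x.2)) cK.
  move=> [t u] [/=]; rewrite !in_itv /= => tt uu.
  have [r r0 [M HM]] := loc t u tt uu; exists M.
  have r2 : 0 < r / 2 by rewrite divr_gt0.
  exists (ball t (r / 2), ball u (r / 2)); first by split; exact: nbhsx_ballx.
  move=> [s v] [] /=; rewrite /ball /= => st vu; apply: HM.
  rewrite (le_lt_trans (modulus_le_ReIm _))//= [ltRHS]splitr.
  by rewrite -(distrC t) -(distrC u) ltrD.
exists C => t u tt uu; apply: (HC (t, u)).
by split; rewrite /= in_itv.
Qed.

Lemma continuous_punctured_measurable (h : R -> R) (u0 : R) :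
  (forall u, u != u0 -> {for u, continuous h}) -> measurable_fun setT h.
Proof.
move=> hc.
have -> : [set: R] = `]-oo, u0[ `|` ([set u0] `|` `]u0, +oo[).
  apply/seteqP; split => // x _ /=; rewrite !in_itv /= andbT.
  by case: (ltgtP x u0) => h0; [left|right; right|right; left].
apply/measurable_funU => //; first exact: measurableU.
split; first by apply: open_continuous_measurable_fun => // x /[1!inE] /= /[!in_itv] /= xu;
  apply: hc; rewrite lt_eqF.
apply/measurable_funU => //; split; first exact: measurable_fun_set1.
by apply: open_continuous_measurable_fun => // x /[1!inE] /= /[!in_itv] /= /andP[xu _];
  apply: hc; rewrite gt_eqF.
Qed.

(** The Cauchy-Riemann equations make both (Re H, Im H) and (Im H, -Re H) admissible pairs for
    [strip_shift]. At [c0] nothing but local boundedness is asked, which is how a removable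
    singularity is handled without extending [H]. *)
Lemma complex_strip_shift H (H1 : R[i] -> R[i]) (D : R -> R -> R) (a b t1 t2 M : R) c0 :
  a < t1 -> t1 < complex.Re c0 -> complex.Re c0 < t2 -> t2 < b ->
  (forall c, a < complex.Re c < b -> c != c0 -> cderiv H c (H1 c)) ->
  (forall c, a < complex.Re c < b -> c != c0 -> ccont H1 c) ->
  loc_bounded (fun c => modulus (H c)) c0 ->
  (forall t u, a < t < b -> modulus (H (t +i* u)) <= D t u) ->
  (forall t, a < t < b -> mu.-integrable setT (EFin \o D t)) ->
  (forall t, t1 <= t <= t2 -> \int[mu]_u D t u <= M) ->
  cintegral (fun u => H (t1 +i* u)) = cintegral (fun u => H (t2 +i* u)).
Proof.
case: c0 => t0 u0 /= at1 t10 t02 t2b dH cH1 Hb HD Di DM.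
have neq t u : (t != t0) || (u != u0) -> (t +i* u : R[i]) != (t0 +i* u0).
  by rewrite eq_complex /= negb_and.
have neqt t u : t != t0 -> (t +i* u : R[i]) != (t0 +i* u0).
  by move=> tt0; apply: neq; rewrite tt0.
have cH c : a < complex.Re c < b -> c != (t0 +i* u0) -> ccont H c.
  by move=> cab cc0; exact: (cderiv_ccont (dH c cab cc0)).
have Hloc t u : t1 <= t <= t2 -> loc_bounded (fun c => modulus (H c)) (t +i* u).
  move=> /andP[ta tb]; have [->//|cc0] := eqVneq (t +i* u : R[i]) (t0 +i* u0).
  apply: ccont_loc_bounded; apply: cH => //=.
  by rewrite (lt_le_trans at1)//= (le_lt_trans tb).
have HN (N : R) : exists C : R, forall t u, t1 <= t <= t2 -> `|u| <= N ->
    modulus (H (t +i* u)) <= C.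
  have [|C HC] := @rectangle_bounded (fun c => modulus (H c)) t1 t2 (- N) N.
    by move=> t u tt _; exact: Hloc.
  by exists C => t u tt; rewrite ler_norml; exact: HC.
have H1N t (N : R) : a < t < b -> t != t0 -> exists2 d : R, 0 < d & exists C : R,
    forall s u, `|s - t| < d -> `|u| <= N -> modulus (H1 (s +i* u)) <= C.
  move=> /andP[ta tb] tt0.
  pose d := Num.min (Num.min (t - a) (b - t)) `|t - t0| / 2.
  have d0 : 0 < d by rewrite divr_gt0// !lt_min !subr_gt0 ta tb normr_gt0 subr_eq0.
  have [|C HC] := @rectangle_bounded (fun c => modulus (H1 c)) (t - d) (t + d) (- N) N.
    move=> s u /andP[s1 s2] _; apply: ccont_loc_bounded; apply: cH1.
      have d1 : d < t - a.
        by rewrite /d ltr_pdivrMr// (@le_lt_trans _ _ (t - a))// ?ltr_pMr ?subr_gt0 ?ltr1n//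
          !ge_min lexx.
      have d2 : d < b - t.
        by rewrite /d ltr_pdivrMr// (@le_lt_trans _ _ (b - t))// ?ltr_pMr ?subr_gt0 ?ltr1n//
          !ge_min lexx orbT.
      by rewrite /=; apply/andP; split; lra.
    apply: neqt; apply: contraTneq s1 => s0.
    have d3 : d < `|t - t0|.
      by rewrite /d ltr_pdivrMr// (@le_lt_trans _ _ `|t - t0|)// ?ltr_pMr ?normr_gt0 ?subr_eq0
        ?ltr1n// !ge_min lexx orbT.
    rewrite s0 -ltNge; move: d3; rewrite lter_normr => /orP[]; first by lra.
    by move: s2; rewrite s0; lra.
  exists d => //; exists C => s u sd uN; apply: HC; last by rewrite -ler_norml.
  by move: sd; rewrite ltr_norml => /andP[? ?]; apply/andP; split; lra.
have meas (pr : R[i] -> R) : (forall t u, a < t < b -> (t != t0) || (u != u0) ->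
      {for u, continuous (fun v => pr (H (t +i* v)))}) ->
    forall t, a < t < b -> measurable_fun setT (fun v => pr (H (t +i* v))).
  move=> prc t tab; apply: (@continuous_punctured_measurable _ u0) => u uu0.
  by apply: prc => //; rewrite uu0 orbT.
have cRe t u : a < t < b -> (t != t0) || (u != u0) ->
      {for u, continuous (fun v => complex.Re (H (t +i* v)))}.
  by move=> tab tu; have [] := ccont_vertical (cH (t +i* u) tab (neq _ _ tu)).
have cIm t u : a < t < b -> (t != t0) || (u != u0) ->
      {for u, continuous (fun v => complex.Im (H (t +i* v)))}.
  by move=> tab tu; have [] := ccont_vertical (cH (t +i* u) tab (neq _ _ tu)).
have inte (pr : R[i] -> R) : (forall z, `|pr z| <= modulus z) ->
    (forall t u, a < t < b -> (t != t0) || (u != u0) ->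
      {for u, continuous (fun v => pr (H (t +i* v)))}) ->
    forall t, a < t < b -> mu.-integrable setT (EFin \o (fun v => pr (H (t +i* v)))).
  move=> prm prc t tab; apply: (integrable_dominated _ (meas pr prc t tab) (Di t tab)) => //.
  by move=> u _; rewrite (le_trans (prm _))// HD.
have iRe := inte _ (@Re_le_modulus R) cRe.
have iIm := inte _ (@Im_le_modulus R) cIm.
have norm (pr : R[i] -> R) : (forall z, `|pr z| <= modulus z) ->
    (forall t, a < t < b -> mu.-integrable setT (EFin \o (fun v => pr (H (t +i* v))))) ->
    forall t, t1 <= t <= t2 -> \int[mu]_u `|pr (H (t +i* u))| <= M.
  move=> prm pri t tt; have tab : a < t < b.
    by move: tt => /andP[? ?]; rewrite (lt_le_trans at1)//= (le_lt_trans _ t2b).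
  apply: le_trans (DM t tt); apply: mu_le_Rintegral => //; last first.
  - by move=> u _; rewrite (le_trans (prm _))// HD.
  - exact: Di.
  - by apply: mu_integrable_norm => //; exact: pri.
congr (_ +i* _).
  apply: (@strip_shift R (fun t u => complex.Re (H (t +i* u))) (fun t u => complex.Im (H (t +i* u)))
    (fun t u => complex.Re (H1 (t +i* u))) a b t0 u0 t1 t2 M) => //.
  - by move=> t u tab tu; have [] := cderiv_horizontal (dH (t +i* u) tab (neq _ _ tu)).
  - by move=> t u tab tu; have [] := cderiv_vertical (dH (t +i* u) tab (neqt _ u tu)).
  - by move=> t u tab tu; have [] := ccont_vertical (cH1 (t +i* u) tab (neqt _ u tu)).
  - by move=> t u tab tu; apply: cRe => //; rewrite tu.
  - move=> t N tab tt0; have [d d0 [C HC]] := H1N t N tab tt0.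
    by exists d => //; exists C => s u sd uN; rewrite (le_trans (Re_le_modulus _))// HC.
  - move=> N; have [C HC] := HN N; exists C => t u tt uN.
    by rewrite (le_trans (Re_le_modulus _))// HC.
  - exact: norm (@Im_le_modulus R) iIm.
apply: (@strip_shift R (fun t u => complex.Im (H (t +i* u))) (fun t u => - complex.Re (H (t +i* u)))
  (fun t u => complex.Im (H1 (t +i* u))) a b t0 u0 t1 t2 M) => //.
- by move=> t u tab tu; have [] := cderiv_horizontal (dH (t +i* u) tab (neq _ _ tu)).
- move=> t u tab tu; have [dR _] := cderiv_vertical (dH (t +i* u) tab (neqt _ u tu)).
  by have := is_deriveN dR; rewrite opprK.
- by move=> t u tab tu; have [] := ccont_vertical (cH1 (t +i* u) tab (neqt _ u tu)).
- by move=> t u tab tu; apply: cIm => //; rewrite tu.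
- move=> t N tab tt0; have [d d0 [C HC]] := H1N t N tab tt0.
  by exists d => //; exists C => s u sd uN; rewrite (le_trans (Im_le_modulus _))// HC.
- move=> N; have [C HC] := HN N; exists C => t u tt uN.
  by rewrite (le_trans (Im_le_modulus _))// HC.
- move=> t tab; have := mu_integrableZl (-1) _ (iRe t tab) => /(_ measurableT).
  by under eq_fun do rewrite mulN1r.
- move=> t tt; under eq_Rintegral do rewrite normrN.
  exact: norm (@Re_le_modulus R) iRe t tt.
Qed.

End StripShift.

(** * The function pi^2 / sin^2 (pi c) *)

Section CscSquare.
Context {R : realType}.
Implicit Types (c z : R[i]) (a b t u : R).

Definition unit_exp c : R[i] := cexp ((2 * pi) *i * c).

(* [pi^2 / sin^2 (pi c)] *)
Definition csc2 c : R[i] :=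
  - ((2 * pi) ^+ 2)%:C * unit_exp c * ((unit_exp c - 1)^-1 * (unit_exp c - 1)^-1).

(** The shape is the one that the product rule produces for [csc2]; only its continuity will matter,
    so it is never simplified. *)
Definition csc2' c : R[i] :=
  let E := unit_exp c in let V := (E - 1)^-1 in let tau := (2 * pi) *i in
  - ((2 * pi) ^+ 2)%:C * (tau * E) * (V * V) +
  - ((2 * pi) ^+ 2)%:C * E * (- (tau * E) * (V * V) * V + V * (- (tau * E) * (V * V))).

Lemma twopi_gt0 : 0 < 2 * pi :> R.
Proof. by rewrite mulr_gt0// pi_gt0. Qed.

Lemma unit_expE t u : unit_exp (t +i* u) =
  (expR (- (2 * pi * u)))%:C * (cos (2 * pi * t) +i* sin (2 * pi * t)).
Proof.
by rewrite /unit_exp /cexp /=; congr (_ * _); rewrite !mul0r ?sub0r ?add0r.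
Qed.

Lemma modulus_unit_exp t u : modulus (unit_exp (t +i* u)) = expR (- (2 * pi * u)).
Proof. by rewrite modulus_cexp /= mul0r sub0r. Qed.

Lemma unit_exp_neq0 c : unit_exp c != 0.
Proof. exact: cexp_neq0. Qed.

Lemma sqr_modulus_unit_expB1 t u : let x := expR (- (2 * pi * u)) in
  modulus (unit_exp (t +i* u) - 1) ^+ 2 = x ^+ 2 - 2 * x * cos (2 * pi * t) + 1.
Proof.
move=> x; rewrite unit_expE -/x sqr_modulus; have := cos2Dsin2 (2 * pi * t).
set C := cos _; set S := sin _ => H.
have -> : complex.Re (x%:C * (C +i* S) - 1) = x * C - 1 by rewrite /=; ring.
have -> : complex.Im (x%:C * (C +i* S) - 1) = x * S by rewrite /=; ring.
rewrite (_ : _ + _ = x ^+ 2 * (C ^+ 2 + S ^+ 2) - 2 * x * C + 1); last by ring.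
by rewrite H mulr1.
Qed.

Lemma cderiv_unit_exp c : cderiv unit_exp c ((2 * pi) *i * unit_exp c).
Proof. exact: cderiv_cexpZ. Qed.

Let cderiv_invE c : unit_exp c != 1 ->
  cderiv (fun w => (unit_exp w - 1)^-1) c
    (- ((2 * pi) *i * unit_exp c) * ((unit_exp c - 1)^-1 * (unit_exp c - 1)^-1)).
Proof.
move=> E1; have E0 : unit_exp c - 1 != 0 by rewrite subr_eq0.
have := @cderivV R (fun w => unit_exp w - 1) c _ E0 (cderivB (cderiv_unit_exp c) (cderiv_cst 1 c)).
by apply: cderiv_eq; rewrite subr0 expr2 invfM.
Qed.

Lemma cderiv_csc2 c : unit_exp c != 1 -> cderiv csc2 c (csc2' c).
Proof.
move=> E1; have dV := cderiv_invE E1.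
exact: (cderivM (cderivZ _ (cderiv_unit_exp c)) (cderivM dV dV)).
Qed.

Lemma cderiv_csc2' c : unit_exp c != 1 -> exists d, cderiv csc2' c d.
Proof.
move=> E1; have dV := cderiv_invE E1; have dE := cderiv_unit_exp c.
have dVV := cderivM dV dV.
have dV' := cderivM (cderivN (cderivZ ((2 * pi) *i) dE)) dVV.
eexists.
exact: (cderivD (cderivM (cderivZ (- ((2 * pi) ^+ 2)%:C) (cderivZ ((2 * pi) *i) dE)) dVV)
  (cderivM (cderivZ (- ((2 * pi) ^+ 2)%:C) dE) (cderivD (cderivM dV' dV) (cderivM dV dV')))).
Qed.

Lemma modulus_csc2 t u : unit_exp (t +i* u) != 1 -> let x := expR (- (2 * pi * u)) in
  modulus (csc2 (t +i* u)) =
    (2 * pi) ^+ 2 * (x / (x ^+ 2 - 2 * x * cos (2 * pi * t) + 1)).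
Proof.
move=> E1 x; have := sqr_modulus_unit_expB1 t u; have := modulus_unit_exp t u.
rewrite /csc2 -/x; move: (unit_exp _) => E Ex EQ.
rewrite !modulusM modulusN modulus_real ger0_norm ?sqr_ge0//.
by rewrite Ex modulusV -invfM -expr2 EQ mulrA.
Qed.

Lemma expR_N_norm u : expR (- (2 * pi * `|u|)) =
  Num.min (expR (- (2 * pi * u))) (expR (- (2 * pi * u)))^-1.
Proof.
rewrite -expRN opprK; have p0 := twopi_gt0.
have [u0|u0] := lerP 0 u.
  by rewrite ger0_norm// min_l// ler_expR; have : 0 <= 2 * pi * u := mulr_ge0 (ltW p0) u0; lra.
have pu : 2 * pi * u < 0 by rewrite pmulr_rlt0.
by rewrite ltr0_norm// mulrN opprK min_r// ler_expR; lra.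
Qed.

(* With [x = e^(-2 pi u)] the two cases bound [x^2 - 2 x cos b + 1] from below
   by [kap max(1, x^2)]. *)
Lemma csc2_bound t u (kap : R) : 0 < kap <= 1 ->
  (cos (2 * pi * t) <= 1 - kap) \/ (expR (- (2 * pi * `|u|)) <= 1 - kap) ->
  unit_exp (t +i* u) != 1 /\
  modulus (csc2 (t +i* u)) <= (2 * pi) ^+ 2 / kap ^+ 2 * expR (- (2 * pi * `|u|)).
Proof.
move=> /andP[k0 k1] H.
set x := expR (- (2 * pi * u)); have x0 : 0 < x by exact: expR_gt0.
set C := cos (2 * pi * t).
have C1 : C <= 1 by exact: cos_le1.
pose Q := x ^+ 2 - 2 * x * C + 1.
have Qb : kap ^+ 2 <= Q /\ kap ^+ 2 * x ^+ 2 <= Q.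
  case: H => [Ck|].
    have h1 : x * C <= x * (1 - kap) by rewrite ler_pM2l.
    have h2 : 0 <= kap * (1 - kap) by rewrite mulr_ge0 ?subr_ge0// ltW.
    have h3 : 0 <= x ^+ 2 * (kap * (1 - kap)) by rewrite mulr_ge0 ?sqr_ge0.
    have h4 := sqr_ge0 (x - (1 - kap)); have h5 := sqr_ge0 (1 - x * (1 - kap)).
    by rewrite /Q; split; lra.
  rewrite expR_N_norm -/x ge_min => /orP[xk|xk].
    have h1 : x * C <= x by rewrite ler_piMr// ltW.
    have h2 : 0 <= (1 - kap - x) * (1 - x + kap) by rewrite mulr_ge0//; lra.
    have h3 : 0 <= kap ^+ 2 * ((1 - x) * (1 + x)).
      by rewrite mulr_ge0 ?sqr_ge0// mulr_ge0//; lra.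
    by rewrite /Q; split; lra.
  have xk1 : 1 <= x * (1 - kap) by rewrite mulrC -ler_pdivrMr// mul1r.
  have xC : x * C <= x by rewrite ler_piMr// ltW.
  have Q1 : (x - 1) ^+ 2 <= Q by rewrite /Q; lra.
  have kx : kap * x <= x - 1 by lra.
  have kx2 : (kap * x) ^+ 2 <= (x - 1) ^+ 2.
    by rewrite lerXn2r// nnegrE ?mulr_ge0 ?ltW//; nra.
  rewrite exprMn in kx2; split; last exact: le_trans Q1.
  by rewrite (le_trans _ (le_trans kx2 Q1))// ler_peMr ?sqr_ge0// exprn_ege1//; nra.
have Q0 : 0 < Q by apply: lt_le_trans Qb.1; rewrite exprn_gt0.
have E1 : unit_exp (t +i* u) != 1.
  apply: contraTneq Q0 => E1; rewrite -leNgt.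
  by have := sqr_modulus_unit_expB1 t u; rewrite E1 subrr modulus0 expr0n /= -/x -/C -/Q => <-.
split=> //; rewrite modulus_csc2// -/x -/C -/Q -mulrA ler_wpM2l ?sqr_ge0//.
rewrite expR_N_norm -/x minEle; case: ifP => _.
  by rewrite mulrC ler_pM2r// lef_pV2 ?posrE ?exprn_gt0// Qb.1.
rewrite ler_pdivrMr// -invfM mulrC ler_pdivlMr ?mulr_gt0 ?exprn_gt0//.
by rewrite mulrCA -expr2 Qb.2.
Qed.

Lemma cos_le_away (be b : R) : 0 <= be <= pi -> be <= b <= 2 * pi - be -> cos b <= cos be.
Proof.
move=> /andP[be0 bepi] /andP[beb b2].
have mono x y : 0 <= x <= pi -> 0 <= y <= pi -> x <= y -> cos y <= cos x.
  move=> xp yp; rewrite le_eqVlt => /predU1P[->//|xy].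
  by apply: ltW; rewrite ltr_cos// in_itv.
have [bpi|bpi] := lerP b pi.
  by apply: mono => //; rewrite ?be0// bpi (le_trans be0 beb).
rewrite -(cosN b) -cosD2pi mulr2n; apply: mono; rewrite ?be0//; last by lra.
by have := @pi_gt0 R => pi0; apply/andP; split; lra.
Qed.

(** If $|u| > de/2$ then $e^{-2\pi|u|}$ is bounded away from 1. Otherwise $|t| \ge de/2$, and
    $2\pi|t|$ keeps the distance [be] from 0 and $2\pi$, so its cosine is bounded away from 1. These
    are the two cases of [csc2_bound]. *)
Lemma csc2_decay (de : R) : 0 < de -> exists2 C : R, 0 <= C & forall t u,
  `|t| <= 1 - de -> de <= modulus (t +i* u) ->
  unit_exp (t +i* u) != 1 /\
  modulus (csc2 (t +i* u)) <= C * expR (- (2 * pi * `|u|)).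
Proof.
move=> de0; have pi0 := @pi_gt0 R.
pose be : R := Num.min (pi * de) pi.
have be0 : 0 < be by rewrite lt_min mulr_gt0.
have bepi : be <= pi by rewrite ge_min lexx orbT.
have cb1 : cos be < 1.
  by rewrite -cos0 ltr_cos// in_itv /= ?lexx ?pi_ge0//= (ltW be0).
have e1 : expR (- (pi * de)) < 1 by rewrite expR_lt1 oppr_lt0 mulr_gt0.
pose kap := Num.min (Num.min (1 - cos be) 1) (1 - expR (- (pi * de))).
have k01 : 0 < kap <= 1 by rewrite !lt_min !subr_gt0 cb1 ltr01 e1 /= !ge_min lexx orbT.
exists ((2 * pi) ^+ 2 / kap ^+ 2); first by rewrite divr_ge0 ?sqr_ge0.
move=> t u t1 tu; apply: csc2_bound => //.
have k1 : kap <= 1 - cos be by rewrite !ge_min lexx.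
have k2 : kap <= 1 - expR (- (pi * de)) by rewrite !ge_min lexx orbT.
have [ut|tu'] := lerP `|u| (de / 2).
  left; suff : cos (2 * pi * t) <= cos be by lra.
  have -> : cos (2 * pi * t) = cos (2 * pi * `|t|).
    by have [//|t0] := ler0P t; rewrite ?mulrN ?cosN.
  apply: cos_le_away; first by rewrite (ltW be0).
  have t2 : de / 2 <= `|t|.
    by have := le_trans tu (modulus_le_ReIm _); rewrite /=; lra.
  have b1 : be <= pi * de by rewrite ge_min lexx.
  have b2 : pi * de <= 2 * pi * `|t| by nra.
  have b3 : 2 * pi * `|t| <= 2 * pi - 2 * pi * de by nra.
  by apply/andP; split; nra.
right; have : expR (- (2 * pi * `|u|)) <= expR (- (pi * de)) by rewrite ler_expR; nra.
lra.
Qed.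

Lemma unit_exp_neq1 t u : 0 < t < 1 -> unit_exp (t +i* u) != 1.
Proof.
move=> /andP[t0 t1]; pose de := Num.min t (1 - t).
have de0 : 0 < de by rewrite lt_min t0 subr_gt0.
have [C C0 H] := csc2_decay de0.
have d1 : de <= t by rewrite ge_min lexx.
have d2 : de <= 1 - t by rewrite ge_min lexx orbT.
apply: (H t u _ _).1; first by rewrite (ger0_norm (ltW t0)); lra.
by apply: le_trans (Re_le_modulus _); rewrite /= (ger0_norm (ltW t0)).
Qed.

(** Let $e = e^{i\pi c}$. The arguments $c/2$ and $(c+1)/2$ have [unit_exp] equal to $e$ and $-e$,
    and the claim becomes $4e^2/(e^2-1)^2 = e/(e-1)^2 - e/(e+1)^2$. *)
Lemma csc2_halves t u : 0 < t < 1 ->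
  4 * csc2 (t +i* u) = csc2 ((t / 2) +i* (u / 2)) + csc2 (((t + 1) / 2) +i* (u / 2)).
Proof.
move=> t01; pose e := unit_exp ((t / 2) +i* (u / 2)).
have E : unit_exp (t +i* u) = e ^+ 2.
  rewrite /e expr2 /unit_exp -cexpD -mulrDr; congr (cexp (_ * _)).
  by apply/eqP; rewrite eq_complex /= -!splitr !eqxx.
have E' : unit_exp (((t + 1) / 2) +i* (u / 2)) = - e.
  rewrite /e !unit_expE -[RHS]mulrN; congr (_ * _).
  rewrite (_ : 2 * pi * ((t + 1) / 2) = 2 * pi * (t / 2) + pi); last by field.
  by rewrite cosDpi sinDpi; apply/eqP; rewrite eq_complex /= !eqxx.
have e1 : e ^+ 2 - 1 != 0 by rewrite subr_eq0 -E unit_exp_neq1.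
have em : e - 1 != 0 by apply: contraNneq e1 => h; rewrite (_ : _ - 1 = (e - 1) * (e + 1));
  [rewrite h mul0r|ring].
have ep : - e - 1 != 0 by apply: contraNneq e1 => h; rewrite (_ : _ - 1 = (- e - 1) * (- e + 1));
  [rewrite h mul0r|ring].
rewrite /csc2 E E' -/e; field.
by rewrite em ep e1.
Qed.

Lemma csc2_reflect t u : 0 < t < 1 -> csc2 ((1 - t) +i* (- u)) = csc2 (t +i* u).
Proof.
move=> t01; have E0 := unit_exp_neq0 (t +i* u).
have E1 : unit_exp (t +i* u) - 1 != 0 by rewrite subr_eq0 unit_exp_neq1.
have E' : unit_exp ((1 - t) +i* (- u)) = (unit_exp (t +i* u))^-1.
  rewrite /unit_exp -cexpN -[RHS]mul1r.
  have <- : cexp ((2 * pi) *i : R[i]) = 1.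
    rewrite /cexp /= expR0 mul1r (_ : 2 * pi = pi *+ 2); last by rewrite mulr_natl.
    by rewrite cos2pi sin2pi.
  rewrite -cexpD; congr cexp; apply/eqP; rewrite eq_complex /=.
  by apply/andP; split; apply/eqP; ring.
rewrite /csc2 E'; set E := unit_exp _ in E0 E1 *.
have E2 : 1 - E != 0 by rewrite -opprB oppr_eq0.
by field; rewrite E0 E1 mulN1r E2.
Qed.

Lemma cexp_taylor1 z : modulus z <= 1 -> modulus (cexp z - 1 - z) <= expR 1 * modulus z ^+ 2.
Proof.
move=> z1.
have := @complex_taylor R [set w | modulus w <= 1] 0 (expR 1) 2 (fun _ => @cexp R) _ _ _ _ z z1.
rewrite (_ : \sum_(i < 2) _ = 1 + z); last first.
  by rewrite !big_ord_recl big_ord0 cexp0 subr0 addr0 /= expr0 expr1 !divr1 mulr1 mul1r.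
rewrite (_ : cexp z - 1 - z = cexp z - (1 + z)); last by ring.
rewrite subr0; apply.
- by have : modulus (0 : R[i]) <= 1 by rewrite modulus0.
- move=> b b1 s /andP[s0 s1]; change (is_true (modulus (0 + s%:C * (b - 0)) <= 1));
  rewrite subr0 add0r modulusM modulus_real ger0_norm//.
  by rewrite mulr_ile1 ?modulus_ge0.
- by move=> j w _ _; exact: cderiv_cexp.
- move=> w w1; rewrite modulus_cexp ler_expR (le_trans (ler_norm _))//.
  by rewrite (le_trans (Re_le_modulus _)).
Qed.

(* Writing [e^z - 1 = z (1 + rho)] with [|rho| = O(|z|)]. *)
Lemma csc2_near0 : exists2 de : R, 0 < de & exists2 C : R, 0 <= C & forall c,
  c != 0 -> modulus c <= de -> modulus (csc2 c - c^-2) <= C / modulus c.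
Proof.
have p0 := twopi_gt0; have pi0 := @pi_gt0 R.
pose K : R := expR 1; have K0 : 0 < K := expR_gt0 1.
have K1 : 1 <= K by rewrite /K -expR0 ler_expR.
(* This radius gives $K|z| \le 1/4$ for $z = 2\pi i c$, hence $|\rho| \le 1/4$ and $|1+\rho| \ge
   3/4$. The factor 32 below is a generous value above $5 \cdot 16/9$. *)
exists (1 / (4 * K * (2 * pi))); first by rewrite divr_gt0// !mulr_gt0.
exists (32 * K * (2 * pi)); first by rewrite !mulr_ge0 ?ltW.
move=> c c0 cde; pose z := (2 * pi) *i * c.
have zm : modulus z = 2 * pi * modulus c.
  by rewrite modulusM modulus_imag ger0_norm ?ltW.
have cm0 : 0 < modulus c by rewrite modulus_gt0.
have zK : 4 * K * modulus z <= 1.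
  by rewrite zm mulrA mulrC -ler_pdivlMr// !mulr_gt0.
have z0 : z != 0 by rewrite -modulus_gt0 zm mulr_gt0.
have zm0 : 0 < modulus z by rewrite modulus_gt0.
have z1 : modulus z <= 1 by nra.
pose rho := (cexp z - 1 - z) / z.
have rhoB : modulus rho <= K * modulus z.
  rewrite modulusM modulusV ler_pdivrMr// -mulrA -expr2.
  exact: cexp_taylor1.
have Ez : cexp z = 1 + z * (1 + rho) by rewrite /rho; field.
have r14 : modulus rho <= 1 / 4 by lra.
have r1 : 3 / 4 <= modulus (1 + rho).
  have : modulus (1 : R[i]) <= modulus (1 + rho) + modulus rho.
    by rewrite -{1}[1](addrK rho) modulusB.
  by rewrite modulus1; lra.
have r10 : 1 + rho != 0 by rewrite -modulus_gt0; lra.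
have -> : csc2 c - c^-2 = ((z - rho) + (z * rho - rho) - rho ^+ 2) / (c ^+ 2 * (1 + rho) ^+ 2).
  have tz : - ((2 * pi) ^+ 2)%:C = z ^+ 2 / c ^+ 2 :> R[i].
    rewrite /z [X in _ = X / _]exprMn mulfK ?expf_neq0//; apply/eqP; rewrite eq_complex /=.
    by apply/andP; split; apply/eqP; ring.
  rewrite /csc2 /unit_exp -/z tz Ez (_ : 1 + z * (1 + rho) - 1 = z * (1 + rho)); last by ring.
  by field; rewrite c0 z0 r10.
have zr : modulus (z * rho) <= modulus z.
  by rewrite modulusM ler_piMr ?modulus_ge0//; lra.
have rr : modulus (rho ^+ 2) <= modulus rho.
  by rewrite modulusX expr2 ler_piMr ?modulus_ge0//; lra.
have num : modulus ((z - rho) + (z * rho - rho) - rho ^+ 2) <= 5 * K * modulus z.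
  apply: (le_trans (modulusB _ _)); apply: (le_trans (lerD (modulusD _ _) (lexx _))).
  have := modulusB z rho; have := modulusB (z * rho) rho.
  have : modulus z <= K * modulus z by rewrite ler_peMl// ltW.
  lra.
rewrite modulusM modulusV modulusM !modulusX ler_pdivrMr; last first.
  by rewrite mulr_gt0// exprn_gt0//; lra.
apply: (le_trans num); rewrite zm.
rewrite [leRHS](_ : _ = 32 * K * (2 * pi) * modulus c * modulus (1 + rho) ^+ 2); last first.
  by field; rewrite gt_eqF.
rewrite [leLHS](_ : _ = 5 * (K * (2 * pi) * modulus c)); last by ring.
rewrite [leRHS](_ : _ = 32 * (K * (2 * pi) * modulus c) * modulus (1 + rho) ^+ 2); last by ring.
set A := K * _ * _; have A0 : 0 < A by rewrite !mulr_gt0.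
have : (3 / 4) ^+ 2 <= modulus (1 + rho) ^+ 2.
  by rewrite lerXn2r// nnegrE ?modulus_ge0// divr_ge0.
by nra.
Qed.

End CscSquare.

(** * The Laplace transform of the Bernoulli function *)

Section RealSubstitution.
Context {R : realType}.
Notation mu := (@lebesgue_measure R).
Implicit Types (f g : R -> R).

Lemma cvgn_comp_subseq (u : nat -> R) (l : R) (k : nat -> nat) :
  (forall n, (n <= k n)%N) -> u @ \oo --> l -> (fun n => u (k n)) @ \oo --> l.
Proof.
move=> kn /cvgrPdist_lt ul; apply/cvgrPdist_lt => e e0.
have [N _ H] := ul e e0; exists N => // n /= Nn; apply: H.
exact: leq_trans (kn n).
Qed.

Lemma Rintegral_reflect g : continuous g ->
  mu.-integrable setT (EFin \o g) -> mu.-integrable setT (EFin \o (fun x => g (- x))) ->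
  \int[mu]_x g (- x) = \int[mu]_x g x.
Proof.
move=> gc gi gi'.
have := cvg_truncated_integral gi'.
rewrite (_ : (fun n => _) = (fun n : nat => \int[mu]_(x in `[- n%:R, n%:R]) g x)).
  by move=> H; apply: (real_cvgn_unique H); exact: cvg_truncated_integral.
apply/funext => n; rewrite /Rintegral; congr fine.
have Nn : - n%:R <= n%:R :> R by rewrite (@le_trans _ _ 0)// oppr_le0.
have := @integration_by_substitution_oppr R g (- n%:R) n%:R Nn.
rewrite opprK => -> //; exact: continuous_subspaceT.
Qed.

Lemma Rintegral_scale2 g : continuous g ->
  mu.-integrable setT (EFin \o g) -> mu.-integrable setT (EFin \o (fun x => g (x / 2))) ->
  \int[mu]_x g (x / 2) = 2 * \int[mu]_x g x.
Proof.
move=> gc gi gi'.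
have h1 := cvgn_comp_subseq (k := fun n => (n * 2)%N) (fun n =>
  leq_pmulr n (isT : 0 < 2)%N) (cvg_truncated_integral gi').
have h2 : (fun n : nat => 2 * \int[mu]_(x in `[- n%:R, n%:R]) g x) @ \oo --> 2 * \int[mu]_x g x.
  by apply: cvgM; [exact: cvg_cst|exact: cvg_truncated_integral].
apply: (real_cvgn_unique h1); move: h2.
rewrite [X in X @ _ --> _ -> _](_ : _ = (fun n : nat =>
    \int[mu]_(x in `[- (n * 2)%:R, (n * 2)%:R]) g (x / 2)))//.
apply/funext => n.
have F' (x : R) : is_derive x 1 (fun x : R => x * 2) 2.
  by apply: is_derive_eq; rewrite /GRing.scale /=; ring.
have F'E : (fun x : R => x * 2)^`() = cst 2.
  by apply/funext => x; rewrite derive1E; have H := F' x; exact: derive_val.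
have gi2 : mu.-integrable `[- n%:R, n%:R] (EFin \o g).
  exact: (mu_integrableS _ _ (@subsetT _ _) gi).
rewrite -mu_RintegralZl// [RHS]/Rintegral natrM -mulNr.
have Nn : - n%:R <= n%:R :> R by rewrite (@le_trans _ _ 0)// oppr_le0.
have H := @integration_by_substitution_increasing R (fun x : R => x * 2) (fun x =>
  g (x / 2)) (- n%:R) n%:R Nn.
rewrite H.
- rewrite F'E; congr fine; apply: eq_integral => x _; congr EFin.
  have -> : (((fun x0 : R => g (x0 / 2)) \o (fun x0 : R =>
    x0 * 2)) * cst 2) x = g (x * 2 / 2) * 2 by [].
  by rewrite mulfK// mulrC.
- by move=> x y _ _ xy; rewrite ltr_pM2r.
- by move=> x _; rewrite F'E; exact: cvg_cst.
- by rewrite F'E; exact: is_cvg_cst.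
- by rewrite F'E; exact: is_cvg_cst.
- split.
  + by move=> x _; have K := F' x; exact: ex_derive.
  + by apply: cvg_at_right_filter; exact: (is_derive_continuous (F' _)).
  + by apply: cvg_at_left_filter; exact: (is_derive_continuous (F' _)).
- apply: continuous_subspaceT => x; apply: (@continuous_comp _ _ _ (fun x : R => x / 2) g);
  last exact: gc.
  by apply: cvgM; [exact: cvg_id|exact: cvg_cst].
Qed.

Lemma continuous_expR_lin (a : R) : continuous (fun x : R => expR (- (a * `|x|))).
Proof.
move=> x; apply: (@continuous_comp _ _ _ (fun x : R => - (a * `|x|)) expR);
  last exact: continuous_expR.
by apply: cvgN; apply: cvgM; [exact: cvg_cst|exact: norm_continuous].
Qed.

Lemma integrable_expR_abs (a : R) : 0 < a ->
  mu.-integrable setT (EFin \o (fun x : R => expR (- (a * `|x|)))).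
Proof.
move=> a0; have cE := @continuous_expR_lin a.
apply/integrableP; split.
  by apply/measurable_EFinP; exact: continuous_measurable_fun.
under eq_integral do rewrite /= ger0_norm ?expR_ge0//.
have E0 (x : R) : 0 <= expR (- (a * `|x|)) by exact: expR_ge0.
have Esym : (fun x : R => expR (- (a * `|x|))) =1 (fun x : R => expR (- (a * `|x|))) \o -%R.
  by move=> x /=; rewrite normrN.
rewrite (ge0_symfun_integralT E0 cE Esym).
rewrite -set_itvcy; have -> : (\int[mu]_(x in `[0%R, +oo[) (expR (- (a * `|x|)))%:E =
    \int[mu]_(x in `[0%R, +oo[) (expR (- (a * x)))%:E)%E.
  apply: eq_integral => x; rewrite inE /= in_itv /= andbT => x0.
  by rewrite ger0_norm.
have dF (x : R) : is_derive x 1 (fun x : R => - (a^-1 * expR (- (a * x)))) (expR (- (a * x))).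
  apply: is_derive_eq; rewrite /GRing.scale /=.
  by field; rewrite gt_eqF.
rewrite (@ge0_continuous_FTC2y _ (fun x : R => expR (- (a * x))) (fun x : R =>
  - (a^-1 * expR (- (a * x)))) 0 0).
- by rewrite -EFinB lte_mul_pinfty// ltry.
- by move=> x _; exact: expR_ge0.
- apply: continuous_subspaceT => x.
  apply: (@continuous_comp _ _ _ (fun x : R => - (a * x)) expR); last exact: continuous_expR.
  by apply: cvgN; apply: cvgM; [exact: cvg_cst|exact: cvg_id].
- have -> : nbhs (0 : R) = nbhs (- (a^-1 * 0) : R) by rewrite mulr0 oppr0.
  apply: cvgN; apply: cvgM; first exact: cvg_cst.
  apply/cvgrPdist_lt => e e0; exists (- (ln e / a)); split; first exact: num_real.
  move=> x /= H; rewrite sub0r normrN ger0_norm ?expR_ge0// -[ltRHS]lnK// ltr_expR.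
  by move: H; rewrite -mulNr ltr_pdivrMr//; lra.
- by move=> x _; have H := dF x; exact: ex_derive.
- by apply: cvg_at_right_filter; exact: (is_derive_continuous (dF _)).
- by move=> x _; rewrite derive1E; have H := dF x; exact: derive_val.
Qed.

Lemma mul_expRN_le1 (y : R) : y * expR (- y) <= 1.
Proof.
rewrite expRN ler_pdivrMr ?expR_gt0// mul1r.
by have := expR_ge1Dx y; lra.
Qed.

(** Half of the exponent absorbs the linear factor, because $y e^{-ay/2} \le 2/a$. *)
Lemma add1_expR_le (a y : R) : 0 < a -> 0 <= y ->
  (1 + y) * expR (- (a * y)) <= (1 + 2 / a) * expR (- (a / 2 * y)).
Proof.
move=> a0 y0; have -> : expR (- (a * y)) = expR (- (a / 2 * y)) * expR (- (a / 2 * y)).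
  by rewrite -expRD; congr expR; field.
rewrite mulrA ler_wpM2r ?expR_ge0//.
have h1 : expR (- (a / 2 * y)) <= 1.
  by rewrite expR_le1 oppr_le0 !mulr_ge0// ltW.
have h2 := mul_expRN_le1 (a / 2 * y).
have h3 : y * expR (- (a / 2 * y)) <= 2 / a.
  by rewrite ler_pdivlMr//; lra.
by lra.
Qed.
End RealSubstitution.

(** * Complex-valued integrals by components *)

Section ComplexIntegral.
Context {R : realType}.
Notation mu := (@lebesgue_measure R).
Implicit Types (F G : R -> R[i]) (g : R -> R).

Definition cmeasurable F : Prop :=
  measurable_fun setT (fun x => complex.Re (F x)) /\
  measurable_fun setT (fun x => complex.Im (F x)).

(** The real and imaginary parts are estimated separately, which costs the factor 2 in the bound. *)
Lemma cintegrable_dominated F g : cmeasurable F ->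
  mu.-integrable setT (EFin \o g) -> (forall x, modulus (F x) <= g x) ->
  cintegrable F /\ modulus (cintegral F) <= 2 * \int[mu]_x g x.
Proof.
move=> [mR mI] gi Fg.
have gR x : [set: R] x -> `|complex.Re (F x)| <= g x.
  by move=> _; exact: le_trans (Re_le_modulus _) (Fg x).
have gI x : [set: R] x -> `|complex.Im (F x)| <= g x.
  by move=> _; exact: le_trans (Im_le_modulus _) (Fg x).
have iR := integrable_dominated measurableT mR gi gR.
have iI := integrable_dominated measurableT mI gi gI.
split; first by split.
apply: (le_trans (modulus_le_ReIm _)); rewrite mulr_natl mulr2n /=.
by apply: lerD; apply: mu_le_normr_Rintegral.
Qed.

Lemma cintegrableD F G : cintegrable F -> cintegrable G ->
  cintegrable (fun x => F x + G x) /\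
  cintegral (fun x => F x + G x) = cintegral F + cintegral G.
Proof.
move=> [FR FI] [GR GI]; split.
  by split; [under eq_fun do rewrite ReD|under eq_fun do rewrite ImD];
    exact: mu_integrableD.
rewrite /cintegral; apply/eqP; rewrite eq_complex /= -!mu_RintegralD//.
by apply/andP; split; apply/eqP; apply: eq_Rintegral => x _; rewrite ?ReD ?ImD.
Qed.

Lemma cintegrableZ (c : R[i]) F : cintegrable F ->
  cintegrable (fun x => c * F x) /\ cintegral (fun x => c * F x) = c * cintegral F.
Proof.
move=> [FR FI]; split.
  split; [under eq_fun do rewrite ReM|under eq_fun do rewrite ImM].
    by apply: mu_integrableB => //; exact: mu_integrableZl.
  by apply: mu_integrableD => //; exact: mu_integrableZl.
rewrite /cintegral; apply/eqP; rewrite eq_complex ReM ImM /=.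
rewrite -!mu_RintegralZl// -mu_RintegralB//; try exact: mu_integrableZl.
rewrite -mu_RintegralD//; try exact: mu_integrableZl.
by apply/andP; split; apply/eqP; apply: eq_Rintegral => x _; rewrite ?ReM ?ImM.
Qed.

Lemma cintegrable_ext F G : F =1 G -> cintegrable F -> cintegrable G.
Proof. by move=> /funext ->. Qed.

Lemma eq_cintegral F G : F =1 G -> cintegral F = cintegral G.
Proof. by move=> /funext ->. Qed.

Lemma cintegrableB F G : cintegrable F -> cintegrable G ->
  cintegrable (fun x => F x - G x) /\
  cintegral (fun x => F x - G x) = cintegral F - cintegral G.
Proof.
move=> Fi Gi; have [Ni NE] := cintegrableZ (-1) Gi.
have [Di DE] := cintegrableD Fi Ni; rewrite -(mulN1r (cintegral G)) -NE -DE.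
by split; [apply: cintegrable_ext Di|apply: eq_cintegral] => x; rewrite mulN1r.
Qed.

Lemma cintegrable_measurable F : cintegrable F -> cmeasurable F.
Proof. by move=> [/mu_integrable_measurable ? /mu_integrable_measurable]. Qed.

Lemma cmeasurable_modulus F : cmeasurable F -> measurable_fun setT (fun x => modulus (F x)).
Proof.
move=> [mR mI].
rewrite (_ : (fun x => _) = Num.sqrt \o (fun x => complex.Re (F x) ^+ 2 + complex.Im (F x) ^+ 2)).
  apply: measurableT_comp; first by apply: continuous_measurable_fun; exact: sqrt_continuous.
  by apply: measurable_funD; exact: measurable_funX.
by apply/funext => x /=; case: (F x).
Qed.

Lemma cmeasurable_continuous F :
  continuous (fun x => complex.Re (F x)) -> continuous (fun x => complex.Im (F x)) ->
  cmeasurable F.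
Proof. by move=> cR cI; split; exact: continuous_measurable_fun. Qed.

End ComplexIntegral.

(** * The Bernoulli function on the real line *)

Section BernoulliHat.
Context {R : realType}.
Notation mu := (@lebesgue_measure R).
Implicit Types (x y t u : R).

Definition beta x : R := if x == 0 then 1 else x * expR x / (expR x - 1).

Lemma bernoulli_fun_real x : bernoulli_fun (x%:C : R[i]) = (beta x)%:C.
Proof.
rewrite /bernoulli_fun /beta (inj_eq (@complexI R)); case: ifP => // _.
by rewrite cexp_real -!rmorphM -(rmorph1 (real_complex R)) -rmorphB -fmorphV -rmorphM.
Qed.

Lemma expRB1_neq0 x : x != 0 -> expR x - 1 != 0.
Proof. by apply: contra_neq => /eqP; rewrite subr_eq0 -expR0 => /eqP/expR_inj. Qed.

Lemma betaN x : beta (- x) = beta x * expR (- x).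
Proof.
rewrite /beta oppr_eq0; case: eqVneq => [->|x0]; first by rewrite oppr0 expR0 mulr1.
have e0 := expRB1_neq0 x0; have x1 := lt0r_neq0 (expR_gt0 x).
have e1 : 1 - expR x != 0 by rewrite -oppr_eq0 opprB.
by rewrite expRN; field; rewrite ?x1 ?e0 ?mulN1r ?e1.
Qed.

Lemma betaE x : beta x = x + beta (- x).
Proof.
rewrite betaN /beta; case: eqVneq => [->|x0]; first by rewrite add0r oppr0 expR0 mulr1.
have e0 := expRB1_neq0 x0; have x1 := lt0r_neq0 (expR_gt0 x).
by rewrite expRN; field; rewrite x1 e0.
Qed.

(** Here $\beta(-x) = x/(e^x - 1)$ for positive $x$; the two last bounds are $1 + x \le e^x$ and $1
    - x \le e^{-x}$. *)
Lemma betaN_bounds x : 0 <= x -> [/\ 0 <= beta (- x), beta (- x) <= 1 & 1 - x <= beta (- x)].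
Proof.
rewrite le_eqVlt => /predU1P[<-|x0]; first by rewrite oppr0 /beta eqxx addr0 ler01 !lexx.
have e1 : x <= expR x - 1 by have := expR_ge1Dx x; lra.
have e0 : 0 < expR x - 1 by lra.
have -> : beta (- x) = x / (expR x - 1).
  rewrite betaN /beta gt_eqF// expRN; field.
  by rewrite !gt_eqF// expR_gt0.
split; first by rewrite divr_ge0// ltW.
  by rewrite ler_pdivrMr// mul1r.
rewrite ler_pdivlMr//.
have h : (1 - x) * expR x <= 1.
  by rewrite -ler_pdivlMr ?expR_gt0// mul1r -expRN expR_ge1Dx.
by lra.
Qed.

Lemma beta_ge0 x : 0 <= beta x.
Proof.
have [x0|x0] := lerP 0 x.
  by rewrite betaE addr_ge0//; have [] := betaN_bounds x0.
have [|b0 _ _] := @betaN_bounds (- x); first by rewrite oppr_ge0 ltW.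
by rewrite opprK in b0.
Qed.

Lemma beta_B1 x : `|beta x - 1| <= `|x|.
Proof.
have [x0|x0] := lerP 0 x.
  have [b0 b1 b2] := betaN_bounds x0; rewrite betaE (ger0_norm x0).
  by rewrite ler_norml; apply/andP; split; lra.
have [|b0 b1 b2] := @betaN_bounds (- x); first by rewrite oppr_ge0 ltW.
rewrite opprK in b0 b1 b2; rewrite (ltr0_norm x0).
by rewrite ler_norml; apply/andP; split; lra.
Qed.

Lemma beta_continuous : continuous beta.
Proof.
move=> x; have [->|x0] := eqVneq x 0.
  apply/cvgrPdist_le => e e0; exists e => // y /=; rewrite sub0r normrN => ye.
  by rewrite {1}/beta eqxx distrC (le_trans (beta_B1 y))// ltW.
have c : {for x, continuous (fun y => y * expR y / (expR y - 1))}.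
  apply: cvgM; first by apply: cvgM; [exact: cvg_id|exact: continuous_expR].
  apply: cvgV; first exact: expRB1_neq0.
  by apply: cvgB; [exact: continuous_expR|exact: cvg_cst].
rewrite /continuous_at {2}/beta (negbTE x0); apply: cvg_trans c.
apply: near_eq_cvg; exists `|x|; first by rewrite /= normr_gt0.
move=> y /= xy; rewrite /beta ifF//; apply: contraTF xy => /eqP ->.
by rewrite subr0 ltxx.
Qed.

Definition laplace_beta t u x : R[i] := (beta x)%:C * cexp (- ((t +i* u) * x%:C)).

Lemma cexp_ReIm t u x : cexp (- ((t +i* u) * x%:C)) =
  (expR (- (t * x)) * cos (u * x)) +i* (- (expR (- (t * x)) * sin (u * x))) :> R[i].
Proof.
rewrite /cexp /= !mulr0 !subr0 add0r cosN sinN; apply/eqP; rewrite eq_complex /=.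
by apply/andP; split; apply/eqP; ring.
Qed.

Lemma cexp_continuous t u :
  continuous (fun x => complex.Re (cexp (- ((t +i* u) * x%:C)) : R[i])) /\
  continuous (fun x => complex.Im (cexp (- ((t +i* u) * x%:C)) : R[i])).
Proof.
have ce : continuous (fun x : R => expR (- (t * x))).
  move=> x; apply: (@continuous_comp _ _ _ (fun x : R => - (t * x)) expR);
    last exact: continuous_expR.
  by apply: cvgN; apply: cvgM; [exact: cvg_cst|exact: cvg_id].
have cl : continuous (fun x : R => u * x).
  by move=> x; apply: cvgM; [exact: cvg_cst|exact: cvg_id].
split; under eq_fun do rewrite cexp_ReIm /=.
  move=> x; apply: cvgM; first exact: ce.
  by apply: (@continuous_comp _ _ _ (fun x : R => u * x) cos); [exact: cl|exact: continuous_cos].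
move=> x; apply: cvgN; apply: cvgM; first exact: ce.
by apply: (@continuous_comp _ _ _ (fun x : R => u * x) sin); [exact: cl|exact: continuous_sin].
Qed.

Lemma real_cexp_continuous (w : R -> R) t u : continuous w ->
  continuous (fun x => complex.Re ((w x)%:C * cexp (- ((t +i* u) * x%:C)) : R[i])) /\
  continuous (fun x => complex.Im ((w x)%:C * cexp (- ((t +i* u) * x%:C)) : R[i])).
Proof.
move=> wc; have [cR cI] := cexp_continuous t u.
split.
  rewrite (_ : (fun x => _) = (fun x => w x * complex.Re (cexp (- ((t +i* u) * x%:C)) : R[i]))).
    by move=> x; apply: cvgM; [exact: wc|exact: cR].
  by apply/funext => x; rewrite ReM (_ : complex.Im (w x)%:C = 0)// mul0r subr0.
rewrite (_ : (fun x => _) = (fun x => w x * complex.Im (cexp (- ((t +i* u) * x%:C)) : R[i]))).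
  by move=> x; apply: cvgM; [exact: wc|exact: cI].
by apply/funext => x; rewrite ImM (_ : complex.Im (w x)%:C = 0)// mul0r addr0.
Qed.

Lemma modulus_real_cexp (w : R) t u x :
  modulus (w%:C * cexp (- ((t +i* u) * x%:C))) = `|w| * expR (- (t * x)).
Proof. by rewrite modulusM modulus_real modulus_cexp /= mulr0 subr0. Qed.

(** [beta] grows linearly at $+\infty$ and decays like $|x|e^{-|x|}$ at $-\infty$. The integrand
    thus decays at rate $t$ on the right and $1 - t$ on the left, which explains the strip $0 < t <
    1$. *)
Lemma modulus_laplace_beta t u x (de : R) : de <= t -> de <= 1 - t ->
  modulus (laplace_beta t u x) <= (1 + `|x|) * expR (- (de * `|x|)).
Proof.
move=> dt dt1; rewrite modulus_real_cexp ger0_norm ?beta_ge0//.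
have [x0|x0] := lerP 0 x.
  have [b0 b1 b2] := betaN_bounds x0; rewrite (ger0_norm x0) betaE.
  by apply: ler_pM; rewrite ?expR_ge0 ?addr_ge0//; [lra|rewrite ler_expR; nra].
have [|b0 b1 b2] := @betaN_bounds (- x); first by rewrite oppr_ge0 ltW.
rewrite (ltr0_norm x0) -{1}(opprK x) betaN opprK -mulrA -expRD.
apply: ler_pM; rewrite ?expR_ge0 ?beta_ge0//.
  by rewrite betaE opprK in b0 b1 *; lra.
by rewrite ler_expR; nra.
Qed.

Lemma integrable_add1_expR (a : R) : 0 < a ->
  mu.-integrable setT (EFin \o (fun x : R => (1 + `|x|) * expR (- (a * `|x|)))).
Proof.
move=> a0; have a2 : 0 < a / 2 by rewrite divr_gt0.
apply: (integrable_dominated _ _ (mu_integrableZl (1 + 2 / a) measurableT (integrable_expR_abs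
  a2))) => //.
  apply: continuous_measurable_fun => x; apply: cvgM; last exact: continuous_expR_lin.
  by apply: cvgD; [exact: cvg_cst|exact: norm_continuous].
move=> x _; rewrite ger0_norm ?mulr_ge0 ?addr_ge0 ?expR_ge0//.
exact: add1_expR_le.
Qed.

Lemma laplace_beta_integrable t u : 0 < t < 1 -> cintegrable (laplace_beta t u).
Proof.
move=> /andP[t0 t1]; pose de := Num.min t (1 - t).
have de0 : 0 < de by rewrite lt_min t0 subr_gt0.
have mF : cmeasurable (laplace_beta t u).
  by have [cR cI] := real_cexp_continuous t u beta_continuous; exact: cmeasurable_continuous.
apply: (cintegrable_dominated mF (integrable_add1_expR de0) _).1 => x.
by apply: modulus_laplace_beta; rewrite ge_min lexx ?orbT.
Qed.

End BernoulliHat.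

(** * Functional equations of the transform and its closed form *)

Section BernoulliHatClosedForm.
Context {R : realType}.
Notation mu := (@lebesgue_measure R).
Implicit Types (x y t u : R).

(** Its Laplace transform $c^{-2}$ is the singular part at 0 of the transform of [beta]. *)
Definition pos_part x : R := (x + `|x|) / 2.

Lemma pos_part_ge0 x : 0 <= x -> pos_part x = x.
Proof. by move=> x0; rewrite /pos_part ger0_norm//; field. Qed.

Lemma pos_part_lt0 x : x < 0 -> pos_part x = 0.
Proof. by move=> x0; rewrite /pos_part ltr0_norm// subrr mul0r. Qed.

Lemma pos_part_continuous : continuous pos_part.
Proof.
move=> x; apply: cvgM; last exact: cvg_cst.
by apply: cvgD; [exact: cvg_id|exact: norm_continuous].
Qed.

Definition laplace_pos t u x : R[i] := (pos_part x)%:C * cexp (- ((t +i* u) * x%:C)).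

Lemma laplace_pos_integrable t u : 0 < t -> cintegrable (laplace_pos t u).
Proof.
move=> t0; have mF : cmeasurable (laplace_pos t u).
  by have [cR cI] := real_cexp_continuous t u pos_part_continuous; exact: cmeasurable_continuous.
apply: (cintegrable_dominated mF (integrable_add1_expR t0) _).1 => x.
rewrite modulus_real_cexp; have [x0|x0] := lerP 0 x.
  by rewrite pos_part_ge0// ger0_norm// ler_wpM2r ?expR_ge0// lerDr.
by rewrite pos_part_lt0// normr0 mul0r mulr_ge0 ?expR_ge0// addr_ge0.
Qed.

Lemma expRN_harmonic (a : R) n : 0 < a -> expR (- (a * n.+1%:R)) <= a^-1 * harmonic n.
Proof.
move=> a0; have n0 : (0 : R) < n.+1%:R by [].
have := mul_expRN_le1 (a * n.+1%:R).
rewrite (_ : a^-1 * harmonic n = 1 / (a * n.+1%:R)); last by rewrite mul1r invfM.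
by rewrite ler_pdivlMr ?mulr_gt0// mulrC.
Qed.

Lemma cvg0_harmonic (v : nat -> R) (K : R) : (forall n, `|v n| <= K * harmonic n) ->
  v @ \oo --> (0 : R).
Proof.
move=> vK.
have hK : (fun n => K * harmonic n) @ \oo --> (0 : R).
  have -> : nbhs (0 : R) = nbhs (K * 0 : R) by rewrite mulr0.
  by apply: cvgM; [exact: cvg_cst|exact: cvg_harmonic].
have hNK : (fun n => - (K * harmonic n)) @ \oo --> (0 : R).
  by rewrite -oppr0; apply: cvgN.
apply: (squeeze_cvgr _ hNK hK); apply: nearW => n.
by have := vK n; rewrite ler_norml.
Qed.

Lemma cintegral_laplace_pos t u : 0 < t -> cintegral (laplace_pos t u) = (t +i* u)^-2.
Proof.
move=> t0; set c : R[i] := t +i* u.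
have cm : 0 < modulus c by apply: lt_le_trans (Re_le_modulus _); rewrite normr_gt0 gt_eqF.
have c0 : c != 0 by rewrite -modulus_gt0.
(* The primitive of $z e^{-cz}$ that tends to 0 at $+\infty$; the integral is therefore $-A(0) =
   c^{-2}$. *)
pose A (z : R[i]) := - (z * c^-1 + c^-2) * cexp (- c * z).
have dA z : cderiv A z (z * cexp (- c * z)).
  have d1 := cderivN (cderivD (cderivM (cderiv_id z) (cderiv_cst c^-1 z)) (cderiv_cst (c^-2) z)).
  apply: cderiv_eq (cderivM d1 (cderiv_cexpZ (- c) z)).
  by field.
have dAx x : pderiv (fun x => A x%:C) x (x%:C * cexp (- c * x%:C)).
  have E s : 0 + s%:C * 1 = s%:C :> R[i] by rewrite add0r mulr1.
  have := @cderiv_path R A 0 1 x; rewrite E => /(_ _ (dA x%:C)); rewrite mulr1.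
  by rewrite (_ : (fun s : R => _) = (fun x => A x%:C))//; apply/funext => s; rewrite E.
have [LR LI] := laplace_pos_integrable u t0.
have A0 : A 0 = - c^-2 by rewrite /A mul0r add0r mulr0 cexp0 mulr1.
pose K := (modulus c)^-1 + (modulus c)^-1 ^+ 2.
have K0 : 0 <= K by rewrite addr_ge0 ?sqr_ge0// invr_ge0 ltW.
have AK n : modulus (A n.+1%:R%:C) <= K * (1 + 2 / t) * (t / 2)^-1 * harmonic n.
  have n0 : (0 : R) <= n.+1%:R by [].
  rewrite /A modulusM modulusN modulus_cexp.
  have -> : complex.Re (- c * n.+1%:R%:C) = - (t * n.+1%:R).
    by rewrite /c /= mulr0 subr0 mulNr.
  apply: (@le_trans _ _ (K * ((1 + n.+1%:R) * expR (- (t * n.+1%:R))))).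
    rewrite mulrA ler_wpM2r ?expR_ge0//.
    rewrite (le_trans (modulusD _ _))// modulusM modulus_real ger0_norm// !modulusV modulusX.
    have i0 : 0 <= (modulus c)^-1 by rewrite invr_ge0 ltW.
    have j0 : 0 <= (modulus c)^-1 ^+ 2 by exact: sqr_ge0.
    rewrite -exprVn /K mulrDl !mulrDr !mulr1.
    have := mulr_ge0 i0 n0; have := mulr_ge0 j0 n0.
    lra.
  rewrite -!mulrA ler_wpM2l//.
  apply: (le_trans (add1_expR_le t0 n0)); apply: ler_wpM2l.
    by rewrite addr_ge0// divr_ge0// ltW.
  by apply: expRN_harmonic; rewrite divr_gt0.
have trunc (pr : R[i] -> R) (F : R -> R) n : (forall x, x < 0 -> F x = 0) ->
    \int[mu]_(x in `[- n.+1%:R, n.+1%:R]) F x = \int[mu]_(x in `[0, n.+1%:R]) F x.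
  move=> F0; rewrite [LHS]Rintegral_mkcond [RHS]Rintegral_mkcond.
  apply: eq_Rintegral => x _; rewrite !patchE.
  have [x0|x0] := ltP x 0; first by rewrite F0//; case: ifP; case: ifP.
  congr (if _ then _ else _); apply/idP/idP; rewrite !inE /= !in_itv /= => /andP[? ?];
    apply/andP; split => //.
  by rewrite (le_trans _ x0)// oppr_le0.
have main (pr : R[i] -> R) (F : R -> R) : (forall z w, pr (z - w) = pr z - pr w) ->
    (forall z, `|pr z| <= modulus z) ->
    (forall x, 0 <= x -> is_derive x 1 (fun x => pr (A x%:C)) (F x)) ->
    (forall x, x < 0 -> F x = 0) -> continuous F ->
    mu.-integrable setT (EFin \o F) ->
    \int[mu]_x F x = pr (c^-2).
  move=> prB prm dF F0 Fc Fi.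
  have h1 := cvgn_comp_subseq (k := S) leqnSn (cvg_truncated_integral Fi).
  apply: (real_cvgn_unique h1).
  have -> : (fun n : nat => \int[mu]_(x in `[- n.+1%:R, n.+1%:R]) F x) =
      (fun n => pr (A n.+1%:R%:C) - pr (A 0)).
    apply/funext => n; rewrite (trunc pr)//.
    have dF' (x : R) : 0 <= x <= n.+1%:R -> is_derive x 1 (fun x => pr (A x%:C)) (F x).
      by move=> /andP[x0 _]; exact: dF.
    have n0 : (0 : R) < n.+1%:R by [].
    exact: (FTC_derivative n0 dF' (continuous_subspaceT Fc)).
  have -> : nbhs (pr (c^-2)) = nbhs (0 - pr (A 0)).
    have pr0 : pr 0 = 0 by rewrite -(subrr (0 : R[i])) prB subrr.
    by rewrite A0 -[- c^-2]sub0r prB pr0 !sub0r opprK.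
  apply: cvgB; last exact: cvg_cst.
  by apply: cvg0_harmonic => n; exact: le_trans (prm _) (AK n).
have Lx x : 0 <= x -> laplace_pos t u x = x%:C * cexp (- c * x%:C).
  by move=> x0; rewrite /laplace_pos pos_part_ge0// mulNr.
have L0 x : x < 0 -> laplace_pos t u x = 0.
  by move=> x0; rewrite /laplace_pos pos_part_lt0// mul0r.
have [cR cI] := real_cexp_continuous t u pos_part_continuous.
have dR x : 0 <= x -> is_derive x 1 (fun x => complex.Re (A x%:C)) (complex.Re (laplace_pos t u x)).
  by move=> x0; rewrite Lx//; have [] := dAx x.
have dI x : 0 <= x -> is_derive x 1 (fun x => complex.Im (A x%:C)) (complex.Im (laplace_pos t u x)).
  by move=> x0; rewrite Lx//; have [] := dAx x.
have R0 x : x < 0 -> complex.Re (laplace_pos t u x) = 0 by move=> x0; rewrite L0.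
have I0 x : x < 0 -> complex.Im (laplace_pos t u x) = 0 by move=> x0; rewrite L0.
have RB (z w : R[i]) : complex.Re (z - w) = complex.Re z - complex.Re w by rewrite ReD ReN.
have IB (z w : R[i]) : complex.Im (z - w) = complex.Im z - complex.Im w by rewrite ImD ImN.
rewrite /cintegral (main _ _ RB (@Re_le_modulus R) dR R0 cR LR).
by rewrite (main _ _ IB (@Im_le_modulus R) dI I0 cI LI) -complex_decomp.
Qed.

(** This is $\sqrt{2\pi}\,\hat{\mathcal{B}}(u - it)$, since $i(u - it) = t + iu$. *)
Definition bernoulli_laplace t u : R[i] := cintegral (laplace_beta t u).

(** After removal of the positive part there remains $\beta(-|x|) \le (1+|x|)e^{-|x|}$. For $t \le
    1/2$ the factor $e^{-tx}$ uses up at most half of this decay, uniformly in $t$ and $u$. *)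
Lemma bernoulli_laplace_near0 : exists M : R, forall t u, 0 < t <= 1 / 2 ->
  modulus (bernoulli_laplace t u - (t +i* u)^-2) <= M.
Proof.
pose g x := (1 + `|x|) * expR (- (1 / 2 * `|x|)).
have gi : mu.-integrable setT (EFin \o g) by apply: integrable_add1_expR; rewrite divr_gt0.
exists (2 * \int[mu]_x g x) => t u /andP[t0 t1].
have Ki : cintegrable (laplace_beta t u) by apply: laplace_beta_integrable; rewrite t0/=; lra.
have Pi := laplace_pos_integrable u t0.
have [Di DE] := cintegrableB Ki Pi.
rewrite -(cintegral_laplace_pos u t0) -DE.
apply: (cintegrable_dominated (cintegrable_measurable Di) gi _).2 => x.
rewrite /laplace_beta /laplace_pos -mulrBl -rmorphB modulus_real_cexp.
have E : beta x - pos_part x = beta (- `|x|).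
  have [x0|x0] := lerP 0 x; first by rewrite pos_part_ge0// (ger0_norm x0) betaE addrC addKr.
  by rewrite pos_part_lt0// (ltr0_norm x0) opprK subr0.
have x0 := normr_ge0 x; have [b0 b1 b2] := betaN_bounds x0.
rewrite E ger0_norm// betaN.
have b3 : beta `|x| <= 1 + `|x| by rewrite betaE; lra.
rewrite -mulrA -expRD; apply: ler_pM; rewrite ?expR_ge0 ?beta_ge0//.
rewrite ler_expR.
have h1 : - (t * x) <= t * `|x|.
  by rewrite -mulrN; apply: (ler_wpM2l (ltW t0)); rewrite (le_trans (ler_norm _))// normrN.
have h2 : t * `|x| <= 1 / 2 * `|x| by rewrite ler_wpM2r.
lra.
Qed.

Lemma bernoulli_laplace_reflect t u : 0 < t < 1 ->
  bernoulli_laplace (1 - t) (- u) = bernoulli_laplace t u.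
Proof.
move=> t01; have t01' : 0 < 1 - t < 1 by move: t01 => /andP[? ?]; apply/andP; split; lra.
have E x : laplace_beta (1 - t) (- u) x = laplace_beta t u (- x).
  have bE : (beta (- x))%:C = (beta x)%:C * cexp (- x)%:C :> R[i].
    by rewrite cexp_real betaN rmorphM.
  rewrite /laplace_beta bE -mulrA; congr (_ * _).
  rewrite -cexpD; congr cexp; apply/eqP; rewrite eq_complex /=.
  by apply/andP; split; apply/eqP; ring.
have [iR iI] := laplace_beta_integrable u t01.
have := laplace_beta_integrable (- u) t01'.
rewrite /bernoulli_laplace (_ : laplace_beta (1 - t) (- u) = fun x => laplace_beta t u (- x));
  last exact/funext.
move=> [iR' iI'].
have [cR cI] := real_cexp_continuous t u (@beta_continuous R).
rewrite /cintegral (@Rintegral_reflect R (fun x => complex.Re (laplace_beta t u x)) cR iR iR').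
by rewrite (@Rintegral_reflect R (fun x => complex.Im (laplace_beta t u x)) cI iI iI').
Qed.

(** This is $e^x - 1 = (e^{x/2} - 1)(e^{x/2} + 1)$; it becomes the duplication formula of the
    transform. *)
Lemma beta_half x : beta x * (1 + expR (- (x / 2))) = 2 * beta (x / 2).
Proof.
rewrite /beta mulf_eq0 invr_eq0 pnatr_eq0 orbF; case: eqVneq => [->|x0].
  by rewrite mul0r oppr0 expR0 mul1r mulr1.
have x20 : x / 2 != 0 by rewrite mulf_neq0// invr_eq0.
have e2 := expRB1_neq0 x20; have e1 := expRB1_neq0 x0.
have E : expR x = expR (x / 2) ^+ 2 by rewrite expr2 -expRD -splitr.
rewrite expRN; move: e1; rewrite E => e1.
have e3 := lt0r_neq0 (expR_gt0 (x / 2)).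
by field; rewrite e1 e2 e3.
Qed.

(** The integrand at $(c+1)/2$ is $e^{-x/2}$ times the one at $c/2$. Their sum is
    $2\beta(x/2)e^{-cx/2}$ by [beta_half], and the substitution $x \mapsto 2x$ gives the second
    factor 2. *)
Lemma bernoulli_laplace_halves t u : 0 < t < 1 ->
  4 * bernoulli_laplace t u =
  bernoulli_laplace (t / 2) (u / 2) + bernoulli_laplace ((t + 1) / 2) (u / 2).
Proof.
move=> t01.
have t1 : 0 < t / 2 < 1 by move: t01 => /andP[? ?]; apply/andP; split; lra.
have t2 : 0 < (t + 1) / 2 < 1 by move: t01 => /andP[? ?]; apply/andP; split; lra.
have [Si SE] := cintegrableD (laplace_beta_integrable (u / 2) t1) (laplace_beta_integrable (u /
  2) t2).
have E x : laplace_beta (t / 2) (u / 2) x + laplace_beta ((t + 1) / 2) (u / 2) x =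
    2 * laplace_beta t u (x / 2).
  rewrite /laplace_beta.
  have -> : cexp (- ((((t + 1) / 2) +i* (u / 2)) * x%:C)) =
      (expR (- (x / 2)))%:C * cexp (- (((t / 2) +i* (u / 2)) * x%:C)) :> R[i].
    rewrite -(cexp_real (- (x / 2))) -cexpD; congr cexp; apply/eqP; rewrite eq_complex /=.
    by apply/andP; split; apply/eqP; field.
  have -> : cexp (- ((t +i* u) * (x / 2)%:C)) = cexp (- (((t / 2) +i* (u / 2)) * x%:C)) :> R[i].
    congr cexp; apply/eqP; rewrite eq_complex /=.
    by apply/andP; split; apply/eqP; field.
  have bE : (beta x)%:C * (1 + (expR (- (x / 2)))%:C) = 2 * (beta (x / 2))%:C :> R[i].
    by rewrite -[1](rmorph1 (real_complex R)) -rmorphD -rmorphM beta_half rmorphM rmorph_nat.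
  by rewrite [RHS]mulrA -bE; ring.
rewrite /bernoulli_laplace -SE (eq_cintegral E).
have [Hi _] := cintegrableZ (2^-1) Si.
have {}Hi : cintegrable (fun x => laplace_beta t u (x / 2)).
  by apply: cintegrable_ext Hi => x; rewrite E mulKf.
have [_ ->] := cintegrableZ 2 Hi.
rewrite (_ : 4 = 2 * 2); last by rewrite -natrM.
rewrite -mulrA; congr (_ * _).
have [iR iI] := laplace_beta_integrable u t01; have [iR' iI'] := Hi.
have [cR cI] := real_cexp_continuous t u (@beta_continuous R).
rewrite [RHS]/cintegral (@Rintegral_scale2 R (fun x => complex.Re (laplace_beta t u x)) cR iR iR').
rewrite (@Rintegral_scale2 R (fun x => complex.Im (laplace_beta t u x)) cI iI iI').
rewrite -[X in X * _](rmorph_nat (real_complex R) 2) /cintegral.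
by apply/eqP; rewrite eq_complex ReM ImM /= !mul0r subr0 addr0 !eqxx.
Qed.

(* Herglotz' trick: the difference [g] of the two sides satisfies
   [4 g(c) = g(c/2) + g((c+1)/2)] and [g = O(W)] with [W = 1/|c| + 1/|1-c| + 4],
   while [(W(c/2) + W((c+1)/2))/4 <= 3/4 W(c)]. *)
Lemma bernoulli_laplace_csc2 t u : 0 < t < 1 -> bernoulli_laplace t u = csc2 (t +i* u).
Proof.
move: t u; pose W (t u : R) := (modulus (t +i* u))^-1 + (modulus ((1 - t) +i* u))^-1 + 4.
pose g t u := bernoulli_laplace t u - csc2 (t +i* u).
have mge (a b : R) : `|a| <= modulus (a +i* b) by exact: Re_le_modulus (a +i* b).
have mpos (a b : R) : 0 < a -> 0 < modulus (a +i* b).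
  by move=> a0; apply: lt_le_trans (mge a b); rewrite normr_gt0 gt_eqF.
(* Halving doubles the two singular terms. The two other inverses are at most 2, their arguments
   having real part at least 1/2. The constant 4 in [W] is fitted to 2 + 2 + 4 + 4 = 3 * 4. *)
have W_contr t u : 0 < t < 1 -> W (t / 2) (u / 2) + W ((t + 1) / 2) (u / 2) <= 3 * W t u.
  move=> /andP[t0 t1]; rewrite /W.
  have half (a b : R) : modulus ((a / 2) +i* (b / 2)) = modulus (a +i* b) / 2.
    rewrite (_ : (a / 2) +i* (b / 2) = 2^-1%:C * (a +i* b)); last first.
      by apply/eqP; rewrite eq_complex /= !mul0r subr0 addr0 (mulrC a) (mulrC b) !eqxx.
    by rewrite modulusM modulus_real ger0_norm ?invr_ge0// mulrC.
  have -> : 1 - (t + 1) / 2 = (1 - t) / 2 by field.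
  have big (a b : R) : 1 / 2 <= a -> (modulus (a +i* b))^-1 <= 2.
    move=> a1; have a0 : 0 < a by lra.
    rewrite -[leRHS]invrK lef_pV2 ?posrE ?mpos ?invr_gt0//.
    by apply: le_trans (mge a b); rewrite (ger0_norm (ltW a0)); lra.
  have h1 := big (1 - t / 2) (u / 2); have h2 := big ((t + 1) / 2) (u / 2).
  rewrite !half !invf_div.
  have p1 : 0 <= (modulus (t +i* u))^-1 by rewrite invr_ge0 modulus_ge0.
  have p2 : 0 <= (modulus ((1 - t) +i* u))^-1 by rewrite invr_ge0 modulus_ge0.
  have {}h1 := h1 ltac:(lra); have {}h2 := h2 ltac:(lra).
  by rewrite half invf_div in h2; lra.
have g_contr t u : 0 < t < 1 -> 4 * g t u = g (t / 2) (u / 2) + g ((t + 1) / 2) (u / 2).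
  by move=> t01; rewrite /g mulrBr bernoulli_laplace_halves// csc2_halves//; ring.
have [M M0 gM] : exists2 M : R, 0 <= M & forall t u, 0 < t < 1 -> modulus (g t u) <= M * W t u.
  have [M1 K1] := bernoulli_laplace_near0.
  have [de de0 [C C0 S1]] := @csc2_near0 R.
  pose e := Num.min de (1 / 2); have e0 : 0 < e by rewrite lt_min de0 divr_gt0.
  have [C' C'0 S2] := csc2_decay e0.
  have ede : e <= de by rewrite ge_min lexx.
  have e12 : e <= 1 / 2 by rewrite ge_min lexx orbT.
  pose M := Num.max M1 0 + C + C' + (e ^+ 2)^-1.
  have M1m : M1 <= Num.max M1 0 by rewrite le_max lexx.
  have m0 : 0 <= Num.max M1 0 by rewrite le_max lexx orbT.
  have ei0 : 0 <= (e ^+ 2)^-1 by rewrite invr_ge0 sqr_ge0.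
  have M0 : 0 <= M by rewrite /M !addr_ge0.
  (* Near 0 both functions are $c^{-2}$ up to $O(1/|c|)$, so the double poles cancel; away from 0
     each of them is bounded. The other half of the strip follows by the reflection $c \mapsto 1 -
     c$. *)
  have small t u : 0 < t <= 1 / 2 -> modulus (g t u) <= M * ((modulus (t +i* u))^-1 + 4).
    move=> /andP[t0 t1]; have cm := mpos t u t0.
    have ci0 : 0 <= (modulus (t +i* u))^-1 by rewrite invr_ge0 ltW.
    have K1' := K1 t u (introT andP (conj t0 t1)).
    have -> : g t u = (bernoulli_laplace t u - (t +i* u)^-2) - (csc2 (t +i* u) - (t +i* u)^-2).
      by rewrite /g; ring.
    apply: (le_trans (modulusB _ _)).
    have p1 : 0 <= Num.max M1 0 * (modulus (t +i* u))^-1 by rewrite mulr_ge0.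
    have p2 : 0 <= C * (modulus (t +i* u))^-1 by rewrite mulr_ge0.
    have p3 : 0 <= C' * (modulus (t +i* u))^-1 by rewrite mulr_ge0.
    have p4 : 0 <= (e ^+ 2)^-1 * (modulus (t +i* u))^-1 by rewrite mulr_ge0.
    have [ce|ce] := lerP (modulus (t +i* u)) e.
      have := S1 (t +i* u); rewrite -modulus_gt0 => /(_ cm (le_trans ce ede)) H.
      by rewrite /M; lra.
    have [|E1 H] := S2 t u _ (ltW ce); first by rewrite (ger0_norm (ltW t0)); lra.
    have H2 : modulus ((t +i* u)^-2) <= (e ^+ 2)^-1.
      rewrite modulusV modulusX lef_pV2 ?posrE ?exprn_gt0//.
      by apply: lerXn2r; rewrite ?nnegrE ltW.
    have H3 : expR (- (2 * pi * `|u|)) <= 1.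
      by rewrite expR_le1 oppr_le0 !mulr_ge0// pi_ge0.
    have H4 : C' * expR (- (2 * pi * `|u|)) <= C' by rewrite ler_piMr.
    have := modulusB (csc2 (t +i* u)) ((t +i* u)^-2).
    by rewrite /M; lra.
  exists M => // t u /andP[t0 t1]; have [t12|t12] := lerP t (1 / 2).
    apply: (le_trans (small t u _)); first by rewrite t0.
    rewrite ler_wpM2l// lerD2r lerDl invr_ge0 modulus_ge0//.
  have t01 : 0 < t < 1 by rewrite t0.
  have -> : g t u = g (1 - t) (- u).
    by rewrite /g bernoulli_laplace_reflect// csc2_reflect.
  apply: (le_trans (small (1 - t) (- u) _)); first by apply/andP; split; lra.
  rewrite ler_wpM2l// lerD2r.
  have -> : modulus ((1 - t) +i* (- u)) = modulus ((1 - t) +i* u) by rewrite /= sqrrN.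
  by rewrite lerDr invr_ge0 modulus_ge0.
have iter n : forall t u, 0 < t < 1 -> modulus (g t u) <= M * (3 / 4) ^+ n * W t u.
  elim: n => [|n IH] t' u' t01; first by rewrite mulr1; exact: gM.
  have /andP[t0 t1] := t01.
  have := congr1 (@ComplexField.Normc.normc R) (g_contr t' u' t01).
  rewrite modulusM modulus_nat => H4.
  have h1 := IH (t' / 2) (u' / 2); have h2 := IH ((t' + 1) / 2) (u' / 2).
  have {}h1 := h1 ltac:(apply/andP; split; lra); have {}h2 := h2 ltac:(apply/andP; split; lra).
  have K0 : 0 <= M * (3 / 4) ^+ n by rewrite mulr_ge0// exprn_ge0// divr_ge0.
  have := ler_wpM2l K0 (W_contr t' u' t01).
  have := modulusD (g (t' / 2) (u' / 2)) (g ((t' + 1) / 2) (u' / 2)).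
  by rewrite -H4 exprSr; lra.
move=> t u t01; apply/eqP; rewrite -subr_eq0 -modulus_eq0 eq_le modulus_ge0 andbT.
have gl : (fun n => M * (3 / 4) ^+ n * W t u) @ \oo --> (0 : R).
  have -> : nbhs (0 : R) = nbhs (M * 0 * W t u) by rewrite mulr0 mul0r.
  apply: cvgM; last exact: cvg_cst.
  apply: cvgM; first exact: cvg_cst.
  by apply: cvg_expr; rewrite ger0_norm ?divr_ge0// ltr_pdivrMr// mul1r ltr_nat.
rewrite -(cvg_lim (@Rhausdorff R) gl); apply: limr_ge; first by apply/cvg_ex; exists 0.
by apply: nearW => n; exact: iter.
Qed.

End BernoulliHatClosedForm.

(** * The umbral operator *)

Section Kernel.
Context {R : realType}.
Notation mu := (@lebesgue_measure R).
Implicit Types (t u : R) (f : R[i] -> R[i]) (w z c : R[i]).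

Definition wexp u : R := expR (- (2 * pi * `|u|)).

Definition ker u : R := 2 * pi * (expR (- (2 * pi * u)) / (1 + expR (- (2 * pi * u))) ^+ 2).

(** The logistic distribution function with density [ker]. Its tails [sigm u] on the left and
    [1 - sigm u = sigm (- u)] on the right both lie below [wexp]. *)
Definition sigm u : R := (1 + expR (- (2 * pi * u)))^-1.

Lemma wexp_ge0 u : 0 <= wexp u.
Proof. exact: expR_ge0. Qed.

Lemma wexp_continuous : continuous wexp.
Proof. exact: continuous_expR_lin. Qed.

Lemma wexp_integrable : mu.-integrable setT (EFin \o wexp).
Proof. exact: integrable_expR_abs (@twopi_gt0 R). Qed.

Lemma tu_split t u : t +i* u = t%:C + u *i :> R[i].
Proof. by apply/eqP; rewrite eq_complex /= addr0 add0r !eqxx. Qed.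

Lemma is_derive_sigm u : is_derive u 1 sigm (ker u).
Proof.
have h0 : 1 + expR (- (2 * pi * u)) != 0 by rewrite gt_eqF// addr_gt0// expR_gt0.
have dE : is_derive u 1 (fun u => 1 + expR (- (2 * pi * u))) (- (2 * pi) * expR (- (2 * pi * u))).
  by apply: is_derive_eq; rewrite /GRing.scale /=; ring.
have dV : derivable (fun u => 1 + expR (- (2 * pi * u))) u 1 by exact: ex_derive.
apply: DeriveDef; first exact: derivableV.
rewrite deriveV// derive_val /GRing.scale /= /ker; field.
exact: h0.
Qed.

Lemma sigm_ge0 u : 0 <= sigm u.
Proof. by rewrite invr_ge0 addr_ge0// expR_ge0. Qed.

Lemma sigm_le u : sigm u <= expR (2 * pi * u).
Proof.
rewrite -[X in _ <= expR X]opprK expRN lef_pV2 ?posrE ?expR_gt0 ?addr_gt0 ?expR_gt0//.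
by rewrite lerDr.
Qed.

Lemma onem_sigm u : 1 - sigm u = sigm (- u).
Proof.
have h0 := expR_gt0 (2 * pi * u).
rewrite /sigm mulrN opprK expRN; field.
by rewrite !gt_eqF// ?addr_gt0.
Qed.

Lemma ker_ge0 u : 0 <= ker u.
Proof.
by rewrite mulr_ge0 ?mulr_ge0 ?pi_ge0// divr_ge0 ?expR_ge0// exprn_ge0// addr_ge0// expR_ge0.
Qed.

Lemma kerE u : ker u = 2 * pi * (sigm u * sigm (- u)).
Proof.
have h0 := expR_gt0 (2 * pi * u).
rewrite /ker /sigm mulrN opprK expRN; congr (_ * _); field.
by rewrite !gt_eqF// ?addr_gt0.
Qed.

Lemma ker_le u : ker u <= 2 * pi * wexp u.
Proof.
have s1 v : sigm v <= 1.
  by rewrite invf_le1 ?addr_gt0 ?expR_gt0// lerDl expR_ge0.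
rewrite kerE; apply: ler_wpM2l; first by rewrite mulr_ge0// pi_ge0.
rewrite /wexp; have [u0|u0] := lerP 0 u.
  rewrite (ger0_norm u0) -mulrN.
  by rewrite (le_trans _ (sigm_le _))// ler_piMl ?sigm_ge0.
rewrite (ltr0_norm u0) mulrN opprK.
by rewrite (le_trans _ (sigm_le _))// ler_piMr ?sigm_ge0.
Qed.

Lemma ker_continuous : continuous ker.
Proof.
have cE : continuous (fun u : R => expR (- (2 * pi * u))).
  move=> u; apply: (@continuous_comp _ _ _ (fun u : R => - (2 * pi * u)) expR);
    last exact: continuous_expR.
  by apply: cvgN; apply: cvgM; [exact: cvg_cst|exact: cvg_id].
move=> u; apply: cvgM; first exact: cvg_cst.
have cD : {for u, continuous (fun u : R => 1 + expR (- (2 * pi * u)))}.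
  by apply: cvgD; [exact: cvg_cst|exact: cE].
apply: cvgM; first exact: cE.
apply: cvgV; first by rewrite expf_neq0// gt_eqF// addr_gt0// expR_gt0.
by rewrite /=; under eq_fun do rewrite expr2; rewrite expr2; apply: cvgM.
Qed.

Lemma ker_integrable : mu.-integrable setT (EFin \o ker).
Proof.
apply: (integrable_dominated _ _ (mu_integrableZl (2 * pi) measurableT wexp_integrable)) => //.
  exact: continuous_measurable_fun ker_continuous.
by move=> u _; rewrite ger0_norm ?ker_ge0// ker_le.
Qed.

Lemma Rintegral_ker : \int[mu]_u ker u = 1.
Proof.
have h1 := cvgn_comp_subseq (k := S) leqnSn (cvg_truncated_integral ker_integrable).
apply: (real_cvgn_unique h1).
have -> : (fun n : nat => \int[mu]_(x in `[- n.+1%:R, n.+1%:R]) ker x) =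
    (fun n => 1 - 2 * sigm (- n.+1%:R)).
  apply/funext => n; have Nn : - n.+1%:R < n.+1%:R :> R by rewrite gtrN.
  rewrite (FTC_derivative Nn (fun u _ => is_derive_sigm u) (continuous_subspaceT ker_continuous)).
  by rewrite -[X in X - _](opprK (sigm _)) -[sigm _](subKr 1) onem_sigm; ring.
have -> : nbhs (1 : R) = nbhs (1 - 2 * 0 : R) by rewrite mulr0 subr0.
apply: cvgB; first exact: cvg_cst.
apply: cvgM; first exact: cvg_cst.
apply: (@cvg0_harmonic _ _ ((2 * pi)^-1)) => n.
rewrite ger0_norm ?sigm_ge0// (le_trans (sigm_le _))// mulrN.
exact: expRN_harmonic (@twopi_gt0 R).
Qed.

(** On both lines [unit_exp] is $-e^{-2\pi u}$. Having the same density on the two lines is what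
    allows [umbral f w] and [umbral f (w + 1)] to be compared. *)
Lemma csc2_pm_half u (s : R) : s = 1 / 2 \/ s = - (1 / 2) ->
  csc2 (s +i* u) = (2 * pi * ker u)%:C.
Proof.
move=> hs; have E : unit_exp (s +i* u) = - (expR (- (2 * pi * u)))%:C.
  rewrite unit_expE -[RHS]mulrN1; congr (_ * _).
  case: hs => ->.
    rewrite (_ : 2 * pi * (1 / 2) = pi); last by field.
    by rewrite cospi sinpi; apply/eqP; rewrite eq_complex /= oppr0 !eqxx.
  rewrite mulrN (_ : 2 * pi * (1 / 2) = pi); last by field.
  by rewrite cosN sinN cospi sinpi; apply/eqP; rewrite eq_complex /= !oppr0 !eqxx.
rewrite /csc2 E /ker; set x := expR _.
have x0 : 1 + x%:C != 0 :> R[i].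
  by rewrite -(rmorph1 (real_complex R)) -rmorphD (inj_eq (@complexI R)) gt_eqF// addr_gt0//
    expR_gt0.
have -> : (2 * pi * (2 * pi * (x / (1 + x) ^+ 2)))%:C =
   ((2 * pi) ^+ 2)%:C * (x%:C / (1 + x%:C) ^+ 2) :> R[i].
  by rewrite -(rmorph1 (real_complex R)) -rmorphD -rmorphXn -fmorph_div -rmorphM mulrA -expr2.
have -> : - x%:C - 1 = - (1 + x%:C) :> R[i] by ring.
by field.
Qed.

(** The integral hypothesis on [f] in the form consumed by the line shifts: a bound uniform over a
    compact range of abscissae, at an arbitrary height [y] so that translates of [f] are covered. *)
Definition strip_int f : Prop := forall (y t1 t2 : R), 0 < t1 -> t1 <= t2 ->
  exists M : R, forall t, t1 <= t <= t2 ->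
    mu.-integrable setT (EFin \o (fun u => wexp u * modulus (f ((t +i* y) + u *i)))) /\
    \int[mu]_u (wexp u * modulus (f ((t +i* y) + u *i))) <= M.

Definition hp_cont f : Prop := forall z, right_half_plane z -> ccont f z.

Lemma ccont_shift f a z : ccont f (a + z) -> ccont (fun w => f (a + w)) z.
Proof.
move=> fc e e0; have [r r0 H] := fc e e0; exists r => // w wz; apply: H.
by rewrite opprD addrACA subrr add0r.
Qed.

Lemma ccont_line f w u : ccont f (w + u *i) ->
  {for u, continuous (fun v => complex.Re (f (w + v *i)))} /\
  {for u, continuous (fun v => complex.Im (f (w + v *i)))}.
Proof. by move=> /ccont_shift /(@ccont_vertical R (fun z => f (w + z)) 0 u). Qed.

Lemma hp_cont_line f w : hp_cont f -> 0 < complex.Re w ->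
  continuous (fun v => complex.Re (f (w + v *i))) /\
  continuous (fun v => complex.Im (f (w + v *i))).
Proof.
move=> fc w0; have H u : ccont f (w + u *i).
  by apply: fc; rewrite /right_half_plane /= ReD /= addr0.
by split=> u; have [] := ccont_line (H u).
Qed.

Lemma hp_cont_measurable f w : hp_cont f -> 0 < complex.Re w ->
  cmeasurable (fun u => f (w + u *i)).
Proof. by move=> fc w0; have [? ?] := hp_cont_line fc w0; exact: cmeasurable_continuous. Qed.

(** Compactness of [[t1, t2]] makes the local bounds uniform. A finite value of the extended
    integral also yields integrability, measurability coming from continuity. *)
Lemma strip_int_of_local f : hp_cont f ->
  (forall t : R[i], right_half_plane t -> exists M : R, \forall u \near t,
    (\int[mu]_xi (expR (- (2 * pi) * `|xi|) * modulus (f (u + xi *i)))%:E <= M%:E)%E) ->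
  strip_int f.
Proof.
move=> fc loc y t1 t2 t10 t12.
pose I t := (\int[mu]_xi (wexp xi * modulus (f ((t +i* y) + xi *i)))%:E)%E.
have I0 t : (0 <= I t)%E.
  by apply: integral_ge0 => u _; rewrite lee_fin mulr_ge0 ?wexp_ge0 ?modulus_ge0.
have locI t : 0 < t -> exists M : R, \forall s \near t, (I s <= M%:E)%E.
  move=> t0; have [M /nbhs_modulusP[d d0 H]] := loc (t +i* y) t0; exists M.
  exists d => // s /= st; have := H (s +i* y).
  rewrite (_ : s +i* y - (t +i* y) = (s - t)%:C); last first.
    by apply/eqP; rewrite eq_complex /= subrr !eqxx.
  rewrite modulus_real distrC => /(_ st); rewrite /I /wexp.
  by under eq_integral do rewrite mulNr.
have [|C HC] := @compact_locally_bounded R _ `[t1, t2]%classic (fun t =>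
  fine (I t)) (@segment_compact _ _ _).
  move=> t; rewrite /= in_itv /= => /andP[tt _].
  have [M HM] := locI t (lt_le_trans t10 tt); exists M.
  apply: filterS HM => s sM.
  have fs : I s \is a fin_num.
    by rewrite ge0_fin_numE// (le_lt_trans sM)// ltry.
  by rewrite -lee_fin fineK.
exists C => t tt; have t0 : 0 < t by move: tt => /andP[? _]; exact: lt_le_trans t10 _.
have [M /nbhs_singleton HM] := locI t t0.
split; last by apply: HC; rewrite /= in_itv.
apply/integrableP; split.
  apply/measurable_EFinP; apply: measurable_funM.
    exact: continuous_measurable_fun wexp_continuous.
  exact: cmeasurable_modulus (hp_cont_measurable fc _).
apply: le_lt_trans (ltry M); apply: le_trans HM.
rewrite le_eqVlt; apply/orP; left; apply/eqP; apply: eq_integral => u _.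
by rewrite /= ger0_norm// mulr_ge0 ?wexp_ge0 ?modulus_ge0.
Qed.

Lemma strip_int_integrable f w : strip_int f -> 0 < complex.Re w ->
  mu.-integrable setT (EFin \o (fun u => wexp u * modulus (f (w + u *i)))).
Proof.
case: w => t y sf /= t0; have [M H] := sf y t t t0 (lexx _).
have [|Hi _] := H t; first by rewrite lexx.
exact: Hi.
Qed.

Lemma ker_cintegrable f w : hp_cont f -> strip_int f -> 0 < complex.Re w ->
  cintegrable (fun u => (ker u)%:C * f (w + u *i)).
Proof.
move=> fc sf w0.
have gi := mu_integrableZl (2 * pi) measurableT (strip_int_integrable sf w0).
have [cR cI] := hp_cont_line fc w0.
have mF : cmeasurable (fun u => (ker u)%:C * f (w + u *i)).
  apply: cmeasurable_continuous.
    rewrite (_ : (fun x => _) = (fun u => ker u * complex.Re (f (w + u *i)))).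
      by move=> u; apply: cvgM; [exact: ker_continuous|exact: cR].
    by apply/funext => u; rewrite ReM (_ : complex.Im (ker u)%:C = 0)// mul0r subr0.
  rewrite (_ : (fun x => _) = (fun u => ker u * complex.Im (f (w + u *i)))).
    by move=> u; apply: cvgM; [exact: ker_continuous|exact: cI].
  by apply/funext => u; rewrite ImM (_ : complex.Im (ker u)%:C = 0)// mul0r addr0.
apply: (cintegrable_dominated mF gi _).1 => u.
rewrite modulusM modulus_real ger0_norm ?ker_ge0// mulrA.
by rewrite ler_wpM2r ?modulus_ge0// ker_le.
Qed.

End Kernel.

(** * The functional equation of the umbral operator *)

Section UmbralShift.
Context {R : realType}.
Notation mu := (@lebesgue_measure R).
Implicit Types (t u : R) (f : R[i] -> R[i]) (w z c : R[i]).

Lemma pow_add1_expR_le (a : R) d : 0 < a -> exists2 a' : R, 0 < a' &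
  exists2 C : R, 0 <= C & forall y, 0 <= y -> (1 + y) ^+ d * expR (- (a * y)) <= C * expR (- (a'
    * y)).
Proof.
move=> a0; elim: d => [|d [a' a'0 [C C0 H]]].
  by exists a => //; exists 1 => // y y0; rewrite expr0.
exists (a' / 2); first by rewrite divr_gt0.
exists (C * (1 + 2 / a')).
  by rewrite mulr_ge0// addr_ge0// divr_ge0// ltW.
move=> y y0; rewrite exprS -mulrA.
apply: (@le_trans _ _ ((1 + y) * (C * expR (- (a' * y))))).
  by apply: ler_wpM2l; [rewrite addr_ge0|exact: H].
by rewrite mulrCA -mulrA; apply: ler_wpM2l => //; exact: add1_expR_le.
Qed.

Lemma pow_wexp_integrable d : mu.-integrable setT (EFin \o (fun u : R => (1 + `|u|) ^+ d * wexp u)).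
Proof.
have [a a0 [C C0 H]] := pow_add1_expR_le d (@twopi_gt0 R).
apply: (integrable_dominated _ _ (mu_integrableZl C measurableT (integrable_expR_abs a0))) => //.
  apply: continuous_measurable_fun => u; apply: cvgM; last exact: wexp_continuous.
  have c1 : {for u, continuous (fun u : R => 1 + `|u|)}.
    by apply: cvgD; [exact: cvg_cst|exact: norm_continuous].
  by apply: (@continuous_comp _ _ _ (fun u : R => 1 + `|u|) (fun x => x ^+ d));
    [exact: c1|exact: exprn_continuous].
move=> u _; rewrite ger0_norm; last by rewrite mulr_ge0 ?wexp_ge0// exprn_ge0// addr_ge0.
exact: H.
Qed.

Lemma strip_int_poly f (K : R) d : 0 <= K -> hp_cont f ->
  (forall z, modulus (f z) <= K * (1 + modulus z) ^+ d) -> strip_int f.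
Proof.
move=> K0 fc fK y t1 t2 t10 t12.
pose A := 1 + t2 + `|y|.
have t20 : 0 <= t2 by rewrite ltW// (lt_le_trans t10).
have A1 : 1 <= A by rewrite /A -addrA lerDl addr_ge0.
have gi := mu_integrableZl (K * A ^+ d) measurableT (pow_wexp_integrable d).
exists (\int[mu]_u (K * A ^+ d * ((1 + `|u|) ^+ d * wexp u))) => t /andP[tt1 tt2].
have t0 : 0 < t := lt_le_trans t10 tt1.
have bnd u : wexp u * modulus (f ((t +i* y) + u *i)) <= K * A ^+ d * ((1 + `|u|) ^+ d * wexp u).
  rewrite mulrC mulrA ler_wpM2r ?wexp_ge0// (le_trans (fK _))// -mulrA ler_wpM2l//.
  rewrite -exprMn lerXn2r// ?nnegrE ?addr_ge0 ?modulus_ge0 ?mulr_ge0 ?addr_ge0//.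
  have h1 : modulus (t +i* y) <= t + `|y|.
    by rewrite -{2}(ger0_norm (ltW t0)); exact: modulus_le_ReIm.
  have h2 := modulusD (t +i* y) (u *i); rewrite modulus_imag in h2.
  have h3 : `|u| <= A * `|u| by rewrite ler_peMl.
  by rewrite mulrDr mulr1; move: h3; rewrite /A; lra.
have mi : mu.-integrable setT (EFin \o (fun u => wexp u * modulus (f ((t +i* y) + u *i)))).
  apply: (integrable_dominated _ _ gi) => //.
    apply: measurable_funM; first exact: continuous_measurable_fun wexp_continuous.
    exact: cmeasurable_modulus (hp_cont_measurable fc _).
  by move=> u _; rewrite ger0_norm ?mulr_ge0 ?wexp_ge0 ?modulus_ge0.
by split => //; apply: mu_le_Rintegral.
Qed.

Lemma hp_cont_affine (a b : R[i]) : hp_cont (fun z => a + b * z).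
Proof. by move=> z _; exact: (cderiv_ccont (cderivD (cderiv_cst a z) (cderivZ b (cderiv_id z)))).
  Qed.

Lemma strip_int_affine (a b : R[i]) : strip_int (fun z => a + b * z).
Proof.
apply: (@strip_int_poly _ (modulus a + modulus b) 1); first by rewrite addr_ge0 ?modulus_ge0.
  exact: hp_cont_affine.
move=> z; rewrite expr1 (le_trans (modulusD _ _))// modulusM.
have := mulr_ge0 (modulus_ge0 a) (modulus_ge0 z); have := modulus_ge0 b.
by rewrite mulrDr mulr1 mulrDl; lra.
Qed.

(* [umbral f w] is the value [f(B + w)]: the integral defining [f(B)], taken on
   the line [Re = 1/2] where [pi^2 / sin^2] becomes the density [ker], applied
   to the translate of [f] by [w]. *)
Definition umbral f w : R[i] := cintegral (fun u => (ker u)%:C * f (w + (1 / 2)%:C + u *i)).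

Lemma quadratic_bound f (f1 f2 : R[i] -> R[i]) c0 :
  (forall z, right_half_plane z -> cderiv f z (f1 z)) ->
  (forall z, right_half_plane z -> cderiv f1 z (f2 z)) ->
  hp_cont f2 -> right_half_plane c0 ->
  exists2 r : R, 0 < r & exists2 B : R, 0 <= B & forall c, modulus c <= r ->
    modulus (f (c0 + c) - f c0 - f1 c0 * c) <= B * modulus c ^+ 2.
Proof.
move=> df df1 cf2 c00; have [r1 r10 [B fB]] := ccont_loc_bounded (cf2 _ c00).
pose r := Num.min r1 (complex.Re c0) / 2.
have r0 : 0 < r by rewrite divr_gt0// lt_min r10.
have rr : r < Num.min r1 (complex.Re c0).
  by rewrite /r ltr_pdivrMr// ltr_pMr ?ltr1n// lt_min r10.
have [rr1 rc0] : r < r1 /\ r < complex.Re c0.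
  by move: rr; rewrite lt_min => /andP[].
exists r => //; exists `|B| => // c cr.
pose S : set R[i] := [set w | modulus (w - c0) <= r].
have SU w : S w -> right_half_plane w.
  rewrite /S /right_half_plane /= => wr.
  have := Re_le_modulus (w - c0); rewrite ReD ReN ler_norml => /andP[h _].
  by lra.
pose F n := if n is 0 then f else if n is 1%N then f1 else f2.
have Sc0 : S c0 by rewrite /S /= subrr modulus0 ltW.
have star w : S w -> forall s : R, 0 <= s <= 1 -> S (c0 + s%:C * (w - c0)).
  rewrite /S => /= wr s /andP[s0 s1].
  have -> : c0 + s%:C * (w - c0) - c0 = s%:C * (w - c0) by rewrite addrC addKr.
  by rewrite modulusM modulus_real (ger0_norm s0) (le_trans _ wr)// ler_piMl// modulus_ge0.
have dF j z : (j < 2)%N -> S z -> cderiv (F j) z (F j.+1 z).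
  by case: j => [|[|//]] _ /SU; [exact: df|exact: df1].
have FB z : S z -> modulus (F 2%N z) <= `|B|.
  by move=> zr; rewrite (le_trans (fB _ _) (ler_norm _))// (le_lt_trans zr).
have Sc : S (c0 + c) by rewrite /S /= addrC addKr.
have := complex_taylor Sc0 star dF FB Sc.
rewrite (_ : c0 + c - c0 = c); last by rewrite addrC addKr.
congr (modulus _ <= _).
by rewrite !big_ord_recl big_ord0 /= expr0 expr1 !divr1 mulr1 addr0; ring.
Qed.

(* The kernel has a double pole at 0 only, so after subtracting the first order
   Taylor polynomial of [f] at [w + 1] nothing is lost in moving the line of
   integration from [Re = -1/2] to [Re = 1/2]. *)
Lemma umbral_shift f (f1 f2 : R[i] -> R[i]) w :
  (forall z, right_half_plane z -> cderiv f z (f1 z)) ->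
  (forall z, right_half_plane z -> cderiv f1 z (f2 z)) ->
  hp_cont f2 -> strip_int f -> - (1 / 2) < complex.Re w ->
  umbral f (w + 1) - umbral f w = f1 (w + 1).
Proof.
move=> df df1 cf2 sf w0; have pi0 := @pi_gt0 R.
set c0 := w + 1; pose x0 := complex.Re c0; pose y0 := complex.Im c0.
have x0h : 1 / 2 < x0 by rewrite /x0 /c0 ReD /=; lra.
have c0U : right_half_plane c0 by rewrite /right_half_plane /=; rewrite -/x0; lra.
have fc : hp_cont f by move=> z /df; exact: cderiv_ccont.
have [r r0 [B B0 fB]] := quadratic_bound df df1 cf2 c0U.
have [de1 de10 [C1 C10 S1]] := @csc2_near0 R.
pose d0 := Num.min (Num.min r de1) (1 / 4).
have d00 : 0 < d0 by rewrite !lt_min r0 de10 divr_gt0.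
have [d0r d0d d04] : [/\ d0 <= r, d0 <= de1 & d0 <= 1 / 4].
  by split; rewrite /d0 !ge_min ?lexx ?orbT.
have [C C0 S2] := csc2_decay d00.
pose H c := (f (c0 + c) - f c0 - f1 c0 * c) * csc2 c.
pose H1 c := (f1 (c0 + c) - 0 - f1 c0 * 1) * csc2 c + (f (c0 + c) - f c0 - f1 c0 * c) * csc2' c.
(* The open strip must exceed $[-1/2, 1/2]$ a little. The entry [x0 - 1 / 2] keeps [c0 + c] in the
   half-plane, and [1 / 4] keeps [c] away from the poles at $\pm 1$. *)
pose eta := Num.min (1 / 4) (x0 - 1 / 2) / 2.
have eta0 : 0 < eta by rewrite divr_gt0// lt_min subr_gt0 x0h divr_gt0.
have eta1 : eta <= 1 / 8.
  by rewrite /eta ler_pdivrMr// (_ : 1 / 8 * 2 = 1 / 4 :> R) ?ge_min ?lexx//; field.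
have eta2 : eta < x0 - 1 / 2.
  rewrite /eta ltr_pdivrMr// (@le_lt_trans _ _ (x0 - 1 / 2))// ?ge_min ?lexx ?orbT//.
  by lra.
pose a := - (1 / 2) - eta; pose b := 1 / 2 + eta.
have near t : a < t < b -> `|t| <= 1 - d0.
  by move=> /andP[ta tb]; rewrite ler_norml /a /b in ta tb *; apply/andP; split; lra.
have inU t u : a < t < b -> right_half_plane (c0 + (t +i* u)).
  by move=> /andP[ta tb]; rewrite /right_half_plane /= ReD /= -/x0 /a in ta *; lra.
have E1 c : a < complex.Re c < b -> c != 0 -> unit_exp c != 1.
  case: c => t u /= tab c00.
  pose d' := Num.min d0 (modulus (t +i* u)).
  have d'0 : 0 < d' by rewrite lt_min d00 modulus_gt0.
  have [C' C'0 S3] := csc2_decay d'0.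
  have d'd : d' <= d0 by rewrite ge_min lexx.
  apply: (S3 t u _ _).1; first by rewrite (le_trans (near t tab))//; lra.
  by rewrite ge_min lexx orbT.
have dlin c : right_half_plane (c0 + c) ->
    cderiv (fun c => f (c0 + c) - f c0 - f1 c0 * c) c (f1 (c0 + c) - 0 - f1 c0 * 1).
  move=> cU; apply: cderivB; last exact: (cderivZ _ (cderiv_id c)).
  by apply: cderivB; [exact: (cderiv_shift (df _ cU))|exact: cderiv_cst].
have dH c : a < complex.Re c < b -> c != 0 -> cderiv H c (H1 c).
  move=> cab c00; have cU : right_half_plane (c0 + c) by move: cab; case: (c) => t u; exact: inU.
  exact: (cderivM (dlin c cU) (cderiv_csc2 (E1 c cab c00))).
have cH1 c : a < complex.Re c < b -> c != 0 -> ccont H1 c.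
  move=> cab c00; have cU : right_half_plane (c0 + c) by move: cab; case: (c) => t u; exact: inU.
  have [e de] := cderiv_csc2' (E1 c cab c00).
  have d1 : cderiv (fun c => f1 (c0 + c) - 0 - f1 c0 * 1) c (f2 (c0 + c) - 0 - 0).
    apply: cderivB; last exact: cderiv_cst.
    by apply: cderivB; [exact: (cderiv_shift (df1 _ cU))|exact: cderiv_cst].
  exact: (cderiv_ccont (cderivD (cderivM d1 (cderiv_csc2 (E1 c cab c00))) (cderivM (dlin c cU)
    de))).
pose B' := B * (1 + C1).
have B'0 : 0 <= B' by rewrite mulr_ge0// addr_ge0.
have Hsmall c : modulus c <= d0 -> modulus (H c) <= B'.
  (* At the pole the convention that 0 has inverse 0 gives [csc2 0 = 0], so the bound holds there
     too. *)
  move=> cd; have [->|c00] := eqVneq c 0.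
    by rewrite /H (_ : csc2 0 = 0) ?mulr0 ?modulus0// /csc2 /unit_exp mulr0 cexp0 subrr invr0
      !mulr0.
  have cm : 0 < modulus c by rewrite modulus_gt0.
  have h1 := fB c (le_trans cd d0r); have h2 := S1 c c00 (le_trans cd d0d).
  have h3 : modulus (csc2 c) <= (modulus c)^-2 + C1 / modulus c.
    rewrite (_ : csc2 c = c^-2 + (csc2 c - c^-2)); last by ring.
    by rewrite (le_trans (modulusD _ _))// modulusV modulusX lerD2l.
  rewrite /H modulusM.
  apply: (le_trans (ler_pM (modulus_ge0 _) (modulus_ge0 _) h1 h3)).
  rewrite (_ : B * modulus c ^+ 2 * _ = B * (1 + C1 * modulus c)); last by field; rewrite gt_eqF.
  by rewrite /B'; apply: ler_wpM2l => //; rewrite lerD2l ler_piMr//; lra.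
have Hloc : loc_bounded (fun c => modulus (H c)) 0.
  by exists d0 => //; exists B' => c; rewrite subr0 => /ltW; exact: Hsmall.
pose K := B' * expR (2 * pi) + C * (modulus (f c0) + modulus (f1 c0)).
have K0 : 0 <= K by rewrite addr_ge0 ?mulr_ge0 ?expR_ge0 ?addr_ge0 ?modulus_ge0.
have cE t u : c0 + (t +i* u) = ((x0 + t) +i* y0) + u *i.
  rewrite {1}[c0]complex_decomp -/x0 -/y0; apply/eqP; rewrite eq_complex /=.
  by rewrite addr0 !eqxx.
(* The first summand dominates the contribution of [f] away from the pole. The second takes care of
   the linear polynomial and, through the factor [expR (2 * pi)] in [K], of the disc around the
   pole. *)
pose D t u := C * (wexp u * modulus (f (((x0 + t) +i* y0) + u *i))) + K * ((1 + `|u|) ^+ 1 * wexp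
  u).
have HD t u : a < t < b -> modulus (H (t +i* u)) <= D t u.
  move=> tab; have t1 : `|t| <= 1 by rewrite (le_trans (near t tab))//; lra.
  have W0 : 0 <= wexp u := wexp_ge0 u.
  have Cf0 : 0 <= C * (wexp u * modulus (f (((x0 + t) +i* y0) + u *i))).
    by rewrite !mulr_ge0 ?modulus_ge0.
  rewrite /D expr1; have [cd|cd] := lerP (modulus (t +i* u)) d0.
    rewrite (le_trans (Hsmall _ cd))// (@le_trans _ _ (K * ((1 + `|u|) * wexp u)))//;
      last by rewrite lerDr.
    have u1 : `|u| <= 1 / 4 by rewrite (le_trans (Im_le_modulus (t +i* u)))// (le_trans cd).
    have e1 : 1 <= expR (2 * pi) * wexp u.
      have h0 : 2 * pi * `|u| <= 2 * pi * (1 / 4) by apply: (ler_wpM2l (ltW (@twopi_gt0 R))).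
      by rewrite -expRD -[leLHS]expR0 ler_expR; lra.
    have e2 : B' <= B' * expR (2 * pi) * wexp u by rewrite -mulrA ler_peMr.
    have e3 : 0 <= C * (modulus (f c0) + modulus (f1 c0)).
      by rewrite mulr_ge0// addr_ge0// modulus_ge0.
    have e4 : 0 <= K * (`|u| * wexp u) by rewrite !mulr_ge0.
    have e5 : 0 <= C * (modulus (f c0) + modulus (f1 c0)) * wexp u by rewrite mulr_ge0.
    by move: e4; rewrite /K => e4; lra.
  have [_ h1] := S2 t u (near t tab) (ltW cd).
  rewrite /H modulusM cE.
  have h2 : modulus (f (((x0 + t) +i* y0) + u *i) - f c0 - f1 c0 * (t +i* u)) <=
      modulus (f (((x0 + t) +i* y0) + u *i)) + (modulus (f c0) + modulus (f1 c0)) * (1 + `|u|).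
    apply: (le_trans (modulusB _ _)); apply: (le_trans (lerD (modulusB _ _) (lexx _))).
    rewrite modulusM.
    have h3 : modulus (f1 c0) * modulus (t +i* u) <= modulus (f1 c0) * (1 + `|u|).
      rewrite ler_wpM2l ?modulus_ge0// (le_trans (modulus_le_ReIm _))//=.
      by rewrite lerD2r.
    have h4 : 0 <= modulus (f c0) * `|u| by rewrite mulr_ge0 ?modulus_ge0.
    by rewrite mulrDl mulrDr mulr1; lra.
  apply: (le_trans (ler_pM (modulus_ge0 _) (modulus_ge0 _) h2 h1)).
  rewrite -/(wexp u).
  have h5 : 0 <= B' * expR (2 * pi) * ((1 + `|u|) * wexp u).
    by rewrite !mulr_ge0 ?expR_ge0// addr_ge0.
  by rewrite /K; lra.
have xt t : a < t < b -> 0 < x0 + t by move=> /andP[ta tb]; rewrite /a in ta; lra.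
have Di t : a < t < b -> mu.-integrable setT (EFin \o D t).
  move=> /xt t0; apply: mu_integrableD => //.
    by apply: mu_integrableZl => //; exact: (@strip_int_integrable _ _ ((x0 + t) +i* y0)).
  by apply: mu_integrableZl => //; exact: pow_wexp_integrable.
have [M DM] : exists M : R, forall t, - (1 / 2) <= t <= 1 / 2 -> \int[mu]_u D t u <= M.
  have [||M HM] := sf y0 (x0 - 1 / 2) (x0 + 1 / 2); first by lra.
    by lra.
  exists (C * M + K * \int[mu]_u ((1 + `|u|) ^+ 1 * wexp u)) => t /andP[t1 t2].
  have [|Mi MM] := HM (x0 + t); first by apply/andP; split; lra.
  rewrite mu_RintegralD//; last 2 first.
    exact: mu_integrableZl.
    by apply: mu_integrableZl => //; exact: pow_wexp_integrable.
  rewrite !mu_RintegralZl//; last exact: pow_wexp_integrable.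
  by rewrite lerD2r ler_wpM2l.
have main : cintegral (fun u => H (- (1 / 2) +i* u)) = cintegral (fun u => H (1 / 2 +i* u)).
  apply: (@complex_strip_shift R H H1 D a b (- (1 / 2)) (1 / 2) M 0) => //; rewrite ?/a ?/b /=; lra.
pose A (s u : R) := (ker u)%:C * f (c0 + s%:C + u *i).
pose L (s u : R) := (ker u)%:C * (f c0 + f1 c0 * (s%:C + u *i)).
have HE (s u : R) : s = 1 / 2 \/ s = - (1 / 2) -> H (s +i* u) = (2 * pi)%:C * (A s u - L s u).
  move=> hs; rewrite /H (csc2_pm_half u hs) rmorphM /A /L tu_split (addrA c0).
  by ring.
have Ai (s : R) : - (1 / 2) <= s -> cintegrable (A s).
  move=> hs; apply: ker_cintegrable => //.
  by rewrite ReD /= -/x0; lra.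
have Li (s : R) : cintegrable (L s).
  have := @ker_cintegrable _ _ 1 (hp_cont_affine (f c0 + f1 c0 * (s%:C - 1)) (f1 c0))
    (strip_int_affine (f c0 + f1 c0 * (s%:C - 1)) (f1 c0)) ltr01.
  by apply: cintegrable_ext => u; rewrite /L; congr (_ * _); ring.
have HI (s : R) : s = 1 / 2 \/ s = - (1 / 2) -> - (1 / 2) <= s ->
    cintegral (fun u => H (s +i* u)) = (2 * pi)%:C * (cintegral (A s) - cintegral (L s)).
  move=> hs hs'; have [Di' DE] := cintegrableB (Ai s hs') (Li s).
  by rewrite (eq_cintegral (fun u => HE s u hs)); have [_ ->] := cintegrableZ (2 * pi)%:C Di';
    rewrite DE.
have h1 : - (1 / 2) <= 1 / 2 :> R by lra.
move: main; rewrite (HI _ (or_intror erefl) (lexx _)) (HI _ (or_introl erefl) h1).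
have p0 : (2 * pi)%:C != 0 :> R[i] by rewrite (inj_eq (@complexI R)) gt_eqF// twopi_gt0.
move=> /(mulfI p0) main.
have UA1 : umbral f c0 = cintegral (A (1 / 2)) by [].
have UA2 : umbral f w = cintegral (A (- (1 / 2))).
  apply: eq_cintegral => u; congr (_ * f (_ + _)).
  rewrite /c0 -addrA; congr (_ + _); rewrite -(rmorph1 (real_complex R)) -rmorphD.
  by congr (_%:C); field.
(* The arguments on the two lines differ by 1, so the linear polynomial changes by its slope, which
   is then multiplied by the mass 1 of the density. *)
have LL : cintegral (L (1 / 2)) - cintegral (L (- (1 / 2))) = f1 c0.
  have [_ <-] := cintegrableB (Li (1 / 2)) (Li (- (1 / 2))).
  have E u : L (1 / 2) u - L (- (1 / 2)) u = f1 c0 * (ker u)%:C.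
    have hE : (- (1 / 2))%:C = (1 / 2)%:C - 1 :> R[i].
      by rewrite -(rmorph1 (real_complex R)) -rmorphB; congr (_%:C); field.
    by rewrite /L hE; ring.
  have ki : cintegrable (fun u : R => (ker u)%:C : R[i]).
    by split; [exact: ker_integrable|rewrite /=; apply: integrable0].
  rewrite (eq_cintegral E); have [_ ->] := cintegrableZ (f1 c0) ki.
  rewrite /cintegral /= Rintegral_ker (_ : \int[mu]_x 0 = 0) ?mulr1//.
  by rewrite /Rintegral integral0.
rewrite UA1 UA2 -LL; move: main => /eqP; rewrite subr_eq => /eqP ->.
by ring.
Qed.

End UmbralShift.

(** * The integral defining f(B) and its independence of the line *)

Section UmbraValue.
Context {R : realType}.
Notation mu := (@lebesgue_measure R).
Implicit Types (t u : R) (w z c : R[i]).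

Section Fixed.
Variables (f f1 f2 : R[i] -> R[i]).
Hypothesis df : forall z, right_half_plane z -> cderiv f z (f1 z).
Hypothesis df1 : forall z, right_half_plane z -> cderiv f1 z (f2 z).
Hypothesis sf : strip_int f.

Let H c := csc2 c * f c.

Let dH c : 0 < complex.Re c < 1 -> cderiv H c (csc2' c * f c + csc2 c * f1 c).
Proof.
case: c => t u /= t01; have /andP[t0 _] := t01.
exact: (cderivM (cderiv_csc2 (unit_exp_neq1 u t01)) (@df (t +i* u) t0)).
Qed.

Let csc2_dominated t1 t2 : 0 < t1 -> t2 < 1 -> exists2 C : R, 0 <= C & forall t u,
  t1 <= t <= t2 -> modulus (H (t +i* u)) <= C * (wexp u * modulus (f ((t +i* 0) + u *i))).
Proof.
move=> t10 t21; pose de := Num.min t1 (1 - t2).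
have de0 : 0 < de by rewrite lt_min t10 subr_gt0.
have [C C0 HC] := csc2_decay de0; exists C => // t u /andP[tt1 tt2].
have t0 := lt_le_trans t10 tt1.
have d1 : de <= t1 by rewrite ge_min lexx.
have d2 : de <= 1 - t2 by rewrite ge_min lexx orbT.
have [||_ h] := HC t u; first by rewrite (ger0_norm (ltW t0)); lra.
  apply: le_trans (Re_le_modulus _); rewrite /= (ger0_norm (ltW t0)).
  exact: le_trans tt1.
have -> : (t +i* 0) + u *i = t +i* u :> R[i].
  by apply/eqP; rewrite eq_complex /= addr0 add0r !eqxx.
by rewrite /H modulusM mulrA ler_wpM2r ?modulus_ge0.
Qed.

Lemma csc2_line_shift t1 t2 : 0 < t1 -> t1 < t2 -> t2 < 1 ->
  cintegral (fun u => csc2 (t1 +i* u) * f (t1 +i* u)) =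
  cintegral (fun u => csc2 (t2 +i* u) * f (t2 +i* u)).
Proof.
move=> t10 t12 t21.
pose a := t1 / 2; pose b := (1 + t2) / 2.
have a0 : 0 < a by rewrite divr_gt0.
have b1 : b < 1 by rewrite /b; lra.
have [C C0 HC] := csc2_dominated a0 b1.
have [M HM] := sf 0 t10 (ltW t12).
have at1 : a < t1 by rewrite /a; lra.
have t2b : t2 < b by rewrite /b; lra.
have m1 : t1 < (t1 + t2) / 2 by lra.
have m2 : (t1 + t2) / 2 < t2 by lra.
have ab01 t : a < t < b -> 0 < t < 1 by move=> /andP[ta tb]; apply/andP; split; lra.
(* The strip contains no singularity; the midpoint serves as a nominal exceptional point. *)
apply: (@complex_strip_shift R H (fun c => csc2' c * f c + csc2 c * f1 c)
  (fun t u => C * (wexp u * modulus (f ((t +i* 0) + u *i)))) a b t1 t2 (C * M) ((t1 + t2) /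
    2)%:C) => //=.
- by move=> c /ab01 c01 _; exact: dH.
- case=> t u /= /ab01 t01 _; have E1 := unit_exp_neq1 u t01.
  have [d dc] := cderiv_csc2' E1; have /andP[t0 _] := t01.
  exact: (cderiv_ccont (cderivD (cderivM dc (@df (t +i* u) t0))
    (cderivM (cderiv_csc2 E1) (@df1 (t +i* u) t0)))).
- apply: ccont_loc_bounded; apply: cderiv_ccont; apply: dH => /=.
  by apply: ab01; rewrite (lt_trans at1)//= (lt_trans m2).
- by move=> t u /andP[ta tb]; apply: HC; rewrite !ltW.
- move=> t /ab01/andP[t0 _]; apply: mu_integrableZl => //.
  exact: (@strip_int_integrable _ _ (t +i* 0)).
- move=> t tt; have [Hi HtM] := HM t tt.
  by rewrite mu_RintegralZl// ler_wpM2l.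
Qed.

Lemma umbra_integrandE t u : 0 < t < 1 ->
  umbra_integrand f t u = (Num.sqrt (2 * pi))^-1%:C * (csc2 (t +i* u) * f (t +i* u)).
Proof.
move=> t01; have iE : 'i * (u -i* t) = t +i* u :> R[i].
  by apply/eqP; rewrite eq_complex /= !mul0r !mul1r !sub0r opprK add0r !eqxx.
rewrite /umbra_integrand /bernoulli_hat iE -mulrA -bernoulli_laplace_csc2//.
congr (_ * (_ * _)); apply: eq_cintegral => x.
by rewrite bernoulli_fun_real.
Qed.

Lemma csc2_cintegrable t : 0 < t < 1 -> cintegrable (fun u => csc2 (t +i* u) * f (t +i* u)).
Proof.
move=> /andP[t0 t1]; have [C C0 HC] := csc2_dominated t0 t1.
have gi := mu_integrableZl C measurableT (@strip_int_integrable _ _ (t +i* 0) sf t0).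
have mF : cmeasurable (fun u => H (t +i* u)).
  have cH u : ccont H (t +i* u) by apply: cderiv_ccont; apply: dH; rewrite /= t0.
  by apply: cmeasurable_continuous => u; have [] := ccont_vertical (cH u).
apply: (cintegrable_dominated mF gi _).1 => u.
by apply: HC; rewrite !lexx.
Qed.

Lemma umbra_integrable t : 0 < t < 1 -> cintegrable (umbra_integrand f t).
Proof.
move=> t01; have [Hi _] := cintegrableZ (Num.sqrt (2 * pi))^-1%:C (csc2_cintegrable t01).
by apply: cintegrable_ext Hi => u; rewrite umbra_integrandE.
Qed.

Lemma umbra_integral_umbral t : 0 < t < 1 -> umbra_integral f t = umbral f 0.
Proof.
have line s : 0 < s < 1 -> umbra_integral f s =
    (2 * pi)^-1%:C * cintegral (fun u => csc2 (s +i* u) * f (s +i* u)).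
  move=> s01; rewrite /umbra_integral (eq_cintegral (fun u => umbra_integrandE u s01)).
  have [_ ->] := cintegrableZ (Num.sqrt (2 * pi))^-1%:C (csc2_cintegrable s01).
  rewrite mulrA -rmorphM; congr (_%:C * _).
  by rewrite -invfM -expr2 sqr_sqrtr// ltW// twopi_gt0.
have h01 : 0 < (1 / 2 : R) < 1 by apply/andP; split; lra.
have half : umbra_integral f (1 / 2) = umbral f 0.
  rewrite line// /umbral.
  have E u : csc2 (1 / 2 +i* u) * f (1 / 2 +i* u) =
      (2 * pi)%:C * ((ker u)%:C * f (0 + (1 / 2)%:C + u *i)).
    rewrite (csc2_pm_half u (or_introl erefl)) rmorphM -mulrA; congr (_ * (_ * f _)).
    by rewrite add0r tu_split.
  rewrite (eq_cintegral E).
  have ki : cintegrable (fun u => (ker u)%:C * f (0 + (1 / 2)%:C + u *i)).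
    apply: ker_cintegrable => //; first by move=> z /df; exact: cderiv_ccont.
    by rewrite /= add0r; lra.
  have [_ ->] := cintegrableZ (2 * pi)%:C ki.
  by rewrite mulrA -rmorphM mulVf ?rmorph1 ?mul1r// gt_eqF// twopi_gt0.
move=> t01; rewrite -half; have /andP[t0 t1] := t01.
have [tl|tg|->//] := ltgtP t (1 / 2); rewrite (line _ t01) (line _ h01); congr (_ * _).
  by apply: csc2_line_shift => //; lra.
by apply/esym; apply: csc2_line_shift => //; lra.
Qed.

End Fixed.

(** The class condition bounds the growth of $f'$, while the umbral value requires that of $f$. The
    mean value inequality on the vertical segment from $\mathrm{Re}\,z$ to $z$ costs a factor
    $|\mathrm{Im}\,z|$, absorbed by raising the exponential rate by 1. *)
Lemma exp_growth_primitive (f f1 : R[i] -> R[i]) :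
  (forall z, right_half_plane z -> cderiv f z (f1 z)) ->
  exp_growth f1 -> exp_growth f.
Proof.
move=> df [s [C [C0 Cb Cf]]].
have fc z : right_half_plane z -> ccont f z by move=> /df; exact: cderiv_ccont.
exists (`|s| + 1), (fun x => modulus (f x%:C) + C x); split.
- by move=> x x0; rewrite addr_ge0 ?modulus_ge0// C0.
- move=> x x0; have [M HM] := Cb x x0.
  have [r r0 [N HN]] := ccont_loc_bounded (fc x%:C x0).
  exists (N + M); have : \forall y \near x, modulus (f y%:C) <= N.
    exists r => // y xy; apply: HN.
    by rewrite -rmorphB modulus_real distrC.
  by move=> HN'; apply: filterS2 HN' HM => y h1 h2; rewrite lerD.
case=> x y x0; rewrite /right_half_plane /= in x0.
have e1 : 1 <= expR ((`|s| + 1) * `|y|).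
  by rewrite -[leLHS]expR0 ler_expR mulr_ge0// addr_ge0.
have mv : modulus (f (x +i* y) - f x%:C) <= C x * expR (`|s| * `|y|) * modulus (y *i : R[i]).
  have <- : x +i* y - x%:C = y *i :> R[i].
    by apply/eqP; rewrite eq_complex /= subrr subr0 !eqxx.
  apply: (@complex_mean_value R f f1) => v /andP[v0 v1].
    apply: df; rewrite /right_half_plane /=.
    by rewrite !mul0r subr0 subrr mulr0 addr0.
  have -> : x%:C + v%:C * (x +i* y - x%:C) = x +i* (v * y).
    by apply/eqP; rewrite eq_complex /= !mul0r subr0 subrr mulr0 !addr0 subr0 add0r !eqxx.
  apply: (le_trans (Cf (x +i* (v * y)) x0)); apply: ler_wpM2l; first exact: C0.
  rewrite ler_expR (le_trans (ler_norm _))// normrM normr_id ler_wpM2l//.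
  by rewrite normrM (ger0_norm v0) ler_piMl.
rewrite modulus_imag in mv.
have e2 : expR (`|s| * `|y|) * `|y| <= expR ((`|s| + 1) * `|y|).
  rewrite mulrDl expRD mul1r ler_wpM2l ?expR_ge0//.
  by have := expR_ge1Dx `|y|; lra.
have h1 : modulus (f (x +i* y)) <= modulus (f x%:C) + modulus (f (x +i* y) - f x%:C).
  by rewrite (le_trans _ (modulusD _ _))// addrC subrK.
rewrite mulrDl (le_trans h1)// lerD//.
  by rewrite ler_peMr ?modulus_ge0.
by rewrite (le_trans mv)// -mulrA ler_wpM2l// C0.
Qed.

End UmbraValue.

(** * Asymptotics of the umbral operator *)

Section LocallyUniform.
Context {R : realType}.

Lemma cvg0_locally_uniformly_compact (g : R -> R -> \bar R) (A e : R) :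
  cvg0_locally_uniformly g -> 0 < e ->
  exists X : R, forall x y : R, X <= x -> `|y| <= A -> (`|g x y| < e%:E)%E.
Proof.
move=> gl e0; have /compact_near_coveringP cK := @segment_compact R (- A) A.
have [|X [_ H]] := cK R (pinfty_nbhs R) (fun x y => (`|g x y| < e%:E)%E) _.
  move=> y0 _; have [V Vy0 HV] := gl y0.
  exists (V, [set x | forall y, V y -> (`|g x y| < e%:E)%E]) => /=.
    by split=> //; exact: HV.
  by move=> [y x] /= [Vy]; apply.
exists (X + 1) => x y Xx yA; apply: (H x); first by rewrite (lt_le_trans _ Xx)// ltrDl.
by rewrite /= in_itv /= -ler_norml.
Qed.

End LocallyUniform.

(** * Integration by parts against the density *)

Section ByParts.
Context {R : realType}.
Notation mu := (@lebesgue_measure R).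
Implicit Types (r rho : R -> R).

Lemma continuous_sigm : continuous (@sigm R).
Proof. by move=> u; exact: (is_derive_continuous (is_derive_sigm u)). Qed.

Lemma is_derive_sigmN (u : R) : is_derive u 1 (fun u : R => sigm (- u)) (- ker u).
Proof.
have -> : (fun u : R => sigm (- u)) = (fun u => 1 - sigm u) by apply/funext => v; rewrite onem_sigm.
by have H := is_derive_sigm u; rewrite -[- ker u]sub0r; apply: is_deriveB.
Qed.

Lemma Rintegral_split0 (g : R -> R) (n : R) : 0 <= n -> continuous g ->
  \int[mu]_(x in `[- n, n]) g x = \int[mu]_(x in `[- n, 0]) g x + \int[mu]_(x in `[0, n]) g x.
Proof.
move=> n0 gc.
have gi a b : mu.-integrable `[a, b] (EFin \o g).
  by apply: continuous_itv_integrable; exact: continuous_subspaceT.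
have := @Rintegral_itvB R g (BLeft (- n)) (BRight n) 0 (gi _ _).
rewrite !bnd_simp => /(_ _ n0); rewrite oppr_le0 => /(_ n0) => H.
have H2 : \int[mu]_(x in `]0, n]) g x = \int[mu]_(x in `[0, n]) g x.
  apply: Rintegral_itv_obnd_cbnd.
  apply: (@mu_integrableS _ `]0, n] `[0, n] _ _ _ _ (gi 0 n)) => //.
  by apply: subset_itvr; rewrite bnd_simp.
by rewrite -H2 -H addrC subrK.
Qed.

(* [sigm] is a primitive of [ker], so both boundary terms and both remaining
   integrals are controlled by the exponentially weighted integral of [rho]. *)
Lemma ker_by_parts r rho (I1 I2 : R) : r 0 = 0 ->
  (forall u : R, is_derive u 1 r (rho u)) -> continuous rho ->
  mu.-integrable setT (EFin \o (fun u => ker u * r u)) ->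
  (forall n : nat, \int[mu]_(u in `[0, n.+1%:R]) (`|rho u| * wexp u) <= I1) ->
  (forall n : nat, \int[mu]_(u in `[- n.+1%:R, 0]) (`|rho u| * wexp u) <= I2) ->
  `|\int[mu]_u (ker u * r u)| <= 2 * (I1 + I2).
Proof.
move=> r00 dr crho ki HI1 HI2.
have cr : continuous r by move=> u; exact: (is_derive_continuous (dr u)).
have ck : continuous (fun u => ker u * r u).
  by move=> u; apply: cvgM; [exact: ker_continuous|exact: cr].
have cs : continuous (fun u => sigm u * rho u).
  by move=> u; apply: cvgM; [exact: continuous_sigm|exact: crho].
have csN : continuous (fun u => sigm (- u) * rho u).
  by move=> u; apply: cvgM; [exact: (is_derive_continuous (is_derive_sigmN u))|exact: crho].
have cw : continuous (fun u => `|rho u| * wexp u).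
  move=> u; apply: cvgM; last exact: wexp_continuous.
  by apply: cvg_norm; exact: crho.
have ci (h : R -> R) (a b : R) : continuous h -> mu.-integrable `[a, b] (EFin \o h).
  by move=> hc; apply: continuous_itv_integrable; exact: continuous_subspaceT.
have cC (c : R) : continuous (fun u => c * `|rho u|).
  by move=> u; apply: cvgM; [exact: cvg_cst|apply: cvg_norm; exact: crho].
(* Meant for the boundary terms. Because [r] vanishes at 0, its value at the far end is an integral
   of [rho]; there [sigm] or its reflection is below [wexp] on the whole interval, since [wexp]
   decreases away from 0. *)
have rbound (a b K : R) : a < b -> (forall u : R, a <= u <= b -> K <= wexp u) -> 0 <= K ->
    K * `|r b - r a| <= \int[mu]_(u in `[a, b]) (`|rho u| * wexp u).
  move=> ab KW K0.
  rewrite -(FTC_derivative ab (fun u _ => dr u) (continuous_subspaceT crho)).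
  apply: (@le_trans _ _ (K * \int[mu]_(u in `[a, b]) `|rho u|)).
    apply: ler_wpM2l => //; apply: mu_le_normr_Rintegral => //; first exact: ci.
    by apply: ci => u; apply: cvg_norm; exact: crho.
  rewrite -mu_RintegralZl//; last by apply: ci => u; apply: cvg_norm; exact: crho.
  apply: mu_le_Rintegral => //; [exact: ci|exact: ci|].
  by move=> u; rewrite /= in_itv /= => /KW h; rewrite mulrC ler_wpM2l.
(* On each half-line the primitive of [ker] is the one that vanishes at the infinite end:
   [- sigm (- u)] here, [sigm u] on the left. *)
have pos n : `|\int[mu]_(u in `[0, n.+1%:R]) (ker u * r u)| <= 2 * I1.
  have n0 : (0 : R) < n.+1%:R by [].
  have dF (u : R) : 0 <= u <= n.+1%:R ->
      is_derive u 1 (fun u => - (sigm (- u) * r u)) (ker u * r u - sigm (- u) * rho u).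
    move=> _; have H1 := is_derive_sigmN u; have H2 := dr u.
    by apply: is_derive_eq; rewrite /GRing.scale /=; ring.
  have cF : continuous (fun u => ker u * r u - sigm (- u) * rho u).
    by move=> u; apply: cvgB; [exact: ck|exact: csN].
  have := FTC_derivative n0 dF (continuous_subspaceT cF).
  rewrite mu_RintegralB//; [|exact: ci|exact: ci].
  rewrite r00 mulr0 oppr0 subr0 => /eqP; rewrite subr_eq => /eqP ->.
  rewrite (le_trans (ler_normD _ _))// mulr_natl mulr2n lerD//.
    rewrite normrN normrM (ger0_norm (sigm_ge0 _)) -[r _]subr0 -r00.
    apply: le_trans (HI1 n); apply: rbound => //; last exact: sigm_ge0.
    move=> u /andP[u0 un]; rewrite (le_trans (sigm_le _))// /wexp (ger0_norm u0) mulrN ler_expR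
      lerN2.
    by apply: (ler_wpM2l (ltW (@twopi_gt0 R))).
  apply: le_trans (HI1 n); apply: mu_le_normr_Rintegral => //; [exact: ci|exact: ci|].
  move=> u; rewrite /= in_itv /= => /andP[u0 _].
  rewrite normrM (ger0_norm (sigm_ge0 _)) mulrC ler_wpM2l//.
  by rewrite (le_trans (sigm_le _))// /wexp (ger0_norm u0) mulrN.
have neg n : `|\int[mu]_(u in `[- n.+1%:R, 0]) (ker u * r u)| <= 2 * I2.
  have n0 : - n.+1%:R < 0 :> R by rewrite oppr_lt0.
  have dF (u : R) : - n.+1%:R <= u <= 0 ->
      is_derive u 1 (fun u => sigm u * r u) (ker u * r u + sigm u * rho u).
    move=> _; have H1 := is_derive_sigm u; have H2 := dr u.
    by apply: is_derive_eq; rewrite /GRing.scale /=; ring.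
  have cF : continuous (fun u => ker u * r u + sigm u * rho u).
    by move=> u; apply: cvgD; [exact: ck|exact: cs].
  have := FTC_derivative n0 dF (continuous_subspaceT cF).
  rewrite mu_RintegralD//; [|exact: ci|exact: ci].
  rewrite r00 mulr0 sub0r => /eqP; rewrite eq_sym -subr_eq eq_sym => /eqP ->.
  rewrite (le_trans (ler_normB _ _))// mulr_natl mulr2n lerD//.
    rewrite normrN normrM (ger0_norm (sigm_ge0 _)) -normrN -[- r _]sub0r -{1}r00.
    apply: le_trans (HI2 n); apply: rbound => //; last exact: sigm_ge0.
    move=> u /andP[un u0]; rewrite (le_trans (sigm_le _))// /wexp (ler0_norm u0) ler_expR.
    rewrite (_ : - (2 * pi * - u) = 2 * pi * u); last by ring.
    by apply: (ler_wpM2l (ltW (@twopi_gt0 R))).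
  apply: le_trans (HI2 n); apply: mu_le_normr_Rintegral => //; [exact: ci|exact: ci|].
  move=> u; rewrite /= in_itv /= => /andP[_ u0].
  rewrite normrM (ger0_norm (sigm_ge0 _)) mulrC ler_wpM2l//.
  by rewrite (le_trans (sigm_le _))// /wexp (ler0_norm u0) mulrN opprK.
have tr := cvgn_comp_subseq (k := S) leqnSn (cvg_truncated_integral ki).
have bnd n : `|\int[mu]_(u in `[- n.+1%:R, n.+1%:R]) (ker u * r u)| <= 2 * (I1 + I2).
  rewrite Rintegral_split0// (le_trans (ler_normD _ _))// mulrDr addrC.
  exact: lerD (pos n) (neg n).
apply: (@cvgr_to_le _ _ _ _ _ _ _ (cvg_norm tr)).
by apply: nearW => n; exact: bnd.
Qed.

End ByParts.

(** * The umbral operator on polynomials *)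

Section UmbralPolynomials.
Context {R : realType}.
Notation mu := (@lebesgue_measure R).
Implicit Types (a : nat -> R[i]) (w x y z h : R[i]).

(** The sequence [a] lists the derivatives at 0, so differentiation is a shift of [a]. The number
    [m] counts terms and exceeds the degree. *)
Definition taylor_poly m a x : R[i] := \sum_(i < m) a i / i`!%:R * x ^+ i.

Lemma taylor_poly0 a x : taylor_poly 0 a x = 0.
Proof. by rewrite /taylor_poly big_ord0. Qed.

Lemma taylor_poly_at0 m a : taylor_poly m.+1 a 0 = a 0%N.
Proof.
rewrite /taylor_poly big_ord_recl fact0 divr1 expr0 mulr1 big1 ?addr0// => i _.
by rewrite expr0n mulr0.
Qed.

Lemma cderiv_taylor_poly m a z :
  cderiv (taylor_poly m.+1 a) z (taylor_poly m (fun i => a i.+1) z).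
Proof.
have := cderiv_taylor_sum a 0 z m.
have -> : \sum_(i < m) a i.+1 / i`!%:R * (z - 0) ^+ i = taylor_poly m (fun i => a i.+1) z.
  by apply: eq_bigr => i _; rewrite subr0.
by apply: cderiv_ext => w; apply: eq_bigr => i _; rewrite subr0.
Qed.

(** Taylor's formula on the whole plane with bound 0, as the [m]-th derivative vanishes
    identically. *)
Lemma taylor_polyD m a x h : taylor_poly m a (x + h) =
  \sum_(j < m) taylor_poly (m - j) (fun i => a (i + j)%N) x / j`!%:R * h ^+ j.
Proof.
pose F j := taylor_poly (m - j) (fun i => a (i + j)%N).
have F0 z : F 0%N z = taylor_poly m a z.
  by rewrite /F subn0; apply: eq_bigr => i _; rewrite addn0.
have dF j z : (j < m)%N -> setT z -> cderiv (F j) z (F j.+1 z).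
  move=> jm _; rewrite (_ : F j.+1 = taylor_poly (m - j.+1) (fun i => a (i.+1 + j)%N)).
    by rewrite /F -(subnSK jm); exact: cderiv_taylor_poly.
  by rewrite /F; congr taylor_poly; apply/funext => i; rewrite addnS.
have FB z : setT z -> modulus (F m z) <= 0 by move=> _; rewrite /F subnn taylor_poly0 modulus0.
have := @complex_taylor R setT x 0 m F I (fun _ _ _ _ => I) dF FB (x + h) I.
rewrite mul0r => H; have /eqP := le_anti (introT andP (conj H (modulus_ge0 _))).
rewrite modulus_eq0 subr_eq0 F0 => /eqP ->.
by apply: eq_bigr => j _; rewrite (addrC x) addrK.
Qed.

Definition ker_moment j : R[i] := cintegral (fun u : R => (ker u)%:C * (u *i) ^+ j).

Lemma ker_moment_cintegrable j : cintegrable (fun u : R => (ker u)%:C * (u *i : R[i]) ^+ j).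
Proof.
have cf : hp_cont (fun z : R[i] => (z - 1) ^+ j).
  move=> z _; have := @cderiv_shift R (fun w => w ^+ j) z (-1) _ (cderivX j _).
  by move=> /cderiv_ccont; rewrite (_ : (fun w => _) = fun w => (w - 1) ^+ j)//; apply/funext =>
    w; rewrite addrC.
have sf : strip_int (fun z : R[i] => (z - 1) ^+ j).
  apply: (@strip_int_poly R _ 1 j) => // z; rewrite mul1r modulusX lerXn2r// ?nnegrE ?modulus_ge0//.
    by rewrite addr_ge0// modulus_ge0.
  by rewrite (le_trans (modulusB _ _))// modulus1 addrC.
have := @ker_cintegrable R _ 1 cf sf ltr01.
by apply: cintegrable_ext => u; rewrite (addrC 1) addrK.
Qed.

Lemma ker_poly_cintegral m (c : nat -> R[i]) :
  cintegrable (fun u : R => (ker u)%:C * \sum_(j < m) c j * (u *i) ^+ j) /\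
  cintegral (fun u : R => (ker u)%:C * \sum_(j < m) c j * (u *i) ^+ j) =
    \sum_(j < m) c j * ker_moment j.
Proof.
elim: m => [|m [IHi IHE]].
  have [Zi ZE] := cintegrableZ 0 (ker_moment_cintegrable 0).
  have E : (fun u : R => 0 * ((ker u)%:C * (u *i : R[i]) ^+ 0)) =1
      (fun u : R => (ker u)%:C * \sum_(j < 0) c j * (u *i) ^+ j).
    by move=> u; rewrite mul0r big_ord0 mulr0.
  by split; [exact: cintegrable_ext E Zi|rewrite -(eq_cintegral E) ZE big_ord0 mul0r].
have [Zi ZE] := cintegrableZ (c m) (ker_moment_cintegrable m).
have [Di DE] := cintegrableD IHi Zi.
have E : (fun u : R => (ker u)%:C * (\sum_(j < m) c j * (u *i) ^+ j) +
      c m * ((ker u)%:C * (u *i : R[i]) ^+ m)) =1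
    (fun u : R => (ker u)%:C * \sum_(j < m.+1) c j * (u *i) ^+ j).
  by move=> u; rewrite big_ord_recr mulrDr mulrCA.
split; first exact: cintegrable_ext E Di.
by rewrite -(eq_cintegral E) DE ZE IHE big_ord_recr.
Qed.

(** The polynomial $L(T)(y) = T(\mathrm{B} + y)$, expanded in moments of the density so that it is
    visibly a polynomial in $y$. *)
Definition umbral_poly m a y : R[i] :=
  \sum_(j < m) taylor_poly (m - j) (fun i => a (i + j)%N) (y + (1 / 2)%:C) / j`!%:R * ker_moment j.

Lemma umbral_taylor_poly m a w : umbral (taylor_poly m a) w = umbral_poly m a w.
Proof.
rewrite /umbral_poly; have [_ <-] := ker_poly_cintegral m
  (fun j => taylor_poly (m - j) (fun i => a (i + j)%N) (w + (1 / 2)%:C) / j`!%:R).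
by apply: eq_cintegral => u; rewrite taylor_polyD.
Qed.

Lemma cderiv_umbral_poly m a y :
  cderiv (umbral_poly m.+1 a) y (umbral_poly m (fun i => a i.+1) y).
Proof.
pose D j := taylor_poly (m - j) (fun i => a (i.+1 + j)%N) (y + (1 / 2)%:C) / j`!%:R * ker_moment j.
have -> : umbral_poly m (fun i => a i.+1) y = \sum_(j < m.+1) D j.
  rewrite big_ord_recr [D _]/D /= subnn taylor_poly0 !mul0r addr0.
  by apply: eq_bigr.
apply: cderiv_sum => j.
have jm : (j <= m)%N by rewrite -ltnS.
have h := @cderiv_shift R (taylor_poly (m.+1 - j) (fun i => a (i + j)%N)) y (1 / 2)%:C
  (taylor_poly (m - j) (fun i => a (i.+1 + j)%N) (y + (1 / 2)%:C)).
rewrite (addrC (1 / 2)%:C) subSn// in h; have {}h := h (cderiv_taylor_poly _ _ _).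
have := cderivZ (j`!%:R^-1 * ker_moment j) h.
rewrite (_ : _ * taylor_poly _ _ _ = D j); last by rewrite /D; ring.
by apply: cderiv_ext => z; rewrite (addrC z) subSn//; ring.
Qed.

Lemma umbral_polyP m a :
  exists2 P : {poly R[i]}, (size P <= m)%N & forall y, P.[y] = umbral_poly m a y.
Proof.
exists (\sum_(j < m) (j`!%:R^-1 * ker_moment j) *:
  \sum_(i < m - j) (a (i + j)%N / i`!%:R) *: ('X - (- (1 / 2)%:C)%:P) ^+ i).
  apply: (leq_trans (size_sum _ _ _)); apply/bigmax_leqP => j _.
  apply: (leq_trans (size_scale_leq _ _)); apply: (leq_trans (size_sum _ _ _)).
  apply/bigmax_leqP => i _; apply: (leq_trans (size_scale_leq _ _)).
  by rewrite size_exp_XsubC (leq_trans (ltn_ord i))// leq_subr.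
move=> y; rewrite horner_sum; apply: eq_bigr => j _.
rewrite hornerZ horner_sum /taylor_poly mulrC -mulrA; congr (_ * _).
by apply: eq_bigr => i _; rewrite hornerZ horner_exp hornerXsubC opprK.
Qed.

End UmbralPolynomials.

(** * Remainder estimates against the density *)

Section Asymptotics.
Context {R : realType}.
Notation mu := (@lebesgue_measure R).
Implicit Types (z t : R[i]).

Lemma continuous_modulus (F : R -> R[i]) :
  continuous (fun x : R => complex.Re (F x)) -> continuous (fun x : R => complex.Im (F x)) ->
  continuous (fun x : R => modulus (F x)).
Proof.
move=> cR cI.
rewrite (_ : (fun x : R => modulus _) = (fun x : R =>
  Num.sqrt (complex.Re (F x) * complex.Re (F x) + complex.Im (F x) * complex.Im (F x)))).
  move=> x; apply: (@continuous_comp _ _ _ (fun x : R =>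
    complex.Re (F x) * complex.Re (F x) + complex.Im (F x) * complex.Im (F x)) Num.sqrt);
    last exact: sqrt_continuous.
  by apply: cvgD; apply: cvgM; [exact: cR|exact: cR|exact: cI|exact: cI].
by apply/funext => x; case: (F x) => a b; rewrite -!expr2.
Qed.

Lemma Rintegral_halfline_le (g h : R -> R) (D : set R) (a b e : R) :
  continuous g -> measurable D -> `]a, b[ `<=` D -> (forall u, 0 <= g u) ->
  (forall u, D u -> g u = h u) ->
  (`|\int[mu]_(u in D) (h u)%:E| < e%:E)%E -> \int[mu]_(u in `[a, b]) g u <= e.
Proof.
move=> cg mD sD g0 gh he.
have gi : mu.-integrable `[a, b] (EFin \o g).
  by apply: continuous_itv_integrable; exact: continuous_subspaceT.
have E : (\int[mu]_(u in D) (h u)%:E = \int[mu]_(u in D) (g u)%:E)%E.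
  by apply: eq_integral => u /set_mem /gh ->.
have I0 : (0 <= \int[mu]_(u in D) (g u)%:E)%E by apply: integral_ge0 => u _; rewrite lee_fin.
rewrite E gee0_abs// in he.
rewrite -lee_fin /Rintegral fineK; last exact: integrable_fin_num.
rewrite -integral_itv_bndo_bndc; last first.
  apply/measurable_EFinP; apply: measurable_funTS; exact: continuous_measurable_fun.
rewrite -integral_itv_obnd_cbnd; last first.
  apply/measurable_EFinP; apply: measurable_funTS; exact: continuous_measurable_fun.
apply: le_trans (ltW he); apply: ge0_subset_integral => //.
  apply/measurable_EFinP; apply: measurable_funTS; exact: continuous_measurable_fun.
by move=> u _; rewrite lee_fin.
Qed.

Section Estimate.
Variables (f f1 f2 : R[i] -> R[i]).
Hypothesis df : forall z, right_half_plane z -> cderiv f z (f1 z).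
Hypothesis df1 : forall z, right_half_plane z -> cderiv f1 z (f2 z).
Hypothesis sf : strip_int f.

(** With $G = f(t + \cdot) - T$ and $G_1 = G'$, the components of $G(iu)$ have derivatives
    $-\mathrm{Im}\,G_1(iu)$ and $\mathrm{Re}\,G_1(iu)$. Each goes through [ker_by_parts] with
    constant 2, whence 4. The condition on [c 0] makes $G$ vanish at 0. *)
Lemma ker_remainder_le (c : nat -> R[i]) t p (I1 I2 : R) : 0 < complex.Re t -> c 0%N = f t ->
  (forall n : nat, \int[mu]_(u in `[0, n.+1%:R])
    (modulus (f1 (t + u *i) - taylor_poly p (fun i => c i.+1) (u *i)) * wexp u) <= I1) ->
  (forall n : nat, \int[mu]_(u in `[- n.+1%:R, 0])
    (modulus (f1 (t + u *i) - taylor_poly p (fun i => c i.+1) (u *i)) * wexp u) <= I2) ->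
  modulus (cintegral (fun u => (ker u)%:C * f (t + u *i)) -
    \sum_(j < p.+1) c j / j`!%:R * ker_moment j) <= 4 * (I1 + I2).
Proof.
move=> t0 c0 HI1 HI2.
pose G z := f (t + z) - taylor_poly p.+1 c z.
pose G1 z := f1 (t + z) - taylor_poly p (fun i => c i.+1) z.
have tU u : right_half_plane (t + (0 +i* u)) by rewrite /right_half_plane /= ReD /= addr0.
have dG u : cderiv G (0 +i* u) (G1 (0 +i* u)).
  by apply: cderivB; [exact: cderiv_shift (df (tU u))|exact: cderiv_taylor_poly].
have cG1 u : ccont G1 (0 +i* u).
  case: p @G1 {G dG HI1 HI2} => [|p] G1.
    have E : (fun z => f1 (t + z) - 0) =1 G1 by move=> z; rewrite /G1 taylor_poly0.
    by apply: cderiv_ccont (cderiv_ext E (cderivB (cderiv_shift (df1 (tU u))) (cderiv_cst 0 _))).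
  by apply: cderiv_ccont (cderivB (cderiv_shift (df1 (tU u))) (cderiv_taylor_poly _ _ _)).
have cR : continuous (fun u : R => complex.Re (G1 (u *i))).
  by move=> u; have [] := ccont_vertical (cG1 u).
have cI : continuous (fun u : R => complex.Im (G1 (u *i))).
  by move=> u; have [] := ccont_vertical (cG1 u).
have cIN : continuous (fun u : R => - complex.Im (G1 (u *i))).
  by move=> u; apply: cvgN; exact: cI.
have cM := continuous_modulus cR cI.
have G00 : G 0 = 0 by rewrite /G addr0 taylor_poly_at0 c0 subrr.
have kf : cintegrable (fun u => (ker u)%:C * f (t + u *i)).
  by apply: ker_cintegrable => // z /df; exact: cderiv_ccont.
have [kp kpE] := ker_poly_cintegral p.+1 (fun j => c j / j`!%:R).
have [[kR kI] kE] := cintegrableB kf kp.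
rewrite -kpE -kE.
have E u : (ker u)%:C * f (t + u *i) - (ker u)%:C * (\sum_(j < p.+1) c j / j`!%:R * (u *i) ^+ j) =
    (ker u)%:C * G (u *i) by rewrite -mulrBr.
rewrite (eq_cintegral E).
move: kR kI; under eq_fun do rewrite E;
  under [X in _ -> mu.-integrable _ X -> _]eq_fun do rewrite E.
have ReE u : complex.Re ((ker u)%:C * G (u *i)) = ker u * complex.Re (G (u *i)).
  by rewrite ReM (_ : complex.Im (ker u)%:C = 0)// mul0r subr0.
have ImE u : complex.Im ((ker u)%:C * G (u *i)) = ker u * complex.Im (G (u *i)).
  by rewrite ImM (_ : complex.Im (ker u)%:C = 0)// mul0r addr0.
under eq_fun do rewrite ReE; under [X in _ -> mu.-integrable _ X -> _]eq_fun do rewrite ImE.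
move=> kR kI.
have bnd (rho : R -> R) (I a b : R) : continuous rho ->
    (forall u, `|rho u| <= modulus (G1 (u *i))) ->
    \int[mu]_(u in `[a, b]) (modulus (G1 (u *i)) * wexp u) <= I ->
    \int[mu]_(u in `[a, b]) (`|rho u| * wexp u) <= I.
  move=> crho rG; apply: le_trans; apply: mu_le_Rintegral => //.
  - apply: continuous_itv_integrable; apply: continuous_subspaceT => u.
    by apply: cvgM; [apply: cvg_norm; exact: crho|exact: wexp_continuous].
  - apply: continuous_itv_integrable; apply: continuous_subspaceT => u.
    by apply: cvgM; [exact: cM|exact: wexp_continuous].
  - by move=> u _; apply: ler_wpM2r; [exact: wexp_ge0|exact: rG].
have bR u : `|- complex.Im (G1 (u *i))| <= modulus (G1 (u *i)).
  by rewrite normrN; exact: Im_le_modulus.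
have bI u : `|complex.Re (G1 (u *i))| <= modulus (G1 (u *i)) by exact: Re_le_modulus.
rewrite (le_trans (modulus_le_ReIm _))//.
rewrite (_ : 4 * (I1 + I2) = 2 * (I1 + I2) + 2 * (I1 + I2)); last by ring.
apply: lerD.
  rewrite (_ : complex.Re _ = \int[mu]_u (ker u * complex.Re (G (u *i)))); last first.
    by apply: eq_Rintegral => u _; exact: ReE.
  apply: (@ker_by_parts R (fun u => complex.Re (G (u *i))) (fun u =>
    - complex.Im (G1 (u *i)))) => //.
  - by rewrite (_ : 0 *i = 0)// G00.
  - by move=> u; have [] := cderiv_vertical (dG u).
  - by move=> n; exact: bnd.
  - by move=> n; exact: bnd.
rewrite (_ : complex.Im _ = \int[mu]_u (ker u * complex.Im (G (u *i)))); last first.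
  by apply: eq_Rintegral => u _; exact: ImE.
apply: (@ker_by_parts R (fun u => complex.Im (G (u *i))) (fun u => complex.Re (G1 (u *i)))) => //.
- by rewrite (_ : 0 *i = 0)// G00.
- by move=> u; have [] := cderiv_vertical (dG u).
- by move=> n; exact: bnd.
- by move=> n; exact: bnd.
Qed.

End Estimate.

End Asymptotics.

(** * Comparison with Taylor polynomials centred at integers *)

Section UmbralAsymptotics.
Context {R : realType}.
Notation mu := (@lebesgue_measure R).
Variables (f : R[i] -> R[i]) (p : nat).
Hypothesis f_analytic : analytic_on (@right_half_plane R) f.
Hypothesis sf : strip_int f.
Hypothesis cT : class_T p (- (2 * pi)) 0 (2 * pi) 0 f^`().
Hypothesis f_top : cvg0_locally_uniformly (fun t xi : R =>
  (modulus (derive1n p.+1 f (t +i* xi)))%:E).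
Implicit Types (y z t : R[i]).

Local Notation F j := (derive1n j%N f).

Lemma cderiv_derive1n j z : right_half_plane z -> cderiv (F j) z (F j.+1 z).
Proof. by have [_] := analytic_derive1n j f_analytic; apply. Qed.

Lemma taylor_remainder_derive1 t u : taylor_remainder p f^`() t u =
  F 1 (t + u *i) - taylor_poly p (fun i => F i.+1 t) (u *i).
Proof.
rewrite /taylor_remainder /taylor_poly big_mkord; congr (_ - _).
by apply: eq_bigr => i _; rewrite -derive1Sn.
Qed.

Lemma weight_right u : 0 < u -> weight (2 * pi) 0 u = wexp u :> R.
Proof. by move=> u0; rewrite /weight /wexp powRr0 mulr1 (gtr0_norm u0) mulNr. Qed.

Lemma weight_left u : u < 0 -> weight (- (2 * pi)) 0 u = wexp u :> R.
Proof. by move=> u0; rewrite /weight /wexp powRr0 mulr1 (ltr0_norm u0) opprK mulrN opprK. Qed.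

Lemma ker_taylor_small (A e : R) : 0 < e -> exists X : R, forall t,
  X <= complex.Re t -> `|complex.Im t| <= A ->
  modulus (cintegral (fun u => (ker u)%:C * f (t + u *i)) -
    \sum_(j < p.+1) F j t / j`!%:R * ker_moment j) <= e.
Proof.
move=> e0; case: cT => _ [_ cr] [_ cl] _.
have e8 : 0 < e / 8 by rewrite divr_gt0.
have [X1 H1] := cvg0_locally_uniformly_compact A cr e8.
have [X2 H2] := cvg0_locally_uniformly_compact A cl e8.
exists (Num.max 1 (Num.max X1 X2)) => t; rewrite !ge_max => /and3P[t1 tX1 tX2] tA.
have t0 : 0 < complex.Re t := lt_le_trans ltr01 t1.
rewrite (_ : e = 4 * (e / 8 + e / 8)); last by field.
pose G u := F 1 (t + u *i) - taylor_poly p (fun i => F i.+1 t) (u *i).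
have cG : continuous (fun u : R => modulus (G u) * wexp u).
  have [cR cI] : continuous (fun u : R => complex.Re (G u)) /\ continuous (fun u : R =>
    complex.Im (G u)).
    have cGu u : ccont (fun z => F 1 (t + z) - taylor_poly p (fun i => F i.+1 t) z) (0 +i* u).
      have tU : right_half_plane (t + (0 +i* u)) by rewrite /right_half_plane /= ReD /= addr0.
      have h := cderiv_shift (@cderiv_derive1n 1 _ tU).
      case: (p) => [|q].
        by apply: cderiv_ccont (cderiv_ext _ (cderivB h (cderiv_cst 0 _))) => z;
          rewrite taylor_poly0.
      exact: cderiv_ccont (cderivB h (cderiv_taylor_poly _ _ _)).
    by split=> u; have [] := ccont_vertical (cGu u).
  by move=> u; apply: cvgM; [exact: continuous_modulus cR cI _|exact: wexp_continuous].
have G0 u : 0 <= modulus (G u) * wexp u by rewrite mulr_ge0 ?modulus_ge0 ?wexp_ge0.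
apply: (@ker_remainder_le R f (F 1) (F 2) _ _ _ (fun i => F i t)) => //.
- by move=> z; exact: (@cderiv_derive1n 0).
- by move=> z; exact: (@cderiv_derive1n 1).
- move=> n; apply: (Rintegral_halfline_le cG _ _ G0 _ (H1 _ _ tX1 tA)) => //.
    by move=> u /=; rewrite !in_itv /= => /andP[-> _].
  move=> u; rewrite /= in_itv /= andbT => u0.
  by rewrite -complex_decomp taylor_remainder_derive1 weight_right.
- move=> n; apply: (Rintegral_halfline_le cG _ _ G0 _ (H2 _ _ tX2 tA)) => //.
    by move=> u /=; rewrite !in_itv /= => /andP[_ ->].
  move=> u; rewrite /= in_itv /= => u0.
  by rewrite -complex_decomp taylor_remainder_derive1 weight_left.
Qed.

(** The derivatives at $n + y + 1/2$ are replaced by their Taylor polynomials at $n$, with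
    coefficients free of $y$. For each order $j$ the remainder involves the same derivative
    $f^{(p+1)}$, which tends to 0. *)
Lemma derive1n_taylor_small (A e : R) : 0 < e -> exists N : nat, forall n y j,
  (N <= n)%N -> -1 < complex.Re y -> modulus y <= A -> (j <= p.+1)%N ->
  modulus (F j (n%:R + (y + (1 / 2)%:C)) -
    taylor_poly (p.+1 - j) (fun i => F (i + j) n%:R) (y + (1 / 2)%:C)) <= e.
Proof.
move=> e0; pose K := (2 + `|A|) ^+ p.+1.
have A1 : 1 <= 2 + `|A| by have := normr_ge0 A; lra.
have K0 : 0 < K by rewrite exprn_gt0// (lt_le_trans ltr01).
have [X HX] := cvg0_locally_uniformly_compact A f_top (divr_gt0 e0 K0).
exists (Num.truncn (`|X| + 1)).+1 => n y j Nn y1 yA jp.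
have nX : `|X| + 1 < n%:R.
  by apply: (lt_le_trans (truncnS_gt _)); rewrite ler_nat.
(* A convex half-strip on which $f^{(p+1)}$ is small. As [n] exceeds [|X| + 1] and Re y exceeds -1,
   it contains both [n] and [n + y + 1/2]. *)
pose S : set R[i] := [set z | `|X| + 1 / 2 <= complex.Re z /\ `|complex.Im z| <= A].
have A0 : 0 <= A by apply: le_trans yA; exact: modulus_ge0.
have ReNat : complex.Re (n%:R : R[i]) = n%:R by rewrite -(rmorph_nat (real_complex R)).
have ImNat : complex.Im (n%:R : R[i]) = 0 by rewrite -(rmorph_nat (real_complex R)).
have Sn : S n%:R by rewrite /S /= ReNat ImNat normr0; split => //; lra.
have Sb : S (n%:R + (y + (1 / 2)%:C)).
  rewrite /S /= !ReD !ImD ReNat ImNat /= add0r addr0; split; first by lra.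
  exact: le_trans (Im_le_modulus _) yA.
have SU z : S z -> right_half_plane z.
  by move=> [zX _]; rewrite /right_half_plane /=; have := normr_ge0 X; lra.
have star b : S b -> forall s : R, 0 <= s <= 1 -> S (n%:R + s%:C * (b - n%:R)).
  move=> [b1 b2] s /andP[s0 s1]; rewrite /S /= !ReD !ImD ReM ImM !ReD !ImD ReN ImN ReNat ImNat /=.
  rewrite !mul0r !subr0 !addr0 add0r; split.
    have h1 : 0 <= s * (complex.Re b - (`|X| + 1 / 2)) by rewrite mulr_ge0// subr_ge0.
    have h2 : 0 <= (1 - s) * (n%:R - (`|X| + 1 / 2)) by rewrite mulr_ge0// subr_ge0//; lra.
    by lra.
  by rewrite normrM (ger0_norm s0) (le_trans _ b2)// ler_piMl.
have FB z : S z -> modulus (F (p.+1 - j + j)%N z) <= e / K.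
  move=> [zX zA]; rewrite subnK// [z]complex_decomp.
  have := HX (complex.Re z) (complex.Im z) _ zA.
  rewrite gee0_abs ?lee_fin ?modulus_ge0// lte_fin => H; apply/ltW/H.
  by have := ler_norm X; lra.
have := @complex_taylor R S n%:R (e / K) (p.+1 - j) (fun i => F (i + j)%N) Sn star
  (fun i z _ Sz => @cderiv_derive1n (i + j) z (SU z Sz)) FB _ Sb.
rewrite (addrC n%:R) addrK add0n => /le_trans; apply.
rewrite -[leRHS](divfK (lt0r_neq0 K0)); apply: (ler_wpM2l (ltW (divr_gt0 e0 K0))).
have h1 : modulus (y + (1 / 2)%:C) <= 2 + `|A|.
  rewrite (le_trans (modulusD _ _))// modulus_real ger0_norm//.
  by have := ler_norm A; lra.
apply: (@le_trans _ _ ((2 + `|A|) ^+ (p.+1 - j))).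
  by rewrite lerXn2r// nnegrE ?modulus_ge0// (le_trans ler01).
by rewrite /K -[X in _ <= _ ^+ X](subnK jp) exprD ler_peMr// ?exprn_ege1// exprn_ge0// (le_trans
  ler01).
Qed.

(** Two errors of size [e / 2] add up: the integral against the Taylor polynomial at $t = n + y +
    1/2$, and the change of its coefficients to those centred at $n$, weighted by finitely many
    moments. *)
Lemma umbral_asymptotic (A e : R) : 0 < e -> exists N : nat, forall n y,
  (N <= n)%N -> -1 < complex.Re y -> modulus y <= A ->
  modulus (umbral f (n%:R + y) - umbral_poly p.+1 (fun i => F i n%:R) y) <= e.
Proof.
move=> e0; have e2 : 0 < e / 2 by rewrite divr_gt0.
pose K := 1 + \sum_(j < p.+1) modulus (@ker_moment R j).
have K0 : 0 < K by rewrite ltr_pwDl// sumr_ge0// => j _; exact: modulus_ge0.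
have [X HX] := ker_taylor_small A e2.
have [N HN] := derive1n_taylor_small A (divr_gt0 e2 K0).
exists (maxn N (Num.truncn (`|X| + 1)).+1) => n y; rewrite geq_max => /andP[Nn Xn] y1 yA.
have nX : `|X| + 1 < n%:R.
  by apply: (lt_le_trans (truncnS_gt _)); rewrite ler_nat.
have ReNat : complex.Re (n%:R : R[i]) = n%:R by rewrite -(rmorph_nat (real_complex R)).
have ImNat : complex.Im (n%:R : R[i]) = 0 by rewrite -(rmorph_nat (real_complex R)).
pose t := n%:R + y + (1 / 2)%:C.
have tX : X <= complex.Re t by rewrite /t !ReD ReNat /=; have := ler_norm X; lra.
have tA : `|complex.Im t| <= A.
  by rewrite /t !ImD ImNat /= add0r addr0 (le_trans (Im_le_modulus _)).
have h1 := HX t tX tA.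
pose T j := taylor_poly (p.+1 - j) (fun i => F (i + j) n%:R) (y + (1 / 2)%:C).
have h2 : modulus (\sum_(j < p.+1) F j t / j`!%:R * ker_moment j -
    \sum_(j < p.+1) T j / j`!%:R * ker_moment j) <= e / 2.
  rewrite -sumrB; apply: (@le_trans _ _ (\sum_(j < p.+1) e / 2 / K * modulus (@ker_moment R j))).
    elim/big_ind2: _ => [|a a' b b' ha hb|j _]; first by rewrite modulus0.
      by rewrite (le_trans (modulusD _ _))// lerD.
    rewrite -mulrBl -mulrBl !modulusM ler_wpM2r ?modulus_ge0//.
    apply: (@le_trans _ _ (modulus (F j t - T j))).
      rewrite ler_piMr ?modulus_ge0// modulusV modulus_nat invf_le1 ?ltr0n ?fact_gt0//.
      by rewrite ler1n fact_gt0.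
    by rewrite /t -addrA; apply: HN => //; rewrite ltnW// ltn_ord.
  rewrite -mulr_sumr -mulrA ler_piMr ?(ltW e2)// ler_pdivrMl// mulr1.
  by rewrite /K lerDr.
rewrite (_ : umbral f (n%:R + y) - _ = (cintegral (fun u => (ker u)%:C * f (t + u *i)) -
    \sum_(j < p.+1) F j t / j`!%:R * ker_moment j) +
  (\sum_(j < p.+1) F j t / j`!%:R * ker_moment j -
    \sum_(j < p.+1) T j / j`!%:R * ker_moment j)); last first.
  by rewrite addrA subrK.
by rewrite (le_trans (modulusD _ _))// (splitr e) lerD.
Qed.

End UmbralAsymptotics.

(** * Mueller-Schleicher sums *)

Section MSUniqueness.
Context {R : realType}.
Implicit Types (f : R[i] -> R[i]) (P : nat -> {poly R[i]}) (y : R[i]).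

(* By Lagrange interpolation at [0, ..., d] the limit is determined by its values
   at natural numbers, which are all equal. *)
Lemma poly_lim_periodic (D : nat -> {poly R[i]}) (d : nat) (L : R[i] -> R[i]) :
  (forall n, (size (D n) <= d)%N) ->
  (forall y, right_half_plane (y + 1) -> (fun n => (D n).[y]) @ \oo --> L y) ->
  (forall y, right_half_plane (y + 1) -> L (y + 1) = L y) ->
  forall y, right_half_plane (y + 1) -> L y = L 0.
Proof.
move=> sD DL Lp y yU.
have natU i : right_half_plane (i%:R + 1 : R[i]).
  rewrite /right_half_plane /= ReD -(rmorph_nat (real_complex R)) /= ltr_wpDl//.
have Lnat i : L i%:R = L 0.
  by elim: i => // i IH; rewrite -natr1 Lp ?IH//; exact: natU.
have d0 : (0 < d.+1)%N by [].
pose l i := tnth (lagrange d.+1 (fun i => i%:R : R[i])) i.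
have xinj : injective (fun i => i%:R : R[i]).
  by move=> i j /eqP; rewrite eqr_nat => /eqP.
have gen (p : {poly R[i]}) : (size p <= d.+1)%N -> p.[y] = \sum_(i < d.+1) (l i).[y] * p.[i%:R].
  move=> sp; rewrite {1}(lagrange_gen d0 xinj sp) horner_sum.
  by apply: eq_bigr => i _; rewrite hornerM hornerC mulrC.
have Ll : L y = \sum_(i < d.+1) (l i).[y] * L i%:R.
  apply: complex_cvgn_unique (DL y yU) _.
  have : (fun n => \sum_(i < d.+1) (l i).[y] * (D n).[i%:R]) @ \oo --> \sum_(i < d.+1) (l i).[y]
    * L i%:R.
    by apply: complex_cvgn_sum => i; apply: complex_cvgnMl; apply: DL; exact: natU.
  by apply: complex_cvgn_ext => n; rewrite -gen// leqW.
have s1 : (size (1%R : {poly R[i]}) <= d.+1)%N by rewrite size_poly1.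
have /esym l1 := gen 1 s1.
rewrite Ll (_ : \sum_(i < d.+1) _ = \sum_(i < d.+1) (l i).[y] * (1 : {poly R[i]}).[i%:R] * L 0).
  by rewrite -mulr_suml l1 hornerC mul1r.
by apply: eq_bigr => i _; rewrite Lnat hornerC mulr1.
Qed.

(** The difference of the two functions $Q$ is the limit of $P_n - P'_n$, of bounded degree, and has
    period 1 because both satisfy the same difference equation. By [poly_lim_periodic] it is
    constant. *)
Lemma MS_Q_unique f P P' y : MS_sequence f P -> MS_sequence f P' -> right_half_plane (y + 1) ->
  MS_Q f P y - MS_Q f P 0 = MS_Q f P' y - MS_Q f P' 0.
Proof.
move=> [[d sP] cP eP] [[d' sP'] cP' eP'].
pose L y := MS_Q f P y - MS_Q f P' y.
have H : forall y, right_half_plane (y + 1) -> L y = L 0.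
  apply: (@poly_lim_periodic (fun n => P n - P' n) (maxn d d')).
  - move=> n; apply: (leq_trans (size_polyD _ _)); rewrite size_polyN.
    by rewrite geq_max (leq_trans (sP n) (leq_maxl _ _)) (leq_trans (sP' n) (leq_maxr _ _)).
  - move=> {}y yU; have := complex_cvgnB (cP' y yU) (cP y yU).
    rewrite (_ : _ - _ = L y); last by rewrite /L /MS_Q; ring.
    by apply: complex_cvgn_ext => n; rewrite /MS_partial hornerD hornerN; ring.
  - move=> {}y yU; have := eP y yU; have := eP' y yU; rewrite /L => <- h.
    move/eqP: h; rewrite subr_eq => /eqP ->; ring.
move=> /H; rewrite /L => h.
move/eqP: h; rewrite subr_eq => /eqP ->; ring.
Qed.

(** Uniqueness lets the sequence picked by [xget] be exchanged for any explicit one; the lower limit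
    1 makes the base point 0. *)
Lemma MS_sumE f P y : MS_sequence f P -> right_half_plane (y + 1) ->
  MS_sum f 1 y = MS_Q f P y - MS_Q f P 0.
Proof.
move=> fP yU; rewrite /MS_sum subrr; apply: MS_Q_unique => //.
by apply: (@xgetI _ _ _ P).
Qed.

End MSUniqueness.

Section MSSequences.
Context {R : realType}.
Implicit Types (f g : R[i] -> R[i]) (a : nat -> R[i]) (w y z : R[i]).

Lemma MS_sequence_intro f (P : nat -> {poly R[i]}) (Q : R[i] -> R[i]) (d : nat) :
  (forall n, (size (P n) <= d)%N) ->
  (forall y, -1 < complex.Re y -> MS_partial f P y @ \oo --> - Q y) ->
  (forall y, -1 < complex.Re y -> Q (y + 1) - Q y = f (y + 1)) ->
  MS_sequence f P /\ forall y, -1 < complex.Re y -> MS_Q f P y = Q y.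
Proof.
move=> sP PQ Qf.
have E y : -1 < complex.Re y -> MS_Q f P y = Q y.
  by move=> /PQ/complex_lim; rewrite /MS_Q => ->; rewrite opprK.
have U y : right_half_plane (y + 1) -> -1 < complex.Re y.
  by rewrite /right_half_plane /= ReD /=; lra.
split=> //; split; first by exists d.
  by move=> y /U /PQ H; apply/cvg_ex; exists (- Q y).
move=> y /U yU; rewrite !E ?Qf//.
by rewrite ReD /=; lra.
Qed.

Lemma taylor_poly_ccont m a z : ccont (taylor_poly m a) z.
Proof.
case: m => [|m]; last exact: cderiv_ccont (cderiv_taylor_poly _ _ _).
by apply: cderiv_ccont (cderiv_ext _ (cderiv_cst 0 z)) => w; rewrite taylor_poly0.
Qed.

Lemma strip_int_taylor_poly m a : strip_int (taylor_poly m a).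
Proof.
apply: (@strip_int_poly R _ (\sum_(i < m) modulus (a i / i`!%:R)) m).
- by apply: sumr_ge0 => i _; exact: modulus_ge0.
- by move=> z _; exact: taylor_poly_ccont.
move=> z; rewrite mulr_suml /taylor_poly.
elim/big_ind2: _ => [|b b' c c' hb hc|i _]; first by rewrite modulus0.
  by rewrite (le_trans (modulusD _ _))// lerD.
have z0 := modulus_ge0 z; have z1 : 1 <= 1 + modulus z by lra.
rewrite modulusM modulusX ler_wpM2l ?modulus_ge0//.
apply: (@le_trans _ _ ((1 + modulus z) ^+ i)).
  by rewrite lerXn2r ?nnegrE//; lra.
by apply: ler_weXn2l => //; exact: ltnW.
Qed.

Lemma umbral_poly_shift m a w : - (1 / 2) < complex.Re w ->
  umbral_poly m.+2 a (w + 1) - umbral_poly m.+2 a w = taylor_poly m.+1 (fun i => a i.+1) (w + 1).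
Proof.
move=> w0; rewrite -!umbral_taylor_poly.
apply: (@umbral_shift R _ _ (taylor_poly m (fun i => a i.+2))) => //.
- by move=> z _; exact: cderiv_taylor_poly.
- by move=> z _; exact: cderiv_taylor_poly.
- by move=> z _; exact: taylor_poly_ccont.
- exact: strip_int_taylor_poly.
Qed.

End MSSequences.

(** * Construction of the two summation sequences *)

Section MullerSchleicher.
Context {R : realType}.
Variables (F : nat -> R[i] -> R[i]) (p : nat).
Implicit Types (w y z : R[i]).
Local Notation f := (F 0).
Hypothesis dF : forall j z, right_half_plane z -> cderiv (F j) z (F j.+1 z).
Hypothesis sf : strip_int f.
Hypothesis umbral_asymptotic : forall A e : R, 0 < e -> exists N : nat, forall n y,
  (N <= n)%N -> -1 < complex.Re y -> modulus y <= A ->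
  modulus (umbral f (n%:R + y) - umbral_poly p.+1 (fun i => F i n%:R) y) <= e.
Hypothesis taylor_small : forall A e : R, 0 < e -> exists N : nat, forall n y j,
  (N <= n)%N -> -1 < complex.Re y -> modulus y <= A -> (j <= p.+1)%N ->
  modulus (F j (n%:R + (y + (1 / 2)%:C)) -
    taylor_poly (p.+1 - j) (fun i => F (i + j)%N n%:R) (y + (1 / 2)%:C)) <= e.

Local Notation U := (@umbral_poly R p.+1).

(* [umbral f w] makes sense for [Re w > -1/2] only; the functional equation
   [umbral_step] extends it to [Re w > -1]. *)
Definition umbral_ext w := umbral f (w + 1) - F 1 (w + 1).

Let Re_nat n : complex.Re (n%:R : R[i]) = n%:R.
Proof. by rewrite -(rmorph_nat (real_complex R)). Qed.

Let shiftU (k : nat) y : (0 < k)%N -> -1 < complex.Re y -> right_half_plane (k%:R + y).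
Proof.
move=> k0 y1; rewrite /right_half_plane /= ReD Re_nat.
have : (1 : R) <= k%:R by rewrite ler1n.
by lra.
Qed.

Let shift1U y : -1 < complex.Re y -> right_half_plane (y + 1).
Proof. by move=> y1; rewrite /right_half_plane /= ReD /=; lra. Qed.

Lemma umbral_step w : - (1 / 2) < complex.Re w -> umbral f (w + 1) - umbral f w = F 1 (w + 1).
Proof.
apply: (@umbral_shift R f (F 1) (F 2)) => //.
- by move=> z; exact: (dF 0).
- by move=> z; exact: (dF 1).
- by move=> z zU; exact: cderiv_ccont (@dF 2 z zU).
Qed.

Lemma umbral_extE w : - (1 / 2) < complex.Re w -> umbral_ext w = umbral f w.
Proof. by move=> w0; rewrite /umbral_ext -(umbral_step w0) subKr. Qed.

Lemma umbral_extS w : -1 < complex.Re w -> umbral_ext (w + 1) - umbral_ext w = F 1 (w + 1).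
Proof.
move=> w0; rewrite umbral_extE; last by rewrite ReD /=; lra.
by rewrite /umbral_ext subKr.
Qed.

Lemma sum_derive1 n y : -1 < complex.Re y ->
  \sum_(1 <= k < n.+1) F 1 (k%:R + y) = umbral_ext (n%:R + y) - umbral_ext y.
Proof.
move=> y1; elim: n => [|n IH]; first by rewrite big_geq// add0r subrr.
have -> : \sum_(1 <= k < n.+2) F 1 (k%:R + y) =
    \sum_(1 <= k < n.+1) F 1 (k%:R + y) + F 1 (n.+1%:R + y).
  by move: (fun k : nat => F 1 (k%:R + y)) => a; rewrite big_nat_recr.
rewrite IH.
have -> : n.+1%:R + y = (n%:R + y) + 1 by rewrite -natr1; ring.
rewrite -(umbral_extS (w := n%:R + y)); first by ring.
by rewrite ReD Re_nat; have : (0 : R) <= n%:R by []; lra.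
Qed.

Lemma cderiv_shift_sum j n y : -1 < complex.Re y ->
  cderiv (fun z => \sum_(1 <= k < n.+1) F j (k%:R + z)) y
    (\sum_(1 <= k < n.+1) F j.+1 (k%:R + y)).
Proof.
move=> y1; rewrite big_add1 big_mkord.
apply: (@cderiv_ext R (fun z => \sum_(i < n) F j (i.+1%:R + z))).
  by move=> z; rewrite big_add1 big_mkord.
by apply: cderiv_sum => i; exact: cderiv_shift (@dF j _ (shiftU (ltn0Sn i) y1)).
Qed.

Lemma umbral_ext_asymptotic (A e : R) : 0 < e -> exists N : nat, forall n y,
  (N <= n)%N -> -1 < complex.Re y -> modulus y <= A ->
  modulus (umbral_ext (n%:R + y) - U (fun i => F i n%:R) y) <= e.
Proof.
move=> e0; have [N HN] := umbral_asymptotic A e0.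
(* The successor forces [n] to be at least 1, so that [n + y] lies where [umbral_ext] agrees with
   [umbral f]. *)
exists N.+1 => n y Nn y1 yA; rewrite umbral_extE; first exact: HN (ltnW Nn) y1 yA.
rewrite ReD Re_nat; have : (1 : R) <= n%:R by rewrite ler1n (leq_ltn_trans _ Nn).
by lra.
Qed.

(** By telescoping, [umbral_ext] is a polynomial minus a finite sum of translates of $f'$, up to an
    error that is locally uniformly small. A uniform limit of continuous functions is continuous. *)
Lemma umbral_ext_ccont y : -1 < complex.Re y -> ccont umbral_ext y.
Proof.
move=> y1 e e0; have e3 : 0 < e / 3 by rewrite divr_gt0.
have [N HN] := umbral_ext_asymptotic (modulus y + 1) e3.
pose H z := U (fun i => F i N%:R) z - \sum_(1 <= k < N.+1) F 1 (k%:R + z).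
have E z : -1 < complex.Re z -> umbral_ext z = (umbral_ext (N%:R + z) - U (fun i =>
  F i N%:R) z) + H z.
  by move=> z1; rewrite /H sum_derive1//; ring.
have cH : ccont H y.
  have cS : ccont (fun z => \sum_(1 <= k < N.+1) F 1 (k%:R + z)) y.
    exact: cderiv_ccont (cderiv_shift_sum 1 N y1).
  move=> d d0; have d2 : 0 < d / 2 by rewrite divr_gt0.
  have [r r0 Hr] := cS _ d2.
  have [q q0 Hq] : exists2 q : R, 0 < q & forall w, modulus (w - y) < q ->
      modulus (U (fun i => F i N%:R) w - U (fun i => F i N%:R) y) < d / 2.
    exact: (cderiv_ccont (cderiv_umbral_poly p (fun i => F i N%:R) y)) d2.
  exists (Num.min r q); first by rewrite lt_min r0.
  move=> w; rewrite lt_min => /andP[wr wq].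
  have -> : H w - H y = (U (fun i => F i N%:R) w - U (fun i => F i N%:R) y) -
      (\sum_(1 <= k < N.+1) F 1 (k%:R + w) - \sum_(1 <= k < N.+1) F 1 (k%:R + y)).
    by rewrite /H; ring.
  by rewrite (splitr d) (le_lt_trans (modulusB _ _))// ltrD ?Hr ?Hq.
have [r r0 Hr] := cH _ e3.
exists (Num.min (Num.min 1 r) (complex.Re y + 1)); first by rewrite !lt_min ltr01 r0 /=; lra.
move=> w; rewrite !lt_min => /andP[/andP[w1 wr] wy].
have wRe : -1 < complex.Re w.
  have := le_lt_trans (Re_le_modulus (w - y)) wy; rewrite ReD ReN ltr_norml => /andP[h _].
  by lra.
have wA : modulus w <= modulus y + 1.
  have -> : w = y + (w - y) by ring.
  by rewrite (le_trans (modulusD _ _))// lerD2l ltW.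
have yA : modulus y <= modulus y + 1 by rewrite lerDl.
pose a := umbral_ext (N%:R + w) - U (fun i => F i N%:R) w.
pose b := umbral_ext (N%:R + y) - U (fun i => F i N%:R) y.
have -> : umbral_ext w - umbral_ext y = a - b + (H w - H y) by rewrite (E _ wRe) (E _ y1) /a /b;
  ring.
have ha : modulus a <= e / 3 by exact: HN.
have hb : modulus b <= e / 3 by exact: HN.
rewrite (le_lt_trans (modulusD _ _))//; have := le_trans (modulusB a b) (lerD ha hb).
by move: (modulus (a - b)) (modulus (H w - H y)) (Hr w wr) => u v; lra.
Qed.

Lemma MS_sequence_derive1 : exists P, MS_sequence (F 1) P /\
  forall y, -1 < complex.Re y -> MS_Q (F 1) P y = umbral_ext y - umbral_ext 0.
Proof.
pose hasP n (P : {poly R[i]}) := (size P <= p.+1)%N /\ forall y, P.[y] = U (fun i => F i n%:R) y.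
have /choice[P0 HP0] : forall n, exists P, hasP n P.
  by move=> n; have [P sP PE] := umbral_polyP p.+1 (fun i => F i n%:R); exists P.
exists (fun n => P0 n - (umbral_ext n%:R)%:P); apply: (@MS_sequence_intro R _ _ _ p.+1).
- move=> n; have [sP _] := HP0 n.
  rewrite (leq_trans (size_polyD _ _))// size_polyN geq_max sP.
  by rewrite (leq_trans (size_polyC_leq1 _)).
- move=> y y1; apply/cvgn_modulusP => e e0; have e2 : 0 < e / 2 by rewrite divr_gt0.
  have [N HN] := umbral_ext_asymptotic (modulus y) e2.
  exists N => n Nn; have [_ PE] := HP0 n.
  rewrite /MS_partial hornerD hornerN hornerC PE sumrB.
  rewrite (sum_derive1 n y1) (_ : \sum_(1 <= k < n.+1) _ = umbral_ext n%:R - umbral_ext 0);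
    last first.
    rewrite -[in RHS](addr0 n%:R) -sum_derive1 ?ltrN10//.
    by apply: eq_bigr => k _; rewrite addr0.
  rewrite (_ : _ - _ = umbral_ext (n%:R + y) - U (fun i => F i n%:R) y); last by ring.
  by apply: le_lt_trans (HN _ _ Nn y1 (lexx _)) _; lra.
- move=> y y1; rewrite -(umbral_extS y1); ring.
Qed.

Let Re_segment a b (s : R) : -1 < complex.Re a -> -1 < complex.Re b -> 0 <= s <= 1 ->
  -1 < complex.Re (a + s%:C * (b - a)).
Proof.
move=> a1 b1 /andP[s0 s1]; rewrite ReD ReM ReD ReN /= mul0r subr0.
rewrite -subr_gt0 (_ : _ - _ = (1 - s) * (complex.Re a + 1) + s * (complex.Re b + 1)); last by ring.
have [s1'|s1'] := ltrP s 1.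
  by rewrite ltr_pwDl// ?mulr_gt0 ?mulr_ge0//; lra.
have -> : s = 1 by apply/le_anti; rewrite s1.
by rewrite subrr mul0r add0r mul1r; lra.
Qed.

Let modulus_segment a b (s A : R) : modulus a <= A -> modulus b <= A -> 0 <= s <= 1 ->
  modulus (a + s%:C * (b - a)) <= A.
Proof.
move=> aA bA /andP[s0 s1].
have -> : a + s%:C * (b - a) = (1 - s)%:C * a + s%:C * b by rewrite rmorphB rmorph1; ring.
rewrite (le_trans (modulusD _ _))// !modulusM !modulus_real (ger0_norm s0).
rewrite ger0_norm ?subr_ge0// (_ : A = (1 - s) * A + s * A); last by ring.
by rewrite lerD// ler_wpM2l// subr_ge0.
Qed.

(* The coefficients of the primitive of the Taylor polynomial of [f] at [n]. *)
Definition primitive_coef n i : R[i] := if i is j.+1 then F j n%:R else 0.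

Definition MS_residual n y := \sum_(1 <= k < n.+1) (f (k%:R + y) - f k%:R) -
  (umbral_poly p.+2 (primitive_coef n) y - umbral_poly p.+2 (primitive_coef n) 0).

Lemma MS_residual0 n : MS_residual n 0 = 0.
Proof.
rewrite /MS_residual subrr subr0 big1// => k _.
by rewrite addr0 subrr.
Qed.

Lemma cderiv_MS_residual n y : -1 < complex.Re y ->
  cderiv (MS_residual n) y (umbral_ext (n%:R + y) - U (fun i => F i n%:R) y - umbral_ext y).
Proof.
move=> y1; have h1 := cderivB (cderiv_shift_sum 0 n y1) (cderiv_cst (\sum_(1 <= k < n.+1) f k%:R)
  y).
have h2 := cderivB (cderiv_umbral_poly p.+1 (primitive_coef n) y)
  (cderiv_cst (umbral_poly p.+2 (primitive_coef n) 0) y).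
have := cderivB h1 h2; rewrite !subr0 (sum_derive1 n y1) addrAC.
by apply: cderiv_ext => z; rewrite /MS_residual sumrB.
Qed.

(** All residuals vanish at 0, and in the difference of two derivatives the common limit cancels,
    leaving two small asymptotic errors. The mean value inequality on the segment from 0 to [y] does
    the rest. *)
Lemma MS_residual_cauchy (A e : R) : 0 < e -> exists N : nat, forall m n y,
  (N <= m)%N -> (N <= n)%N -> -1 < complex.Re y -> modulus y <= A ->
  modulus (MS_residual m y - MS_residual n y) <= e.
Proof.
move=> e0; have A0 : 0 < `|A| + 1 by rewrite ltr_wpDl.
pose d := e / (2 * (`|A| + 1)).
have d0 : 0 < d by rewrite divr_gt0// mulr_gt0.
have [N HN] := umbral_ext_asymptotic A d0; exists N => m n y Nm Nn y1 yA.
pose g n z := umbral_ext (n%:R + z) - U (fun i => F i n%:R) z - umbral_ext z.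
have zero1 : -1 < complex.Re (0 : R[i]) by rewrite /= ltrN10.
have zeroA : modulus (0 : R[i]) <= A by rewrite modulus0; apply: le_trans yA; exact: modulus_ge0.
have /(_ (d + d)) := @complex_mean_value R (fun z => MS_residual m z - MS_residual n z) (fun z =>
  g m z - g n z) 0 y.
rewrite !MS_residual0 !subr0 => H; apply: (@le_trans _ _ ((d + d) * modulus y)).
  apply: H => s s01; have z1 := Re_segment zero1 y1 s01; have zA := modulus_segment zeroA yA s01.
    rewrite subr0 in z1; exact: cderivB (cderiv_MS_residual m z1) (cderiv_MS_residual n z1).
  rewrite subr0 in z1 zA; rewrite /g; move: (HN m _ Nm z1 zA) (HN n _ Nn z1 zA).
  set z := 0 + _; move=> h1 h2.
  have -> : umbral_ext (m%:R + z) - U (fun i => F i m%:R) z - umbral_ext z -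
     (umbral_ext (n%:R + z) - U (fun i => F i n%:R) z - umbral_ext z) =
     (umbral_ext (m%:R + z) - U (fun i => F i m%:R) z) - (umbral_ext (n%:R + z) - U (fun i =>
       F i n%:R) z) by ring.
  by rewrite (le_trans (modulusB _ _))// lerD.
have h : modulus y <= `|A| + 1 by have := ler_norm A; lra.
apply: (le_trans (ler_wpM2l (ltW (addr_gt0 d0 d0)) h)).
by rewrite /d le_eqVlt; apply/orP; left; apply/eqP; field; rewrite gt_eqF.
Qed.

Definition MS_primitive y := - limn (MS_residual ^~ y).

Lemma MS_residual_cvg y : -1 < complex.Re y -> (fun n =>
  MS_residual n y) @ \oo --> - MS_primitive y.
Proof.
move=> y1; have /cvg_ex[l ul] : cvgn (MS_residual ^~ y).
  apply: complex_cauchy_cvg => e e0; have e2 : 0 < e / 2 by rewrite divr_gt0.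
  have [N HN] := MS_residual_cauchy (modulus y) e2; exists N => m n Nm Nn.
  by apply: le_lt_trans (HN m n y Nm Nn y1 (lexx _)) _; lra.
by rewrite /MS_primitive opprK (complex_lim ul).
Qed.

(** Differentiation passes to the limit: adding [umbral_ext y * z] to [MS_residual n z] leaves a
    function whose derivative has modulus at most [e] near [y] for large [n]. The mean value
    inequality is uniform in [n] and survives the limit. *)
Lemma cderiv_MS_primitive y : -1 < complex.Re y -> cderiv MS_primitive y (umbral_ext y).
Proof.
move=> y1 e e0; have e2 : 0 < e / 2 by rewrite divr_gt0.
have [r r0 Hr] := umbral_ext_ccont y1 e2.
have [N HN] := umbral_ext_asymptotic (modulus y + 1) e2.
(* The entry 1 keeps the segment in the disc of the uniform estimate, [r] controls the oscillation
   of [umbral_ext], and [Re y + 1] keeps the real part above -1. *)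
exists (Num.min (Num.min 1 r) (complex.Re y + 1)).
  by rewrite !lt_min ltr01 r0 /=; lra.
move=> h; rewrite !lt_min => /andP[/andP[h1 hr] hy].
have yh1 : -1 < complex.Re (y + h).
  have := le_lt_trans (Re_le_modulus h) hy; rewrite ltr_norml ReD => /andP[? _].
  by lra.
have yA : modulus y <= modulus y + 1 by rewrite lerDl.
have yhA : modulus (y + h) <= modulus y + 1.
  by rewrite (le_trans (modulusD _ _))// lerD2l ltW.
have lim : (fun n => MS_residual n (y + h) - MS_residual n y + umbral_ext y * h) @ \oo -->
    - MS_primitive (y + h) - (- MS_primitive y) + umbral_ext y * h.
  apply: complex_cvgnD; last exact: complex_cvgn_cst.
  by apply: complex_cvgnB; exact: MS_residual_cvg.
have -> : modulus (MS_primitive (y + h) - MS_primitive y - umbral_ext y * h) =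
    modulus (- MS_primitive (y + h) - (- MS_primitive y) + umbral_ext y * h).
  move: (MS_primitive (y + h)) (MS_primitive y) (umbral_ext y * h) => u v w.
  by rewrite -[RHS]modulusN !opprD !opprK.
suff H : \forall n \near \oo, modulus (MS_residual n (y + h) - MS_residual n y + umbral_ext y *
  h) <= e * modulus h.
  exact: (@modulus_lim_le R _ _ _ lim H).
exists N; first by [].
move=> n Nn.
pose g z := umbral_ext (n%:R + z) - U (fun i => F i n%:R) z - umbral_ext z.
have := @complex_mean_value R (fun z => MS_residual n z + umbral_ext y * z) (fun z =>
  g z + umbral_ext y * 1) y (y + h) e.
have -> : y + h - y = h by ring.
have -> : MS_residual n (y + h) + umbral_ext y * (y + h) - (MS_residual n y + umbral_ext y * y) =
  MS_residual n (y + h) - MS_residual n y + umbral_ext y * h.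
  by move: (MS_residual n (y + h)) (MS_residual n y) (umbral_ext y) => a b c; ring.
apply=> s s01.
  have := Re_segment y1 yh1 s01; rewrite (_ : y + h - y = h); last by ring.
  move=> z1; apply: cderivD (cderiv_MS_residual n z1) _.
  exact: cderivZ (cderiv_id _).
have := Re_segment y1 yh1 s01; have := modulus_segment yA yhA s01.
rewrite (_ : y + h - y = h); last by ring.
have : modulus (y + s%:C * h - y) < r.
  rewrite (_ : y + s%:C * h - y = s%:C * h); last by ring.
  rewrite modulusM modulus_real; have /andP[s0 s1] := s01; rewrite (ger0_norm s0).
  by apply: le_lt_trans hr; rewrite ler_piMl ?modulus_ge0.
set z := y + _ => zr zA z1; have := Hr z zr; have := HN n z Nn z1 zA.
set a := umbral_ext _ - _; rewrite /g mulr1 => k1 k2.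
rewrite (_ : _ + _ = a - (umbral_ext z - umbral_ext y)); last by rewrite /a; ring.
by rewrite (le_trans (modulusB _ _))// (splitr e) lerD// ltW.
Qed.

Lemma MS_primitive0 : MS_primitive 0 = 0.
Proof.
have := MS_residual_cvg (y := 0); rewrite /= ltrN10 => /(_ isT) /complex_lim.
rewrite /MS_primitive => _; rewrite (_ : MS_residual ^~ 0 = fun=> 0); last by apply/funext => n;
  exact: MS_residual0.
by rewrite (complex_lim (@complex_cvgn_cst R 0)) oppr0.
Qed.

Lemma sum_consecutive_diff (g : nat -> R[i]) n : \sum_(1 <= k < n.+1) (g k.+1 - g k) = g n.+1 - g
  1%N.
Proof. by rewrite telescope_sumr. Qed.

Lemma MS_primitive1 : MS_primitive 1 = f 1.
Proof.
have one1 : -1 < complex.Re (1 : R[i]) by rewrite /=; lra.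
apply: oppr_inj; apply: complex_cvgn_unique (MS_residual_cvg one1) _.
apply/cvgn_modulusP => e e0; have e2 : 0 < e / 2 by rewrite divr_gt0.
(* This estimate measures displacements as [y + 1/2]; taken at [y = 1/2] and order 0 it compares
   $f(n+1)$ with $T_n(1)$. The telescoped sum minus the shift of $L(S_n)$ is exactly that difference
   minus $f(1)$. *)
have [N HN] := taylor_small 1 e2.
exists N => n Nn; apply: le_lt_trans (_ : e / 2 < e); last by lra.
have half : (1 / 2)%:C + (1 / 2)%:C = 1 :> R[i].
  by rewrite -rmorphD -(rmorph1 (real_complex R)); congr (_%:C); field.
have r1 : -1 < complex.Re ((1 / 2)%:C : R[i]) by rewrite /=; lra.
have m1 : modulus ((1 / 2)%:C : R[i]) <= 1 by rewrite modulus_real ger0_norm//; lra.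
have := HN n (1 / 2)%:C 0%N Nn r1 m1 isT; rewrite half subn0.
congr (modulus _ <= _).
have h0 : - (1 / 2) < complex.Re (0 : R[i]) by rewrite /=; lra.
have := umbral_poly_shift p (primitive_coef n) h0; rewrite add0r => h.
rewrite /MS_residual h.
have -> : \sum_(1 <= k < n.+1) (f (k%:R + 1) - f k%:R) = f (n%:R + 1) - f 1.
  rewrite natr1 -(sum_consecutive_diff (fun k => f k%:R)).
  by apply: eq_bigr => k _; rewrite natr1.
have -> : taylor_poly p.+1 (fun i => F (i + 0)%N n%:R) 1 = taylor_poly p.+1 (fun i =>
  primitive_coef n i.+1) 1.
  by apply: eq_bigr => i _; rewrite addn0.
by ring.
Qed.

Lemma MS_primitive_step y : -1 < complex.Re y -> MS_primitive (y + 1) - MS_primitive y = f (y + 1).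
Proof.
move=> y1; have zero1 : -1 < complex.Re (0 : R[i]) by rewrite /= ltrN10.
pose D z := MS_primitive (1 + z) - MS_primitive z - f (1 + z).
(* By [umbral_extS] the derivative of [D] is 0, so the inequality holds with constant 0 and [D]
   keeps its value at 0. *)
have := @complex_mean_value R D (fun=> 0) 0 y 0.
rewrite mul0r => H; have {H} : modulus (D y - D 0) <= 0.
  apply: H => s s01; last by rewrite modulus0.
  have z1 := Re_segment zero1 y1 s01; move: z1; set z := 0 + _ => z1.
  have z1' : -1 < complex.Re (1 + z) by rewrite ReD /=; lra.
  have zU : right_half_plane (1 + z) by rewrite addrC; exact: shift1U.
  have := cderivB (cderivB (cderiv_shift (cderiv_MS_primitive z1')) (cderiv_MS_primitive z1))
    (cderiv_shift (@dF 0 _ zU)).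
  by rewrite (addrC 1 z) (umbral_extS z1) subrr.
have D0 : D 0 = 0 by rewrite /D addr0 MS_primitive1 MS_primitive0 subr0 subrr.
rewrite D0 subr0 => H; have /eqP := le_anti (introT andP (conj H (modulus_ge0 _))).
by rewrite modulus_eq0 => /eqP; rewrite /D (addrC 1 y) => /subr0_eq.
Qed.

Lemma MS_sequence_primitive : exists P, MS_sequence f P /\
  forall y, -1 < complex.Re y -> MS_Q f P y = MS_primitive y.
Proof.
pose hasP n (P : {poly R[i]}) := (size P <= p.+2)%N /\ forall y, P.[y] = umbral_poly p.+2
  (primitive_coef n) y.
have /choice[P0 HP0] : forall n, exists P, hasP n P.
  by move=> n; have [P sP PE] := umbral_polyP p.+2 (primitive_coef n); exists P.
exists (fun n => P0 n - (umbral_poly p.+2 (primitive_coef n) 0)%:P);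
  apply: (@MS_sequence_intro R _ _ _ p.+2).
- move=> n; have [sP _] := HP0 n.
  rewrite (leq_trans (size_polyD _ _))// size_polyN geq_max sP.
  by rewrite (leq_trans (size_polyC_leq1 _)).
- move=> y /MS_residual_cvg; apply: complex_cvgn_ext => n; have [_ PE] := HP0 n.
  by rewrite /MS_partial hornerD hornerN hornerC PE.
- exact: MS_primitive_step.
Qed.

Lemma MS_sums : [/\ MS_summable f, MS_summable (F 1) &
  forall z, -1 < complex.Re z -> cderiv (MS_sum f 1) z (umbral f 0 + MS_sum (F 1) 1 z)].
Proof.
have [P [fP PQ]] := MS_sequence_primitive; have [P1 [fP1 PQ1]] := MS_sequence_derive1.
split; [by exists P|by exists P1|move=> z z1].
have zero1 : -1 < complex.Re (0 : R[i]) by rewrite /= ltrN10.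
have E y : -1 < complex.Re y -> MS_sum f 1 y = MS_primitive y - MS_primitive 0.
  by move=> y1; rewrite (MS_sumE fP (shift1U y1)) !PQ.
have -> : umbral f 0 + MS_sum (F 1) 1 z = umbral_ext z - 0.
  rewrite (MS_sumE fP1 (shift1U z1)) !PQ1// -umbral_extE; first by ring.
  by rewrite /=; lra.
have z0 : 0 < complex.Re z + 1 by lra.
(* The sum is identified with the primitive only where the real part exceeds -1; the radius
   [Re z + 1] stays in that region. *)
apply: (cderiv_near z0 _ (cderivB (cderiv_MS_primitive z1) (cderiv_cst (MS_primitive 0) z))) =>
  w wz.
rewrite E//; have := le_lt_trans (Re_le_modulus (w - z)) wz.
by rewrite ReD ReN ltr_norml => /andP[? _]; lra.
Qed.

End MullerSchleicher.

Theorem corollary3p2 (R : realType) (f : R[i] -> R[i])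
  (f_analytic : analytic_on (@right_half_plane R) f)
  (f_hyp : exists p : nat, [/\
     class_T p (- (2 * pi)) 0 (2 * pi) 0 f^`(),
     cvg0_locally_uniformly (fun t xi : R =>
       (modulus (derive1n p.+1 f (t +i* xi)))%:E) &
     forall t : R[i], right_half_plane t -> exists M : R,
       \forall u \near t,
         (\int[lebesgue_measure]_xi
            (expR (- (2 * pi) * `|xi|) * modulus (f (u + xi *i)))%:E
          <= M%:E)%E]) :
  [/\ MS_summable f, MS_summable f^`() &
      exists2 fB : R[i], is_umbra_value f fB &
        forall z : R[i], -1 < complex.Re z ->
          is_derive z 1 (MS_sum f 1) (fB + MS_sum f^`() 1 z)].
Proof.
have [p [cT f_top f_int]] := f_hyp.
have df j := (analytic_derive1n j f_analytic).2.
have sf : strip_int f.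
  by apply: strip_int_of_local => // z zU; exact: cderiv_ccont (df 0%N z zU).
have [Sf Sf1 dS] := @MS_sums R (fun j => derive1n j f) p df sf
  (fun A e => umbral_asymptotic f_analytic sf cT f_top A (e := e))
  (fun A e => derive1n_taylor_small f_analytic f_top A (e := e)).
split=> //; exists (umbral f 0); last by move=> z z1; apply/cderivP; exact: dS.
split.
- by apply: (exp_growth_primitive (df 0%N)); case: cT.
- by move=> t; exact: (umbra_integrable (df 0%N) sf).
- by move=> t; exact: (umbra_integral_umbral (df 0%N) (df 1%N) sf).
Qed.
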